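(* Let $1<p<N$, $m>0$, $0\le\mu<\bar\mu=\left(\frac{N-p}{p}\right)^p$, and let $f\in C(\mathbb{R})$ satisfy $$\limsup_{t\to0}\frac{|f(t)|}{|t|^{q-1}}\le A<\infty \quad\text{and}\quad \limsup_{|t|\to\infty}\frac{|f(t)|}{|t|^{p^*-1}}\le A<\infty$$ for some $q>p$ and some constant $A>0$, where $p^*=Np/(N-p)$. Let $u\in W^{1,p}(\mathbb{R}^N)$ be a positive radial weak solution of $$-\Delta_p u-\frac{\mu}{|x|^p}|u|^{p-2}u+m|u|^{p-2}u=f(u)\quad\text{in }\mathbb{R}^N.$$ Then there is a constant $0<C<\infty$ such that $$\lim_{|x|\to\infty}u(x)\,|x|^{\frac{N-1}{p(p-1)}}\,e^{\left(\frac{m}{p-1}\right)^{\frac1p}|x|}=C.$$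
   Context: $N$ is the (integer) dimension and $\Delta_p u=\sum_{i=1}^N\partial_{x_i}(|\nabla u|^{p-2}\partial_{x_i}u)$ is the $p$-Laplacian. Weak solution: $u\in W^{1,p}(\mathbb{R}^N)$ is a weak subsolution (resp. supersolution) of the equation if for every nonnegative $\varphi\in C_0^\infty(\mathbb{R}^N)$ one has $$\int_{\mathbb{R}^N}\left(|\nabla u|^{p-2}\nabla u\cdot\nabla\varphi-\frac{\mu}{|x|^p}|u|^{p-2}u\varphi+m|u|^{p-2}u\varphi\right)\le\ (\text{resp. }\ge)\ \int_{\mathbb{R}^N}f(u)\varphi;$$ it is a weak solution if it is both a weak subsolution and a weak supersolution. A radial function in $W^{1,p}(\mathbb{R}^N)$ is identified with its representative that is continuous on $\mathbb{R}^N\setminus\{0\}$. *)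

(* Defs.v *)
From HB Require Import structures.
From mathcomp Require Import all_boot all_order all_algebra.
From mathcomp Require Import all_classical all_reals all_analysis.

Set Implicit Arguments.
Unset Strict Implicit.
Unset Printing Implicit Defensive.

Import Order.TTheory GRing.Theory Num.Theory.
Import numFieldNormedType.Exports.

Local Open Scope classical_set_scope.
Local Open Scope ring_scope.

Definition rV_display : measure_display. Proof. exact. Qed.

Section measurable_rV.
Context {R : realType} (n : nat).

Let coor (i : 'I_n) (x : 'rV[R]_n) : R := x ord0 i.

Let rV_set0 : g_sigma_preimage coor set0.
Proof. exact: sigma_algebra0. Qed.

Let rV_setC A : g_sigma_preimage coor A -> g_sigma_preimage coor (~` A).
Proof. exact: sigma_algebraC. Qed.

Let rV_bigcup (F : _^nat) : (forall i, g_sigma_preimage coor (F i)) ->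
  g_sigma_preimage coor (\bigcup_i (F i)).
Proof. exact: sigma_algebra_bigcup. Qed.

HB.instance Definition _ := @isMeasurable.Build rV_display
  'rV[R]_n (g_sigma_preimage coor) rV_set0 rV_setC rV_bigcup.

End measurable_rV.

Definition rV_cons {R : realType} n (y : measurableTypeR R * 'rV[R]_n) : 'rV[R]_n.+1 :=
  row_mx y.1%:M y.2 : 'rV[R]_(1 + n).

Lemma rV_cons0 {R : realType} n (y : measurableTypeR R * 'rV[R]_n) : rV_cons y ord0 ord0 = y.1.
Proof.
have -> : y.1 = ((y.1 : R)%:M : 'M[R]_1) ord0 ord0 by rewrite mxE.
rewrite -(row_mxEl (y.1%:M : 'M[R]_1) y.2 ord0 ord0).
apply: (congr1 (fun j : 'I_(1 + n) => row_mx y.1%:M y.2 ord0 j)).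
exact: val_inj.
Qed.

Lemma rV_consS {R : realType} n (y : measurableTypeR R * 'rV[R]_n) i :
  rV_cons y ord0 (lift ord0 i) = y.2 ord0 i.
Proof.
rewrite -(row_mxEr (y.1%:M : 'M[R]_1) y.2 ord0 i).
apply: (congr1 (fun j : 'I_(1 + n) => row_mx y.1%:M y.2 ord0 j)).
exact: val_inj.
Qed.

Lemma measurable_coor {R : realType} n (i : 'I_n) :
  measurable_fun [set: 'rV[R]_n] (fun x => x ord0 i).
Proof.
move=> _ Y mY; rewrite setTI; apply: sub_sigma_algebra => /=.
rewrite -bigcup_seq/=; exists i => /=; first by rewrite mem_index_enum.
by exists Y => //; rewrite setTI.
Qed.

Lemma measurable_fun_rVP d (T : measurableType d) {R : realType} n
    (f : T -> 'rV[R]_n) :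
  measurable_fun [set: T] f <->
  forall i, measurable_fun [set: T] (fun x => f x ord0 i).
Proof.
split=> [mf i|mf].
  exact: (measurableT_comp (measurable_coor i) mf).
move=> _ A mA; rewrite setTI.
suff : g_sigma_preimage (fun i x => f x ord0 i) (f @^-1` A).
  apply: smallest_sub; first exact: sigma_algebra_measurable.
  case: n => [|n] in f mf A mA *; first by rewrite big_ord0.
  rewrite -bigcup_mkord_ord; apply: bigcup_sub => i Ii.
  by move=> B [C mC <-]; exact: mf.
have /= -> := @g_sigma_preimage_comp _ _ n 'rV[R]_n
  (fun i (x : 'rV[R]_n) => x ord0 i) _ f.
by exists A => //; rewrite setTI.
Qed.

Lemma measurable_rV_cons {R : realType} n :
  measurable_fun [set: measurableTypeR R * 'rV[R]_n] (@rV_cons R n).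
Proof.
apply/measurable_fun_rVP => i; case: (unliftP ord0 i) => [j ->|->].
  rewrite (_ : (fun _ => _) = (fun x : 'rV[R]_n => x ord0 j) \o snd).
    exact: (measurableT_comp (measurable_coor j)).
  by apply/funext => y /=; rewrite rV_consS.
rewrite (_ : (fun _ => _) = fst); first exact: measurable_fst.
by apply/funext => y /=; rewrite rV_cons0.
Qed.

(* The n-dimensional Lebesgue measure on the product sigma-algebra of R^n,
   as an iterated product of the one-dimensional one; see lebesgueN_box. *)
Fixpoint lebesgueN {R : realType} (n : nat) : set 'rV[R]_n -> \bar R :=
  match n return set 'rV[R]_n -> \bar R with
  | 0 => fun A => \d_(0 : 'rV[R]_0) A
  | n'.+1 => pushforward
      (product_measure1 lebesgue_measure (@lebesgueN R n')) (@rV_cons R n')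
  end.

Definition rV_box {R : realType} n (A : 'I_n -> set R) : set 'rV[R]_n :=
  [set x | forall i, A i (x ord0 i)].

Lemma measurable_rV_box {R : realType} n (A : 'I_n -> set R) :
  (forall i, measurable (A i)) -> measurable (rV_box A).
Proof.
move=> mA; rewrite (_ : rV_box A =
    \bigcap_(i in [set: 'I_n]) ((fun x : 'rV[R]_n => x ord0 i) @^-1` A i)).
  apply: fin_bigcap_measurable; first exact: finite_finset.
  by move=> i _; rewrite -[X in measurable X]setTI; exact: measurable_coor.
by apply/seteqP; split=> x /= h i; [move=> _; exact: h | exact: (h i I)].
Qed.

Lemma preimage_rV_cons_box {R : realType} n (A : 'I_n.+1 -> set R) :
  @rV_cons R n @^-1` rV_box A = A ord0 `*` rV_box (A \o lift ord0).
Proof.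
apply/seteqP; split=> y /=.
  move=> h; split; first by have := h ord0; rewrite rV_cons0.
  by move=> i; have := h (lift ord0 i); rewrite rV_consS.
move=> [h0 hS] i; case: (unliftP ord0 i) => [j ->|->].
  by rewrite rV_consS; exact: hS.
by rewrite rV_cons0.
Qed.


Section lebesgueN_succ.
Context {R : realType} (n : nat).
Variable m : {sigma_finite_measure set 'rV[R]_n -> \bar R}.
Hypothesis mE : forall A : 'I_n -> set R, (forall i, measurable (A i)) ->
  m (rV_box A) = (\prod_(i < n) lebesgue_measure (A i))%E.

Let succ := pushforward (product_measure1 (@lebesgue_measure R) m) (@rV_cons R n).

Let measurable_preimage A : measurable A -> measurable (@rV_cons R n @^-1` A).
Proof. by move=> mA; rewrite -[X in measurable X]setTI; exact: measurable_rV_cons. Qed.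

Let succ0 : succ set0 = 0%E.
Proof. by rewrite /succ /pushforward preimage_set0 measure0. Qed.

Let succ_ge0 A : (0 <= succ A)%E.
Proof. by rewrite /succ /pushforward; exact: measure_ge0. Qed.

Let succ_sigma_additive : semi_sigma_additive succ.
Proof.
move=> F mF tF mUF; rewrite /succ /pushforward preimage_bigcup.
apply: measure_semi_sigma_additive.
- move=> k; apply: (measurable_preimage (mF k)).
- apply/trivIsetP => /= i j _ _ ij; rewrite -preimage_setI.
  by move/trivIsetP : tF => /(_ _ _ _ _ ij) ->//; rewrite preimage_set0.
- by rewrite -preimage_bigcup; exact: measurable_preimage.
Qed.

HB.instance Definition _ :=
  isMeasure.Build _ _ _ succ succ0 succ_ge0 succ_sigma_additive.

Let succ_box (A : 'I_n.+1 -> set R) : (forall i, measurable (A i)) ->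
  succ (rV_box A) = (\prod_(i < n.+1) lebesgue_measure (A i))%E.
Proof.
move=> mA; rewrite /succ /pushforward preimage_rV_cons_box.
have mAS i : measurable ((A \o lift ord0) i) by exact: mA.
rewrite product_measure1E ?mE ?big_ord_recl//.
- exact: mA.
- exact: measurable_rV_box.
Qed.

Let succ_sigma_finite : sigma_finite setT succ.
Proof.
exists (fun k => rV_box (fun=> `[- k%:R, k%:R]%classic)).
  apply/esym; rewrite -subTset => x _.
  exists (\sum_(i < n.+1) Num.bound `|x ord0 i|)%N => // i /=.
  rewrite in_itv/= -ler_norml (le_trans (ltW (archi_boundP _)))//.
  by rewrite ler_nat (bigD1 i)//= leq_addr.
move=> k; split; first exact: measurable_rV_box.
rewrite succ_box// -ge0_fin_numE; last first.
  by apply: prode_ge0 => i _; exact: measure_ge0.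
apply: (big_ind (fun y : \bar R => y \is a fin_num)) => [||i _]; [by []|exact: fin_numM|].
by rewrite lebesgue_measure_itv/=; case: ifPn.
Qed.

HB.instance Definition _ :=
  Measure_isSigmaFinite.Build _ _ _ succ succ_sigma_finite.

Local Lemma lebesgueN_succ :
  exists2 m' : {sigma_finite_measure set 'rV[R]_n.+1 -> \bar R},
    m' = succ :> (set _ -> _) &
    forall A : 'I_n.+1 -> set R, (forall i, measurable (A i)) ->
      m' (rV_box A) = (\prod_(i < n.+1) lebesgue_measure (A i))%E.
Proof. by exists [the {sigma_finite_measure set _ -> \bar R} of succ]. Qed.

End lebesgueN_succ.

Local Lemma lebesgueN_spec {R : realType} n :
  exists2 m : {sigma_finite_measure set 'rV[R]_n -> \bar R},
    m = @lebesgueN R n :> (set _ -> _) &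
    forall A : 'I_n -> set R, (forall i, measurable (A i)) ->
      m (rV_box A) = (\prod_(i < n) lebesgue_measure (A i))%E.
Proof.
elim: n => [|n [m mE mbox]].
  exists (\d_(0 : 'rV[R]_0)) => // A mA.
  rewrite big_ord0 /= diracE (_ : 0 \in rV_box A)//.
  by rewrite inE => -[].
by have [m' m'E m'box] := lebesgueN_succ mbox; exists m' => //=; rewrite m'E mE.
Qed.

Section lebesgueN_measure.
Context {R : realType} (n : nat).

Let lebesgueN0 : @lebesgueN R n set0 = 0%E.
Proof. by have [m <- _] := @lebesgueN_spec R n. Qed.

Let lebesgueN_ge0 A : (0 <= @lebesgueN R n A)%E.
Proof. by have [m <- _] := @lebesgueN_spec R n. Qed.

Let lebesgueN_sigma_additive : semi_sigma_additive (@lebesgueN R n).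
Proof.
by have [m <- _] := @lebesgueN_spec R n; exact: measure_semi_sigma_additive.
Qed.

HB.instance Definition _ := isMeasure.Build _ _ _ (@lebesgueN R n)
  lebesgueN0 lebesgueN_ge0 lebesgueN_sigma_additive.

Let lebesgueN_sigma_finite : sigma_finite setT (@lebesgueN R n).
Proof. by have [m <- _] := @lebesgueN_spec R n; exact: sigma_finiteT. Qed.

HB.instance Definition _ :=
  Measure_isSigmaFinite.Build _ _ _ (@lebesgueN R n) lebesgueN_sigma_finite.

Lemma lebesgueN_box (A : 'I_n -> set R) : (forall i, measurable (A i)) ->
  lebesgueN (rV_box A) = (\prod_(i < n) lebesgue_measure (A i))%E.
Proof. by have [m <- mbox] := @lebesgueN_spec R n; exact: mbox. Qed.

End lebesgueN_measure.

Section sobolev.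
Context {R : realType} {N : nat}.
Local Notation RN := 'rV[R]_N.
Implicit Types (u phi : RN -> R) (G : RN -> RN) (x y : RN) (i : 'I_N).

Definition dotp x y : R := \sum_(i < N) x ord0 i * y ord0 i.

(* The library's norm `|x| on row vectors is the sup norm. *)
Definition enorm x : R := Num.sqrt (dotp x x).

Definition partial i phi : RN -> R := 'D_(delta_mx ord0 i) phi.

Definition grad phi x : RN := \row_i partial i phi x.

Definition iter_partial (s : seq 'I_N) phi : RN -> R := foldr partial phi s.

Definition smooth phi := forall s : seq 'I_N,
  continuous (iter_partial s phi) /\
  forall i x, derivable (iter_partial s phi) x (delta_mx ord0 i).

Definition test_function phi :=
  smooth phi /\ compact (closure [set x | phi x != 0]).

(* G is a weak gradient of u lying in L^p(R^N; R^N). *)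
Definition weak_gradient (p : R) u G := forall i,
  (fun x => G x ord0 i) \in Lfun (@lebesgueN R N) p%:E /\
  forall phi, test_function phi ->
    \int[@lebesgueN R N]_x (u x * partial i phi x) =
    - \int[@lebesgueN R N]_x (G x ord0 i * phi x).

Definition W1p (p : R) u :=
  u \in Lfun (@lebesgueN R N) p%:E /\ exists G, weak_gradient p u G.

Section equation.
Variables (p mu m : R) (f : R -> R).

(* G stands for the gradient of u. At the single point x = 0 division by zero
   gives mu / |x|^p = 0, which does not affect the integral. *)
Definition weak_form u G phi : R :=
  \int[@lebesgueN R N]_x
    (enorm (G x) `^ (p - 2) * dotp (G x) (grad phi x)
     - mu / enorm x `^ p * (`|u x| `^ (p - 2) * u x) * phi x
     + m * (`|u x| `^ (p - 2) * u x) * phi x).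

(* Weak gradients agree almost everywhere, so "forall G" and "exists G" are
   the same here. *)
Definition weak_subsolution u := W1p p u /\
  forall G, weak_gradient p u G ->
  forall phi, test_function phi -> (forall x, 0 <= phi x) ->
    weak_form u G phi <= \int[@lebesgueN R N]_x (f (u x) * phi x).

Definition weak_supersolution u := W1p p u /\
  forall G, weak_gradient p u G ->
  forall phi, test_function phi -> (forall x, 0 <= phi x) ->
    weak_form u G phi >= \int[@lebesgueN R N]_x (f (u x) * phi x).

Definition weak_solution u := weak_subsolution u /\ weak_supersolution u.

End equation.

Definition radial u := forall x y, enorm x = enorm y -> u x = u y.

End sobolev.

(* Limits along this filter are limits as nrm x tends to +oo. *)
Definition norm_infty {R : realType} {T : Type} (nrm : T -> R) : set_system T :=
  [set P | exists M : R, forall x, M < nrm x -> P x].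

Global Instance norm_infty_filter {R : realType} {T : Type} (nrm : T -> R) :
  Filter (norm_infty nrm).
Proof.
split.
- by exists 0.
- move=> P Q [M MP] [L LQ]; exists (Num.max M L) => x.
  by rewrite gt_max => /andP[/MP ? /LQ ?].
- by move=> P Q PQ [M MP]; exists M => x /MP /PQ.
Qed.

Definition pstar {R : realType} (N : nat) (p : R) : R := N%:R * p / (N%:R - p).

(* Main.v *)
From HB Require Import structures.
Require Import Defs.
From mathcomp Require Import all_boot all_order all_algebra.
From mathcomp Require Import all_classical all_reals all_analysis.
From mathcomp Require Import measurable_realfun ring lra.

Set Implicit Arguments.
Unset Strict Implicit.
Unset Printing Implicit Defensive.

Import Order.TTheory GRing.Theory Num.Theory.
Import numFieldNormedType.Exports.

Local Open Scope classical_set_scope.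
Local Open Scope ring_scope.

(** The solution is radial, so it has a profile V with u(x) = V(|x|^2), and the
    statement is about the decay of v(r) = V(r^2). The proof first turns the weak
    equation into a classical ordinary differential equation for v, then studies
    that equation.

    From the weak equation to the radial equation. The variable s = |x|^2 is used
    instead of |x| because it is a polynomial, so that eta(|x|^2) is a test
    function for every smooth eta supported in ]0, +oo[. On almost every line
    parallel to a coordinate axis, testing the definition of the weak gradient G
    against products shows that u is a primitive of the corresponding component
    of G ([tested_slice], [weak_ftc]); since u is radial, V is
    differentiable almost everywhere and G(x) = 2 V'(|x|^2) x
    ([gradient_radial]). Lebesgue measure pushed forward by |x|^2 has the density
    c s^(N/2 - 1) ([nsq_pushforward]), so testing the equation against plateaus in
    |x|^2 gives an integral identity on the half-line ([profile_tested]), and the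
    du Bois-Reymond lemma turns it into the statement that the flux agrees almost
    everywhere with a continuously differentiable function
    ([flux_continuous_version]). Going back to one good line, V itself is
    continuously differentiable ([profile_C1]). With N - 1 = d the outcome
    ([radial_equation]) is, for large r,
      (|v'|^(p-2) v')' = (m - mu / r^p) v^(p-1) - f(v) - (d / r) |v'|^(p-2) v'
    together with the finiteness of the energy, int (v^p + |v'|^p) < +oo.

    Decay. Finite energy gives v -> 0 ([solution_cvg0]), so f(v) = O(v^(q-1)) is a
    perturbation, and v' < 0 for large r ([solution_decreasing]). The function
    z = (-v' / v)^(p-1) solves the Riccati equation
      z' = (p-1) z^(p/(p-1)) - d z / r - h(r),   h(r) -> m.
    If z left a neighbourhood of the equilibrium zs = beta^(p-1), where
    beta = (m/(p-1))^(1/p), at some large radius, it would later become negative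
    or blow up, hence z -> zs ([logflux_above], [logflux_below]).

    The sharp constant. Consider
      F = p (p-1) zs (ln v + beta r + kappa ln r) + z,  kappa = d / (p (p-1)).
    The linear terms in z - zs cancel in F' because zs is a critical point of the
    Riccati nonlinearity minus its linear substitute
    ([riccati_remainder_quadratic]), and what remains is bounded by
      C (z - zs)^2 + C / r^2 + C / r^p + C v^(q-p).
    Each of these is bounded by the derivative of a bounded function: for
    v^(q-p) because -v'/v stays away from 0, for (z - zs)^2 because the
    equilibrium is repelling, so that (z - zs)^2 grows at a rate comparable to
    itself up to the other terms. Therefore F converges
    ([log_asymptotics]), and so does the logarithm of the quantity in the
    theorem. *)

(** * Smooth steps and plateaus on the line *)

Section smooth_step.
Context {R : realType}.
Implicit Types (t : R) (e : R -> R).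

(** The powers of 1/t make this family of flat functions closed under
    differentiation. *)
Definition flat_exp k t : R := if 0 < t then t^-1 ^+ k * expR (- t^-1) else 0.

Lemma flat_exp_bound k t : `|flat_exp k t| <= k.+1`!%:R * `|t|.
Proof.
rewrite /flat_exp; case: ltP => [t0|t0]; last by rewrite normr0 mulr_ge0.
have i0 : 0 < t^-1 by rewrite invr_gt0.
have i0' := ltW i0.
rewrite ger0_norm; last by rewrite mulr_ge0 ?exprn_ge0 ?expR_ge0.
rewrite expRN (ger0_norm (ltW t0)) ler_pdivrMr ?expR_gt0//.
have := expR_ge1Dxn k (ltW i0).
have fp : 0 < (k.+1`!%:R : R) by rewrite ltr0n fact_gt0.
move=> H; have {}H : t^-1 ^+ k.+1 / k.+1`!%:R <= expR t^-1.
  by apply: le_trans H; rewrite lerDr.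
rewrite ler_pdivrMr// in H.
rewrite -(ler_pM2l i0) -exprS; apply: le_trans H _.
suff -> : t^-1 * (k.+1`!%:R * t * expR t^-1) = expR t^-1 * k.+1`!%:R by [].
by field; rewrite gt_eqF.
Qed.

(** At 0 the difference quotient of the k-th function is the (k+1)-st one, and
    all of them vanish there by the factorial bound on exp. *)
Lemma is_derive_flat_exp k t :
  is_derive t 1 (flat_exp k) (flat_exp k.+2 t - k%:R * flat_exp k.+1 t).
Proof.
have [t0|t0|->] := ltgtP t 0.
- rewrite /flat_exp ltNge (ltW t0)/= mulr0 subr0.
  apply: (@near_eq_is_derive _ _ _ (cst 0)).
  by near=> y; rewrite ltNge ltW//; near: y; exact: lt_nbhsl.
- rewrite /flat_exp t0.
  apply: (@near_eq_is_derive _ _ _ (fun t => t^-1 ^+ k * expR (- t^-1))).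
    near=> y; suff -> : 0 < y by [].
    by near: y; exact: lt_nbhsr.
  have tn : t != 0 by rewrite gt_eqF.
  have dV : is_derive t 1 (fun x : R => x^-1) (- t ^- 2).
    by have /(is_derive_eq (is_deriveV tn (is_derive_id _ _))) : - t ^- 2 *: 1 = - t ^- 2
     by rewrite scaler1.
  have dE : is_derive t 1 (fun x : R => expR (- x^-1)) (expR (- t^-1) * t ^- 2).
    have := @is_derive1_comp R expR (fun x => - x^-1) t _ _ (is_derive_expR _) (is_deriveN dV).
    by rewrite opprK.
  have dX : is_derive t 1 (fun x : R => x^-1 ^+ k) (k%:R * t^-1 ^+ k.-1 * - t ^- 2).
    by have := is_deriveX k dV; rewrite exprfctE.
  have /is_derive_eq := is_deriveM dX dE; apply.
  rewrite /GRing.scale/= -exprVn; case: k {dX} => [|k].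
    by rewrite !expr0 mulr0n; ring.
  by rewrite /= !exprS; ring.
- rewrite {2 3}/flat_exp ltxx/= mulr0 subr0.
  apply/is_derive1_caratheodory; exists (flat_exp k.+1); split.
  + move=> z; rewrite {2}/flat_exp ltxx !subr0 /flat_exp; case: ltP => z0.
      by rewrite exprS; field; rewrite gt_eqF.
    by rewrite mul0r.
  + apply/cvgrPdist_le => /= eps e0.
    have fp : 0 < (k.+2`!%:R : R) by rewrite ltr0n fact_gt0.
    near=> z; rewrite {1}/flat_exp ltxx sub0r normrN.
    apply: le_trans (flat_exp_bound _ _) _.
    rewrite mulrC -ler_pdivlMr//.
    by near: z; exists (eps / k.+2`!%:R) => /=; rewrite ?divr_gt0// => z/=; rewrite sub0r normrN => /ltW.
  + by rewrite /flat_exp ltxx.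
Unshelve. all: by end_near. Qed.

(** A class of functions that contains the smooth step and is visibly stable
    under differentiation, which replaces any computation of higher
    derivatives. *)
Inductive flat_gen : (R -> R) -> Prop :=
| flat_gen_cst c : flat_gen (fun=> c)
| flat_gen_flat k a b : flat_gen (fun t => flat_exp k (a * t + b))
| flat_genD e1 e2 : flat_gen e1 -> flat_gen e2 -> flat_gen (fun t => e1 t + e2 t)
| flat_genM e1 e2 : flat_gen e1 -> flat_gen e2 -> flat_gen (fun t => e1 t * e2 t)
| flat_genV e : (forall t, e t != 0) -> flat_gen e -> flat_gen (fun t => (e t)^-1).

Lemma is_derive_affine (a b t : R) : is_derive t 1 (fun t => a * t + b) a.
Proof.
have := is_deriveD (is_deriveZ a (is_derive_id t 1)) (is_derive_cst b t (1 : R)).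
by move=> /is_derive_eq; apply; rewrite addr0 /GRing.scale/= mulr1.
Qed.

Lemma flat_gen_affine e a b : flat_gen e -> flat_gen (fun t => e (a * t + b)).
Proof.
elim=> [c|k a' b'|e1 e2 _ ? _ ?|e1 e2 _ ? _ ?|e1 e0 _ ?].
- exact: flat_gen_cst.
- under eq_fun do rewrite mulrDr mulrA -addrA.
  exact: flat_gen_flat.
- exact: flat_genD.
- exact: flat_genM.
- by apply: (@flat_genV (fun t => e1 (a * t + b))).
Qed.

Lemma flat_gen_derive e : flat_gen e ->
  exists2 d, flat_gen d & forall t, is_derive t 1 e (d t).
Proof.
elim=> [c|k a b|e1 e2 g1 [d1 gd1 ed1] g2 [d2 gd2 ed2]
  |e1 e2 g1 [d1 gd1 ed1] g2 [d2 gd2 ed2]|e1 e0 g1 [d1 gd1 ed1]].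
- by exists (fun=> 0); [exact: flat_gen_cst|move=> t; exact: is_derive_cst].
- exists (fun t => (flat_exp k.+2 (a * t + b) + (- k%:R) * flat_exp k.+1 (a * t + b)) * a).
    apply: flat_genM; last exact: flat_gen_cst.
    apply: flat_genD; first exact: flat_gen_flat.
    by apply: flat_genM; [exact: flat_gen_cst|exact: flat_gen_flat].
  move=> t; rewrite mulNr.
  exact: (is_derive1_comp (is_derive_flat_exp _ _) (is_derive_affine _ _ _)).
- by exists (fun t => d1 t + d2 t); [exact: flat_genD|move=> t; exact: is_deriveD].
- exists (fun t => e1 t * d2 t + e2 t * d1 t).
    by apply: flat_genD; apply: flat_genM.
  by move=> t; exact: is_deriveM.
- exists (fun t => (-1) * ((e1 t)^-1 * (e1 t)^-1) * d1 t).
    apply: flat_genM => //; apply: flat_genM; first exact: flat_gen_cst.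
    by apply: flat_genM; exact: flat_genV.
  move=> t; have /is_derive_eq := is_deriveV (e0 t) (ed1 t); apply.
  by rewrite /GRing.scale/= expr2 invfM mulN1r.
Qed.

Definition smooth1 e := forall n t, derivable (e^`(n)%classic) t 1.

Lemma flat_gen_smooth1 e : flat_gen e -> smooth1 e.
Proof.
move=> ge n; suff : flat_gen (e^`(n)%classic).
  by move=> /flat_gen_derive[d _ ed] t; have [] := ed t.
elim: n => [|n]; first by rewrite derive1n0.
rewrite derive1nS => /flat_gen_derive[d gd ed].
suff -> : (e^`(n)^`() = d)%classic by [].
by apply/funext => t; rewrite derive1E; have [_ ->] := ed t.
Qed.

Lemma smooth1_derive1 e : smooth1 e -> smooth1 e^`()%classic.
Proof. by move=> se n t; rewrite -derive1Sn; exact: se. Qed.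

Lemma smooth1_derivable e : smooth1 e -> forall t, derivable e t 1.
Proof. by move=> se t; have := se 0%N t; rewrite derive1n0. Qed.

Lemma smooth1_continuous e : smooth1 e -> continuous e.
Proof.
move=> se t; apply: differentiable_continuous.
by apply/derivable1_diffP/smooth1_derivable.
Qed.

Definition step t := flat_exp 0 t / (flat_exp 0 t + flat_exp 0 (1 - t)).

Lemma flat_exp0_ge0 t : 0 <= flat_exp 0 t.
Proof. by rewrite /flat_exp; case: ifP => // _; rewrite mul1r expR_ge0. Qed.

Lemma flat_exp0_gt0 t : 0 < t -> 0 < flat_exp 0 t.
Proof. by rewrite /flat_exp => ->; rewrite mul1r expR_gt0. Qed.

Lemma flat_exp0_le0 t : t <= 0 -> flat_exp 0 t = 0.
Proof. by rewrite /flat_exp ltNge => ->. Qed.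

Let den t := flat_exp 0 t + flat_exp 0 (1 - t).

Let den_gt0 t : 0 < den t.
Proof.
rewrite /den; have [t0|t0] := ltP 0 t.
  by rewrite ltr_wpDr ?flat_exp0_ge0 ?flat_exp0_gt0.
by rewrite ltr_wpDl ?flat_exp0_ge0// flat_exp0_gt0// subr_gt0 (le_lt_trans t0).
Qed.

Lemma step_gen : flat_gen step.
Proof.
have g0 : flat_gen (flat_exp 0).
  have := flat_gen_flat 0 1 0.
  by under eq_fun do rewrite mul1r addr0.
apply: flat_genM => //; apply: (@flat_genV den).
  by move=> t; rewrite gt_eqF.
apply: flat_genD => //.
have := flat_gen_flat 0 (-1) 1.
by under eq_fun do rewrite mulN1r addrC.
Qed.

Lemma step_ge0 t : 0 <= step t.
Proof. by rewrite divr_ge0 ?flat_exp0_ge0 ?ltW ?den_gt0. Qed.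

Lemma step_le1 t : step t <= 1.
Proof. by rewrite ler_pdivrMr ?den_gt0// mul1r lerDl flat_exp0_ge0. Qed.

Lemma step_le0 t : t <= 0 -> step t = 0.
Proof. by move=> t0; rewrite /step flat_exp0_le0// mul0r. Qed.

Lemma step_ge1 t : 1 <= t -> step t = 1.
Proof.
move=> t1; rewrite /step (@flat_exp0_le0 (1 - t)) ?subr_le0//.
by rewrite addr0 divff// gt_eqF// flat_exp0_gt0// (lt_le_trans ltr01).
Qed.

(** The derivative vanishes at 0 and 1 too, by continuity. *)
Lemma step_derive : exists d : R -> R, [/\ continuous d,
  forall t, is_derive t 1 step (d t),
  (forall t, ~~ (0 < t < 1) -> d t = 0) &
  exists M : R, forall t, `|d t| <= M].
Proof.
have [d gd ed] := flat_gen_derive step_gen; exists d.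
have dc : continuous d by exact/smooth1_continuous/flat_gen_smooth1.
have d0 t : ~~ (0 < t < 1) -> d t = 0.
  have dlt s : s < 0 -> d s = 0.
    move=> s0; have [_ <-] := ed s.
    rewrite -(derive_cst (0 : R) s (1 : R)); apply: near_eq_derive.
    by near=> y; rewrite step_le0// ltW//; near: y; exact: lt_nbhsl.
  have dgt s : 1 < s -> d s = 0.
    move=> s0; have [_ <-] := ed s.
    rewrite -(derive_cst (1 : R) s (1 : R)); apply: near_eq_derive.
    by near=> y; rewrite step_ge1// ltW//; near: y; exact: lt_nbhsr.
  rewrite negb_and -!leNgt => /orP[|].
    rewrite le_eqVlt => /orP[/eqP->|/dlt//].
    have h1 : d x @[x --> 0^'-] --> d 0 by apply: cvg_at_left_filter; exact: dc.
    have h2 : d x @[x --> 0^'-] --> 0.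
      apply: cvg_near_cst; near=> x; apply: dlt; near: x; exact: nbhs_left_lt.
    exact: (cvg_unique _ h1 h2).
  rewrite le_eqVlt => /orP[/eqP<-|/dgt//].
  have h1 : d x @[x --> 1^'+] --> d 1 by apply: cvg_at_right_filter; exact: dc.
  have h2 : d x @[x --> 1^'+] --> 0.
    apply: cvg_near_cst; near=> x; apply: dgt; near: x; exact: nbhs_right_gt.
  exact: (cvg_unique _ h1 h2).
split => //.
have [c _ hc] := @EVT_max R (fun t => `|d t|) 0 1 ler01
  (continuous_subspaceT (fun x => continuous_comp (dc x) (@norm_continuous _ _ _))).
exists `|d c| => t; have [t01|/d0->] := boolP (0 < t < 1); last by rewrite normr0.
by apply: hc; rewrite in_itv/=; case/andP: t01 => /ltW-> /ltW->.
Unshelve. all: by end_near. Qed.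

(** For large k, the indicator of [a, b] smoothed at scale 1/k from inside. *)
Definition plateau (k a b : R) t := step (k * (t - a)) * step (k * (b - t)).

Lemma plateau_smooth1 k a b : smooth1 (plateau k a b).
Proof.
apply: flat_gen_smooth1; apply: flat_genM.
  have := flat_gen_affine k (- k * a) step_gen.
  by under eq_fun do rewrite mulNr -mulrBr.
have := flat_gen_affine (- k) (k * b) step_gen.
by under eq_fun do rewrite mulNr addrC -mulrBr.
Qed.

End smooth_step.

(** * Smooth functions generated by the coordinates *)

Section smooth_gen.
Context {R : realType} {N : nat}.
Local Notation RN := 'rV[R]_N.
Implicit Types (g : RN -> R) (x : RN) (i : 'I_N).

(** As in one variable, smoothness of the test functions comes from membership
    in a class stable under partial derivatives. *)
Inductive smooth_gen : (RN -> R) -> Prop :=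
| smooth_gen_cst c : smooth_gen (fun=> c)
| smooth_gen_coord i : smooth_gen (fun x => x ord0 i)
| smooth_gen_comp e g : smooth1 e -> smooth_gen g -> smooth_gen (e \o g)
| smooth_genD g1 g2 : smooth_gen g1 -> smooth_gen g2 ->
    smooth_gen (fun x => g1 x + g2 x)
| smooth_genM g1 g2 : smooth_gen g1 -> smooth_gen g2 ->
    smooth_gen (fun x => g1 x * g2 x).

Lemma is_derive_coord i x (v : RN) : is_derive x v (fun x : RN => x ord0 i) (v ord0 i).
Proof.
have H : h^-1 *: (((fun x : RN => x ord0 i : R) \o shift x) (h *: v) - x ord0 i)
    @[h --> 0^'] --> (v ord0 i : R).
  apply: cvg_near_cst; near=> h.
  have h0 : h != 0 by near: h; exact: nbhs_dnbhs_neq.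
  by rewrite /= !mxE addrK scalerA mulVf// scale1r.
by apply: DeriveDef; [apply/cvg_ex; exists (v ord0 i)|exact: cvg_lim].
Unshelve. all: by end_near. Qed.

Lemma partial_comp i e g x : smooth1 e -> differentiable g x ->
  partial i (e \o g) x = e^`()%classic (g x) * partial i g x.
Proof.
move=> se dg.
have de : differentiable e (g x) by apply/derivable1_diffP/smooth1_derivable.
rewrite /partial deriveE; last exact: differentiable_comp.
rewrite diff_comp//= deriv1E ?deriveE//; last exact/derivable1_diffP.
by rewrite mulrC.
Qed.

Lemma smooth_gen_differentiable g : smooth_gen g -> forall x, differentiable g x.
Proof.
elim=> [c|i|e g0 se _ IH|g1 g2 _ IH1 _ IH2|g1 g2 _ IH1 _ IH2] x.
- exact: differentiable_cst.
- exact: differentiable_coord.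
- by apply: differentiable_comp => //; exact/derivable1_diffP/smooth1_derivable.
- exact: differentiableD.
- exact: differentiableM.
Qed.

Lemma smooth_gen_partial i g : smooth_gen g -> smooth_gen (partial i g).
Proof.
elim=> [c|j|e g0 se gg0 IH|g1 g2 gg1 IH1 gg2 IH2|g1 g2 gg1 IH1 gg2 IH2].
- rewrite (_ : partial _ _ = fun=> 0); first exact: smooth_gen_cst.
  by apply/funext => x; rewrite /partial derive_cst.
- rewrite (_ : partial _ _ = fun=> (delta_mx ord0 i : RN) ord0 j); first exact: smooth_gen_cst.
  by apply/funext => x; rewrite /partial; have [_ ->] := is_derive_coord j x (delta_mx ord0 i).
- rewrite (_ : partial _ _ = fun x => (e^`()%classic \o g0) x * partial i g0 x).
    by apply: smooth_genM => //; apply: smooth_gen_comp => //; exact: smooth1_derive1.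
  by apply/funext => x; rewrite partial_comp//; exact: smooth_gen_differentiable.
- rewrite (_ : partial _ _ = fun x => partial i g1 x + partial i g2 x).
    exact: smooth_genD.
  by apply/funext => x; rewrite /partial deriveD//; apply: diff_derivable;
    exact: smooth_gen_differentiable.
- rewrite (_ : partial _ _ = fun x => g1 x * partial i g2 x + g2 x * partial i g1 x).
    by apply: smooth_genD; apply: smooth_genM.
  by apply/funext => x; rewrite /partial deriveM//; apply: diff_derivable;
    exact: smooth_gen_differentiable.
Qed.

Lemma smooth_gen_smooth g : smooth_gen g -> smooth g.
Proof.
move=> gg s; suff gs : smooth_gen (iter_partial s g).
  split=> [x|i x]; last exact/diff_derivable/smooth_gen_differentiable.
  exact/differentiable_continuous/smooth_gen_differentiable.
by elim: s => [//|i s IH] /=; exact: smooth_gen_partial.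
Qed.

(** The support is a closed subset of a compact cube. *)
Lemma smooth_gen_test g (M : R) : smooth_gen g ->
  (forall x, g x != 0 -> forall i, `|x ord0 i| <= M) -> test_function g.
Proof.
move=> gg gM; split; first exact: smooth_gen_smooth.
have cB : compact [set x : RN | forall i, `[- M, M]%classic (x ord0 i)].
  by apply: (@rV_compact R N (fun=> `[- M, M]%classic)) => i; exact: segment_compact.
apply: (subclosed_compact _ cB); first exact: closed_closure.
have /closure_id -> := compact_closed (@norm_hausdorff _ _) cB.
by apply: closure_subset => x /= /gM xM i; rewrite in_itv/= -ler_norml.
Qed.

End smooth_gen.

(** * Densities, push-forwards and half-open boxes *)

Section density.
Local Open Scope ereal_scope.
Context d (T : measurableType d) (R : realType).
Variables (mu : {measure set T -> \bar R}) (w : T -> R).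
Hypotheses (mw : measurable_fun setT w) (w0 : forall x, (0 <= w x)%R).

Definition density A := \int[mu]_(x in A) (w x)%:E.

Let density0 : density set0 = 0.
Proof. by rewrite /density integral_set0. Qed.

Let density_ge0 A : 0 <= density A.
Proof. by apply: integral_ge0 => x _; rewrite lee_fin. Qed.

Let density_sigma_additive : semi_sigma_additive density.
Proof.
move=> /= F mF tF mUF; rewrite /density; apply: cvg_toP.
  apply: ereal_nondecreasing_is_cvgn => m n mn.
  by apply: lee_sum_nneg_natr => // k _ _; exact: density_ge0.
rewrite ge0_integral_bigcup//=.
- exact/measurable_EFinP/measurable_funTS.
- by move=> x _; rewrite lee_fin.
Qed.

HB.instance Definition _ := isMeasure.Build _ _ _ density
  density0 density_ge0 density_sigma_additive.

Definition density_measure : {measure set T -> \bar R} := density.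

Import HBNNSimple.

(** True for simple functions by definition, and then by monotone convergence. *)
Lemma ge0_integral_density (f : T -> \bar R) :
  measurable_fun setT f -> (forall x, 0 <= f x) ->
  \int[density_measure]_x f x = \int[mu]_x (f x * (w x)%:E).
Proof.
move=> mf f0; pose h := nnsfun_approx measurableT mf.
have hmu n : measurable_fun setT (fun x => (h n x)%:E * (w x)%:E).
  by apply: emeasurable_funM; apply/measurable_EFinP.
transitivity (lim (\int[density_measure]_x (h n x)%:E @[n --> \oo])).
  rewrite -monotone_convergence//=.
  - apply: eq_integral => ? /[!inE] xD; apply/esym/cvg_lim => //=.
    exact: cvg_nnsfun_approx.
  - by move=> n; exact/measurable_EFinP.
  - by move=> n ? _; rewrite lee_fin.
  - by move=> ? _ ? ? mn; rewrite lee_fin; exact/lefP/nd_nnsfun_approx.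
transitivity (lim (\int[mu]_x ((h n x)%:E * (w x)%:E) @[n --> \oo])); last first.
  rewrite -monotone_convergence//=.
  - apply: eq_integral => x _; apply/cvg_lim => //=.
    by apply: cvgeZr => //; exact: cvg_nnsfun_approx.
  - by move=> n ? _; rewrite mule_ge0 ?lee_fin.
  - move=> x _ ? ? mn; rewrite lee_wpmul2r ?lee_fin//.
    exact/lefP/nd_nnsfun_approx.
apply: congr_lim; apply/funext => n.
have nn y x : 0 <= (y * \1_(h n @^-1` [set y]) x)%:E.
  by rewrite EFinM nnfun_muleindic_ge0.
under [LHS]eq_integral do rewrite fimfunE -fsumEFin//.
rewrite [LHS]ge0_integral_fsum//; last first.
  by move=> r; exact/measurable_EFinP/measurableT_comp.
under [RHS]eq_integral.
  move=> x xD; rewrite fimfunE -fsumEFin// ge0_mule_fsuml//.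
  over.
rewrite [RHS]ge0_integral_fsum//; last 2 first.
  - move=> r; apply: emeasurable_funM; last exact/measurable_EFinP.
    by apply/measurable_EFinP; apply/measurableT_comp.
  - by move=> y x _; apply: mule_ge0; [exact: nn|rewrite lee_fin].
apply: eq_fsbigr => r _.
under eq_integral do rewrite EFinM.
rewrite integralZl_indic_nnsfun// integral_indic//= setIT.
under eq_integral do rewrite EFinM -muleA.
have [r0|r0] := leP 0%R r; last first.
  rewrite preimage_nnfun0//= !integral0_eq ?mule0 ?measure0//.
    by rewrite mule0.
  by move=> x _; rewrite indic0 mul0e mule0.
rewrite ge0_integralZl//; last 2 first.
  - by apply: emeasurable_funM; exact/measurable_EFinP.
  - by move=> x _; rewrite mule_ge0// lee_fin.
congr *%E; rewrite /density integral_mkcond; apply: eq_integral => x _.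
by rewrite patchE indicE; case: ifP; rewrite ?mul1e ?mul0e.
Qed.

End density.

Section image_measure.
Context d1 d2 (T1 : measurableType d1) (T2 : measurableType d2) (R : realType).
Variables (mu : {measure set T1 -> \bar R}) (f : T1 -> T2).
Hypothesis mf : measurable_fun setT f.

Definition image_measure : {measure set T2 -> \bar R} :=
  measure_function_pushforward__canonical__measure_function_Measure mu mf.

Lemma image_measureE : image_measure = pushforward mu f :> (set _ -> _).
Proof. by []. Qed.

End image_measure.

Section transfer.
Local Open Scope ereal_scope.
Context d1 d2 (T1 : measurableType d1) (T2 : measurableType d2) (R : realType).
Variables (mu : {measure set T1 -> \bar R}) (nu : {measure set T2 -> \bar R}).
Variable (phi : T1 -> T2).
Hypothesis mphi : measurable_fun setT phi.
Hypothesis nuE : forall A, measurable A -> nu A = mu (phi @^-1` A).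

Lemma ge0_integral_transfer (f : T2 -> \bar R) :
  measurable_fun setT f -> (forall x, 0 <= f x) ->
  \int[nu]_x f x = \int[mu]_y f (phi y).
Proof.
move=> mf f0; rewrite -[RHS]/(\int[_]_(y in phi @^-1` setT) (f \o phi) y).
rewrite -ge0_integral_pushforward//.
rewrite -(image_measureE mu mphi).
by apply: eq_measure_integral => A mA _; exact: nuE.
Qed.

Lemma integrable_transferP (f : T2 -> \bar R) : measurable_fun setT f ->
  nu.-integrable setT f <-> mu.-integrable setT (f \o phi).
Proof.
move=> mf; have mfphi : measurable_fun setT (f \o phi) by exact: measurableT_comp.
have maf : measurable_fun setT (abse \o f) by exact: measurableT_comp.
have E := ge0_integral_transfer maf (fun x => abse_ge0 (f x)).
by split=> /integrableP[_ foo]; apply/integrableP; split => //;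
  [rewrite -[X in X < _]E|rewrite -[X in X < _]/(\int[nu]_x (abse \o f) x) E].
Qed.

Lemma integral_transfer (f : T2 -> \bar R) : nu.-integrable setT f ->
  \int[nu]_x f x = \int[mu]_y f (phi y).
Proof.
move=> intf; have mf := measurable_int _ intf.
rewrite -[RHS]/(\int[_]_(y in phi @^-1` setT) (f \o phi) y).
rewrite -integral_pushforward//; last first.
  by rewrite preimage_setT; exact/(integrable_transferP mf).
rewrite -(image_measureE mu mphi).
by apply: eq_measure_integral => A mA _; exact: nuE.
Qed.

End transfer.

Section rV_measure.
Context {R : realType}.

(** Half-open boxes are stable under intersection and generate the
    sigma-algebra; they are the sets on which measures are compared. *)
Definition cube n (a b : 'I_n -> R) : set 'rV[R]_n :=
  rV_box (fun i => `]a i, b i]%classic).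

Lemma measurable_cube n (a b : 'I_n -> R) : measurable (cube a b).
Proof. by apply: measurable_rV_box => i; exact: measurable_itv. Qed.

Let cubes n : set (set 'rV[R]_n) := [set A | exists a b, A = cube a b].

Lemma cube_cover n : \bigcup_k cube (fun=> - k%:R) (fun=> k%:R) = [set: 'rV[R]_n].
Proof.
apply/seteqP; split=> // x _.
exists (\sum_(i < n) (Num.bound `|x ord0 i|).+1)%N => // i /=.
suff : `|x ord0 i| < (\sum_(i < n) (Num.bound `|x ord0 i|).+1)%N%:R.
  by rewrite ltr_norml in_itv/= => /andP[-> /ltW].
rewrite (lt_le_trans (archi_boundP _))//.
by rewrite ler_nat (bigD1 i)//= (leq_trans _ (leq_addr _ _)).
Qed.

Lemma measurable_rV_cubesE n : @measurable _ 'rV[R]_n = <<s @cubes n >>.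
Proof.
rewrite eqEsubset; split; last first.
  apply: smallest_sub; first exact: sigma_algebra_measurable.
  by move=> _ [a [b ->]]; exact: measurable_cube.
apply: smallest_sub; first exact: smallest_sigma_algebra.
rewrite -bigcup_seq => /= A [i _ [C mC <-]].
rewrite setTI.
suff : image_set_system setT (fun x : 'rV[R]_n => x ord0 i) <<s @cubes n >> C.
  by rewrite /image_set_system/= setTI.
move: C mC; apply: smallest_sub.
  by apply: sigma_algebra_image; exact: smallest_sigma_algebra.
move=> _ [[a b] _ <-]; rewrite /image_set_system/= setTI.
have -> : (fun x : 'rV[R]_n => x ord0 i) @^-1` `]a, b] =
    \bigcup_k cube (fun j => if j == i then a else - k%:R)
                   (fun j => if j == i then b else k%:R).
  apply/seteqP; split=> [x xi|x [k _ /(_ i)]]; last by rewrite eqxx.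
  have : [set: 'rV[R]_n] x by [].
  rewrite -cube_cover => -[k _ xk]; exists k => // j /=.
  by case: ifP => [/eqP->//|_]; exact: xk.
have sa := smallest_sigma_algebra setT (@cubes n).
apply: sigma_algebra_bigcup => k; apply: sub_sigma_algebra.
by eexists; eexists.
Qed.

Lemma cubes_setI n : setI_closed (@cubes n).
Proof.
move=> _ _ [a [b ->]] [c [d ->]].
exists (fun i => Num.max (a i) (c i)), (fun i => Num.min (b i) (d i)).
apply/seteqP; split=> x.
  move=> [xab xcd] i; have := xab i; have := xcd i.
  by rewrite /= !in_itv/= gt_max le_min => /andP[-> ->] /andP[-> ->].
move=> h; split => i; have := h i; rewrite /= !in_itv/= gt_max le_min.
  by move=> /andP[/andP[-> _] /andP[-> _]].
by move=> /andP[/andP[_ ->] /andP[_ ->]].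
Qed.

Lemma measure_rV_unique n (m1 m2 : {measure set 'rV[R]_n -> \bar R}) :
  (forall a b, m1 (cube a b) = m2 (cube a b)) ->
  (forall a b, (m1 (cube a b) < +oo)%E) ->
  forall A, measurable A -> m1 A = m2 A.
Proof.
move=> m12 m1oo A; apply: (measure_unique (@cubes n)
  (fun k => cube (fun=> - k%:R) (fun=> k%:R))).
- exact: measurable_rV_cubesE.
- exact: cubes_setI.
- by move=> k; eexists; eexists.
- exact: cube_cover.
- by move=> _ [a [b ->]].
- by move=> k; exact: m1oo.
Qed.

Lemma lebesgueN_cube n (a b : 'I_n -> R) :
  lebesgueN (cube a b) = (\prod_(i < n) lebesgue_measure `]a i, b i]%classic)%E.
Proof. by rewrite lebesgueN_box// => i; exact: measurable_itv. Qed.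

Lemma lebesgueN_cube_lty n (a b : 'I_n -> R) : (lebesgueN (cube a b) < +oo)%E.
Proof.
rewrite lebesgueN_cube -ge0_fin_numE; last first.
  by apply: prode_ge0 => i _; exact: measure_ge0.
apply: (big_ind (fun y : \bar R => y \is a fin_num)) => [||i _]; [by []|exact: fin_numM|].
by rewrite lebesgue_measure_itv/=; case: ifPn.
Qed.

Definition insert n (i : 'I_n.+1) (y : measurableTypeR R * 'rV[R]_n) : 'rV[R]_n.+1 :=
  \row_j if unlift i j is Some k then y.2 ord0 k else y.1.

Lemma insert_id n (i : 'I_n.+1) y : insert i y ord0 i = y.1.
Proof. by rewrite mxE unlift_none. Qed.

Lemma insert_lift n (i : 'I_n.+1) y k : insert i y ord0 (lift i k) = y.2 ord0 k.
Proof. by rewrite mxE liftK. Qed.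

Lemma measurable_insert n (i : 'I_n.+1) : measurable_fun setT (@insert n i).
Proof.
apply/measurable_fun_rVP => j; case: (unliftP i j) => [k ->|->].
  rewrite (_ : (fun _ => _) = (fun x : 'rV[R]_n => x ord0 k) \o snd).
    exact: (measurableT_comp (measurable_coor k)).
  by apply/funext => y /=; rewrite insert_lift.
rewrite (_ : (fun _ => _) = fst); first exact: measurable_fst.
by apply/funext => y /=; rewrite insert_id.
Qed.

(** The measure is defined by splitting off the first coordinate; comparison on
    boxes shows that any coordinate may be split off. *)
Lemma lebesgueN_insert n (i : 'I_n.+1) (A : set 'rV[R]_n.+1) : measurable A ->
  lebesgueN A = pushforward (lebesgue_measure \x @lebesgueN R n)%E (insert i) A.
Proof.
move=> mA.
have mi : measurable_fun setT (@insert n i) by exact: measurable_insert.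
pose m2 := image_measure (lebesgue_measure \x @lebesgueN R n)%E mi.
suff m12 a b : lebesgueN (cube a b) = m2 (cube a b).
  by apply: (@measure_rV_unique _ (@lebesgueN R n.+1) m2) => // a b;
    exact: lebesgueN_cube_lty.
rewrite lebesgueN_cube /m2 image_measureE /pushforward.
have -> : insert i @^-1` cube a b = `]a i, b i] `*` cube (a \o lift i) (b \o lift i).
  apply/seteqP; split=> y /=.
    move=> h; split; first by have := h i; rewrite insert_id.
    by move=> k; have := h (lift i k); rewrite insert_lift.
  move=> [h0 hS] j; case: (unliftP i j) => [k ->|->].
    by rewrite insert_lift; exact: hS.
  by rewrite insert_id.
rewrite /= product_measure1E//; last exact: measurable_cube.
transitivity (lebesgue_measure `]a i, b i]%classic *
  lebesgueN (cube (a \o lift i) (b \o lift i)))%E => //.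
by rewrite lebesgueN_cube (bigD1_ord i).
Qed.

End rV_measure.

Section fundamental_lemma.
Context {R : realType} {n : nat}.
Local Open Scope ereal_scope.
Local Notation mu := (@lebesgueN R n).

Lemma cube_integral_eq0_ae (K : 'rV[R]_n -> R) :
  (forall a b, mu.-integrable (cube a b) (EFin \o K)) ->
  (forall a b, \int[mu]_(x in cube a b) (K x)%:E = 0) ->
  {ae mu, forall x, K x = 0%R}.
Proof.
move=> iK K0.
have mK : measurable_fun setT K.
  apply/measurable_EFinP; rewrite -cube_cover; apply/measurable_fun_bigcup.
    by move=> k; exact: measurable_cube.
  by move=> k; exact: measurable_int (iK _ _).
have mKp : measurable_fun setT (K^\+)%R by exact: measurable_funrpos.
have mKn : measurable_fun setT (K^\-)%R by exact: measurable_funrneg.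
have p0 x : (0 <= (K^\+)%R x)%R by exact: funrpos_ge0.
have n0 x : (0 <= (K^\-)%R x)%R by exact: funrneg_ge0.
pose m1 := density_measure mu mKp p0.
pose m2 := density_measure mu mKn n0.
have ip a b : mu.-integrable (cube a b) (EFin \o (K^\+)%R).
  by apply: integrable_funrpos => //; exact: measurable_cube.
have in_ a b : mu.-integrable (cube a b) (EFin \o (K^\-)%R).
  by apply: integrable_funrneg => //; exact: measurable_cube.
have m12 A : measurable A -> m1 A = m2 A.
  apply: measure_rV_unique => a b.
    have := K0 a b; rewrite (eq_integral (fun x => ((K^\+)%R x)%:E - ((K^\-)%R x)%:E)).
      rewrite integralB_EFin//; last exact: measurable_cube.
      move=> h; rewrite /m1 /m2 /= /density -[RHS]add0e -h subeK//.
      by apply: integrable_fin_num; [exact: measurable_cube|exact: in_].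
    by move=> x _; rewrite -EFinB -[in LHS](funrposBneg K).
  rewrite /m1/= /density; have /integrableP[_] := ip a b.
  congr (_ < _); apply: eq_integral => x _.
  by rewrite gee0_abs//= lee_fin.
have key (P Q : 'rV[R]_n -> R) A : measurable_fun setT P -> (forall x, (0 <= P x)%R) ->
    measurable A -> \int[mu]_(x in A) (P x)%:E = \int[mu]_(x in A) (Q x)%:E ->
    (forall x, A x -> Q x = 0%R) -> {ae mu, forall x, A x -> P x = 0%R}.
  move=> mP P0 mA PQ An.
  have : \int[mu]_(x in A) `|(P x)%:E| = 0.
    rewrite (eq_integral (EFin \o P)); last first.
      by move=> x _; rewrite gee0_abs// lee_fin.
    by rewrite PQ; apply: integral0_eq => x /An ->.
  move=> /(ae_eq_integral_abs mu mA)-/(_ _); case.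
    exact/measurable_EFinP/measurable_funTS.
  by move=> N [mN N0 sN]; exists N; split => //; apply: subset_trans sN => x /= h;
    contra: h => h /h [].
have h1 : {ae mu, forall x, (0 <= K x)%R -> (K^\+)%R x = 0%R}.
  apply: (key _ (K^\-)%R) => //.
  - by rewrite -[X in measurable X]setTI; exact: measurable_fun_ler.
  - by apply: m12; rewrite -[X in measurable X]setTI; exact: measurable_fun_ler.
  - by move=> x /= x0; apply/max_idPr; rewrite oppr_le0.
have h2 : {ae mu, forall x, (K x <= 0)%R -> (K^\-)%R x = 0%R}.
  apply: (key _ (K^\+)%R) => //.
  - by rewrite -[X in measurable X]setTI; exact: measurable_fun_ler.
  - by apply/esym/m12; rewrite -[X in measurable X]setTI; exact: measurable_fun_ler.
  - by move=> x /= x0; apply/max_idPr.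
apply: filterS2 h1 h2 => x k1 k2; rewrite -(funrposBneg K)/=.
have [x0|x0] := leP 0%R (K x).
  by rewrite !fctE k1// sub0r /funrneg (max_idPr _) ?oppr0// oppr_le0.
by rewrite !fctE k2 ?ltW// subr0 /funrpos (max_idPr _)// ltW.
Qed.

End fundamental_lemma.

(** * Integration of radial functions *)

Section integral_density.
Local Open Scope ereal_scope.
Context d (T : measurableType d) (R : realType).
Variables (mu : {measure set T -> \bar R}) (w : T -> R).
Hypotheses (mw : measurable_fun setT w) (w0 : forall x, (0 <= w x)%R).
Local Notation nu := (density_measure mu mw w0).

Lemma integrable_densityP (f : T -> \bar R) : measurable_fun setT f ->
  nu.-integrable setT f <-> mu.-integrable setT (fun x => f x * (w x)%:E).
Proof.
move=> mf.
have mfw : measurable_fun setT (fun x => f x * (w x)%:E).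
  by apply: emeasurable_funM => //; exact/measurable_EFinP.
have maf : measurable_fun setT (abse \o f) by exact: measurableT_comp.
have E : \int[nu]_x `|f x| = \int[mu]_x `|f x * (w x)%:E|.
  rewrite (ge0_integral_density mu mw w0 maf (fun x => abse_ge0 _)).
  by apply: eq_integral => x _; rewrite abseM [X in _ = _ * X]gee0_abs ?lee_fin.
by split=> /integrableP[_ foo]; apply/integrableP; split => //;
  [rewrite -E|rewrite E].
Qed.

Lemma integral_density (f : T -> \bar R) : measurable_fun setT f ->
  \int[nu]_x f x = \int[mu]_x (f x * (w x)%:E).
Proof.
move=> mf; rewrite [LHS]integralE [RHS]integralE.
rewrite !(ge0_integral_density mu mw w0)//; last 2 first.
- exact: measurable_funeneg.
- exact: measurable_funepos.
congr (_ - _); apply: eq_integral => x _; rewrite ?funeposE ?funenegE.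
  by rewrite maxe_pMl ?lee_fin// mul0e.
by rewrite -mulNe maxe_pMl ?lee_fin// mul0e.
Qed.

End integral_density.

Section radial_measure.
Context {R : realType}.

Definition nsq n (x : 'rV[R]_n) : R := dotp x x.

Lemma nsq_ge0 n (x : 'rV[R]_n) : 0 <= nsq x.
Proof. by apply: sumr_ge0 => i _; rewrite -expr2 sqr_ge0. Qed.

Lemma measurable_nsq n : measurable_fun setT (@nsq n).
Proof.
apply: measurable_sum => i.
by apply: measurable_funM; exact: measurable_coor.
Qed.

Lemma nsqZ n a (x : 'rV[R]_n) : nsq (a *: x) = a ^+ 2 * nsq x.
Proof.
by rewrite /nsq /dotp mulr_sumr; apply: eq_bigr => i _; rewrite !mxE; ring.
Qed.

Lemma nsq_coor n (x : 'rV[R]_n) i : x ord0 i ^+ 2 <= nsq x.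
Proof.
rewrite /nsq /dotp (bigD1 i)//= -expr2 lerDl.
by apply: sumr_ge0 => j _; rewrite -expr2 sqr_ge0.
Qed.

(** Both sides are measures and agree on boxes. *)
Lemma lebesgueN_scale n (a : R) (A : set 'rV[R]_n) : 0 < a -> measurable A ->
  lebesgueN [set x | A (a^-1 *: x)] = ((a ^+ n)%:E * lebesgueN A)%E.
Proof.
move=> a0 mA.
have ms : measurable_fun setT (fun x : 'rV[R]_n => a^-1 *: x).
  apply/measurable_fun_rVP => i; under eq_fun do rewrite mxE.
  by apply: measurable_funM => //; exact: measurable_coor.
have an0 : 0 <= a ^+ n by rewrite exprn_ge0 ?ltW.
pose m1 := image_measure (@lebesgueN R n) ms.
pose m2 := mscale (NngNum an0) (@lebesgueN R n).
suff m12 u v : m2 (cube u v) = m1 (cube u v).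
  apply/esym/(@measure_rV_unique _ _ m2 m1) => // u v.
  by rewrite /m2/= /mscale/= lte_mul_pinfty// ?lee_fin// lebesgueN_cube_lty.
rewrite /m1 image_measureE /pushforward.
have -> : (fun x : 'rV[R]_n => a^-1 *: x) @^-1` cube u v =
    cube (fun i => a * u i) (fun i => a * v i).
  apply/seteqP; split => x h i; have := h i; rewrite /= !in_itv/= !mxE.
    by rewrite ltr_pdivlMl// ler_pdivrMl.
  by rewrite ltr_pdivlMl// ler_pdivrMl.
rewrite /m2/= /mscale/= !lebesgueN_cube.
rewrite [RHS](eq_bigr (fun i => a%:E * lebesgue_measure `]u i, v i]%classic))%E.
  rewrite big_split/=; congr (_ * _)%E.
  by rewrite prodEFin prodr_const card_ord.
move=> i _; rewrite !lebesgue_measure_itv/= !lte_fin ltr_pM2l//.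
by case: ifPn => _; rewrite ?mule0// -!EFinD -EFinM mulrBr.
Qed.

Definition unit_ball n : set 'rV[R]_n := [set x | nsq x <= 1].

Definition ball_vol n : R := fine (lebesgueN (@unit_ball n)).

Lemma measurable_nsq_le n (s : R) : measurable [set x : 'rV[R]_n | nsq x <= s].
Proof.
by rewrite -[X in measurable X]setTI; apply: measurable_fun_ler => //; exact: measurable_nsq.
Qed.

Lemma unit_ball_fin n : lebesgueN (@unit_ball n) \is a fin_num.
Proof.
rewrite ge0_fin_numE//; apply: le_lt_trans (lebesgueN_cube_lty (fun=> -2) (fun=> 1)).
apply: le_measure; rewrite ?inE; [exact: measurable_nsq_le|exact: measurable_cube|].
move=> x /= x1 i /=; rewrite in_itv/=.
have : x ord0 i ^+ 2 <= 1 by apply: le_trans (nsq_coor x i) x1.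
by move=> h; apply/andP; split; nra.
Qed.

Lemma ball_vol_gt0 n : 0 < ball_vol n.
Proof.
rewrite fine_gt0// -ge0_fin_numE// unit_ball_fin andbT.
have t0 : 0 < (n.+1%:R : R)^-1 by rewrite invr_gt0.
apply: (@lt_le_trans _ _ (lebesgueN (cube (fun=> 0) (fun _ : 'I_n => n.+1%:R^-1)))).
  rewrite lebesgueN_cube (eq_bigr (fun=> (n.+1%:R^-1 : R)%:E)); last first.
    by move=> i _; rewrite lebesgue_measure_itv/= lte_fin t0 -EFinD subr0.
  by rewrite prodEFin lte_fin prodr_gt0.
apply: le_measure; rewrite ?inE; [exact: measurable_cube|exact: measurable_nsq_le|].
move=> x /= xc; rewrite /unit_ball/= /nsq /dotp.
have h i : x ord0 i * x ord0 i <= n.+1%:R^-1.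
  have := xc i; rewrite /= in_itv/= => /andP[h1 h2].
  rewrite -[leRHS]mulr1; apply: ler_pM => //; [exact: ltW|exact: ltW|].
  by rewrite (le_trans h2)// invf_le1// ler1n.
apply: (@le_trans _ _ (\sum_(i < n) n.+1%:R^-1)); first exact: ler_sum.
by rewrite sumr_const card_ord -(mulr_natl _ n) ler_pdivrMr// mul1r ler_nat.
Qed.

Lemma lebesgueN_ball n (s : R) : 0 < s ->
  lebesgueN [set x : 'rV[R]_n | nsq x <= s] = (ball_vol n * s `^ (n%:R / 2))%:E.
Proof.
move=> s0; have r0 : 0 < Num.sqrt s by rewrite sqrtr_gt0.
have -> : [set x : 'rV[R]_n | nsq x <= s] =
    [set x | @unit_ball n ((Num.sqrt s)^-1 *: x)].
  apply/funext => x; rewrite /unit_ball/= nsqZ exprVn (sqr_sqrtr (ltW s0)).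
  by rewrite ler_pdivrMl// mulr1.
rewrite lebesgueN_scale//; last exact: measurable_nsq_le.
rewrite EFinM fineK ?unit_ball_fin// muleC; congr (_ * _%:E)%E.
by rewrite -powR12_sqrt ?ltW// -powR_mulrn ?powR_ge0// -powRrM mulrC.
Qed.

(** The density of |x|^2 under Lebesgue measure: the derivative of the volume
    c s^(n/2) of the ball of radius sqrt s. *)
Definition radial_density n (s : R) : R :=
  if 0 < s then ball_vol n * (n%:R / 2) * s `^ (n%:R / 2 - 1) else 0.

Lemma radial_density_ge0 n s : 0 <= radial_density n s.
Proof.
by rewrite /radial_density; case: ifP => // _; rewrite !mulr_ge0 ?powR_ge0// ltW// ball_vol_gt0.
Qed.

Lemma measurable_radial_density n : measurable_fun setT (radial_density n).
Proof.
apply: measurable_fun_if => //=.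
  by apply: measurable_fun_ltr.
apply: measurable_funS measurableT _ _ => //.
apply: measurable_funM => //; exact: measurable_powR.
Qed.

Lemma continuous_powR (a x : R) : 0 < x -> {for x, continuous (@powR R ^~ a)}.
Proof.
move=> x0; apply: differentiable_continuous; apply/derivable1_diffP.
by have [] := is_derive1_powR a x0.
Qed.

Lemma powR_cvg_at_right0 (a : R) : 0 <= a -> x `^ a @[x --> 0^'+] --> (0 : R) `^ a.
Proof.
rewrite le_eqVlt => /predU1P[<-|a0].
  by under eq_fun do rewrite powRr0; rewrite powRr0; exact: cvg_cst.
by rewrite powR0 ?gt_eqF//; exact: powR_cvg0.
Qed.

(** Both measures give c s^(n/2) to the half-line below s > 0, by scaling of
    balls on one side and by the fundamental theorem of calculus on the other. *)
Lemma nsq_pushforward n (B : set R) : (1 < n)%N -> measurable B ->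
  lebesgueN (@nsq n @^-1` B) = density lebesgue_measure (radial_density n) B.
Proof.
move=> n1 mB.
have n2 : (1 : R) <= n%:R / 2.
  by rewrite ler_pdivlMr// mul1r (ler_nat R 2 n).
pose c := ball_vol n.
have mnsq : measurable_fun setT (@nsq n : 'rV[R]_n -> measurableTypeR R).
  exact: measurable_nsq.
pose m1 := image_measure (@lebesgueN R n) mnsq.
pose m2 := density_measure (@lebesgue_measure R) (@measurable_radial_density n) (@radial_density_ge0 n).
have split_ (m : {measure set (measurableTypeR R) -> \bar R}) (a b : R) : a <= b ->
    m `]-oo, b]%classic = (m `]-oo, a]%classic + m `]a, b]%classic)%E.
  move=> ab; transitivity (m (`]-oo, a]%classic `|` `]a, b]%classic)).
    by rewrite -itv_bndbnd_setU.
  apply: measureU => //.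
  apply/seteqP; split => x //= []; rewrite !in_itv/= => x0 /andP[x1 _].
  by move: x1; rewrite ltNge x0.
have m1pos (s : R) : 0 < s -> m1 `]-oo, s]%classic = (c * s `^ (n%:R / 2))%:E.
  move=> s0; rewrite /m1 image_measureE /pushforward.
  have -> : @nsq n @^-1` `]-oo, s]%classic = [set x | nsq x <= s].
    by apply/seteqP; split=> x; rewrite /= in_itv/=.
  exact: lebesgueN_ball.
have m1neg (s : R) : s <= 0 -> m1 `]-oo, s]%classic = 0%E.
  move=> s0; apply/eqP; rewrite eq_le measure_ge0 andbT.
  apply/lee_addgt0Pr => e e0; rewrite add0e.
  have c0 : 0 < c by exact: ball_vol_gt0.
  have ec0 : 0 < e / c by rewrite divr_gt0.
  pose t := Num.min 1 (e / c).
  have t0 : 0 < t by rewrite lt_min ltr01.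
  apply: (@le_trans _ _ (m1 `]-oo, t]%classic)).
    apply: le_measure; rewrite ?inE; [exact: measurable_itv|exact: measurable_itv|].
    by move=> x; rewrite /= !in_itv/= => /le_trans; apply; rewrite (le_trans s0)// ltW.
  rewrite m1pos// lee_fin mulrC -ler_pdivlMr//.
  apply: (@le_trans _ _ t); last by rewrite ge_min lexx orbT.
  by apply: ge1r_powR => //; rewrite t0 ge_min lexx.
have m2neg (s : R) : s <= 0 -> m2 `]-oo, s]%classic = 0%E.
  move=> s0; rewrite /m2/= /density integral0_eq// => x; rewrite /= in_itv/= => xs.
  by rewrite /radial_density ltNge (le_trans xs s0).
have m2pos (s : R) : 0 < s -> m2 `]-oo, s]%classic = (c * s `^ (n%:R / 2))%:E.
  move=> s0.
  rewrite (split_ m2 0) ?(ltW s0)// m2neg// add0e /m2/= /density.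
  have F0 : c * 0 `^ (n%:R / 2) = 0 by rewrite powR0 ?mulr0// gt_eqF// (lt_le_trans ltr01).
  have -> : (c * s `^ (n%:R / 2))%:E =
      ((c * s `^ (n%:R / 2))%:E - (c * 0 `^ (n%:R / 2))%:E)%E.
    by rewrite F0 sube0.
  pose h x : R := c * (n%:R / 2) * x `^ (n%:R / 2 - 1).
  transitivity (\int[lebesgue_measure]_(x in `]0%R, s]) (h x)%:E)%E.
    by apply: eq_integral => x; rewrite inE/= in_itv/= => /andP[x0 _]; rewrite /radial_density x0.
  have cpow x (a : R) : 0 < x -> {for x, continuous (fun s : R => s `^ a)}.
    exact: continuous_powR.
  rewrite integral_itv_obnd_cbnd; last first.
    apply/measurable_EFinP; rewrite /h; apply: measurable_funM => //.
    by apply: measurable_funTS; exact: measurable_powR.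
  rewrite (@continuous_FTC2 R h (fun s => c * s `^ (n%:R / 2)))//=.
  - apply/continuous_within_itvP => //; split.
    + by move=> x; rewrite in_itv/= => /andP[x0 _]; apply: cvgMr; exact: cpow.
    + by apply: cvgMr; apply: powR_cvg_at_right0; rewrite subr_ge0.
    + by apply: cvgMr; apply: cvg_at_left_filter; exact: cpow.
  - split.
    + move=> x; rewrite in_itv/= => /andP[x0 _]; apply: derivableM => //.
      by have [] := is_derive1_powR (n%:R / 2) x0.
    + by apply: cvgMr; apply: powR_cvg_at_right0; rewrite (le_trans ler01).
    + by apply: cvgMr; apply: cvg_at_left_filter; exact: cpow.
  - move=> x; rewrite in_itv/= => /andP[x0 _].
    have [dx ex] := is_derive1_powR (n%:R / 2) x0.
    by rewrite derive1Ml// derive1E ex mulrA.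
have m12 s : m1 `]-oo, s]%classic = m2 `]-oo, s]%classic.
  by have [s0|s0] := leP s 0; [rewrite m1neg// m2neg|rewrite m1pos// m2pos].
have m1fin s : m1 `]-oo, s]%classic \is a fin_num.
  by have [s0|s0] := leP s 0; [rewrite m1neg|rewrite m1pos].
have oc a b : m1 `]a, b]%classic = m2 `]a, b]%classic.
  have [ab|ab] := leP a b; last by rewrite set_itv_ge ?measure0// bnd_simp -leNgt ltW.
  have := m12 b; rewrite (split_ m1 a)// (split_ m2 a)// -m12.
  rewrite ![(m1 `]-oo, a]%classic + _)%E]addeC => h.
  by rewrite -[LHS](addeK _ (m1fin a)) h addeK.
have m1n k : (m1 (`](- k%:R)%R, k%:R]%classic) < +oo)%E.
  apply: (@le_lt_trans _ _ (m1 `]-oo, k%:R]%classic)); last first.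
    by rewrite ltey_eq m1fin.
  by apply: le_measure; rewrite ?inE//; apply: subset_itvr.
have cover : \bigcup_k `](- k%:R)%R, k%:R]%classic = [set: R] by rewrite bigcup_itvT.
have m12oc A : @ocitv R A -> m1 A = m2 A.
  by move=> /ocitvP[->|[[a b] _ ->]]; [rewrite !measure0|exact: oc].
have ocn k : @ocitv R `](- k%:R : R), k%:R]%classic by exact: is_ocitv.
exact: (@measure_unique _ _ (measurableTypeR R) (@ocitv R)
  (fun k => `](- k%:R)%R, k%:R]%classic) erefl (@ocitvI R) ocn cover m1 m2 m12oc m1n B mB).
Qed.

Section radial_integral.
Variable n : nat.
Hypothesis n1 : (1 < n)%N.
Local Notation om := (radial_density n).
Local Notation lebesgue := (@lebesgue_measure R).
Local Open Scope ereal_scope.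

Let nu := density_measure lebesgue (@measurable_radial_density n) (@radial_density_ge0 n).

Let mnsq : measurable_fun setT (@nsq n : 'rV[R]_n -> measurableTypeR R).
Proof. exact: measurable_nsq. Qed.

Let nuE (A : set (measurableTypeR R)) : measurable A ->
  nu A = lebesgueN ((@nsq n) @^-1` A).
Proof. by move=> mA; rewrite nsq_pushforward. Qed.

Lemma integrable_radialP (f : measurableTypeR R -> \bar R) : measurable_fun setT f ->
  (@lebesgueN R n).-integrable setT (f \o @nsq n) <->
  lebesgue.-integrable setT (fun s => f s * (om s)%:E).
Proof.
move=> mf; apply: iff_trans (integrable_densityP lebesgue
  (@measurable_radial_density n) (@radial_density_ge0 n) mf).
exact: (iff_sym (integrable_transferP mnsq nuE mf)).
Qed.

Lemma integral_radial (f : measurableTypeR R -> \bar R) : measurable_fun setT f ->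
  (@lebesgueN R n).-integrable setT (f \o @nsq n) ->
  \int[@lebesgueN R n]_x f (nsq x) = \int[lebesgue]_s (f s * (om s)%:E).
Proof.
move=> mf intf; rewrite -(integral_density lebesgue (@measurable_radial_density n) (@radial_density_ge0 n) mf).
by rewrite -(integral_transfer mnsq nuE)//; exact/(integrable_transferP mnsq nuE).
Qed.

Lemma ae_radial (P : R -> Prop) : {ae lebesgue, forall s, P s} ->
  {ae @lebesgueN R n, forall x, P (nsq x)}.
Proof.
move=> [N [mN N0 sN]]; exists (@nsq n @^-1` N); split.
- by rewrite -[X in measurable X]setTI; exact: mnsq.
- rewrite nsq_pushforward//; apply: null_set_integral => //.
  apply/measurable_EFinP; apply: measurable_funTS; exact: measurable_radial_density.
- by move=> x /= Px; exact: sN.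
Qed.

End radial_integral.

End radial_measure.

(** * The du Bois-Reymond lemma *)

Section integrable_bounded.
Context d (T : measurableType d) (R : realType).
Variables (mu : {measure set T -> \bar R}) (D : set T).
Hypothesis mD : measurable D.

Lemma integrable_mul_bounded (f h : T -> R) (M : R) :
  mu.-integrable D (EFin \o f) -> measurable_fun D h ->
  (forall x, D x -> `|h x| <= M) -> mu.-integrable D (EFin \o (fun x => f x * h x)).
Proof.
move=> fi mh hM; have mf : measurable_fun D f.
  exact/measurable_EFinP/(measurable_int _ fi).
apply: (@le_integrable _ _ _ mu D mD _ (fun x => M%:E * (EFin \o f) x)%E).
- by apply/measurable_EFinP; exact: measurable_funM.
- move=> x Dx /=; rewrite lee_fin normrM mulrC normrM ler_wpM2r//.
  by rewrite (le_trans (hM _ Dx)) ?ler_norm.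
- exact: integrableZl.
Qed.

Lemma Rintegral_dominated_cvg (f_ : nat -> T -> R) (f g : T -> R) :
  (forall n, measurable_fun D (f_ n)) -> measurable_fun D f ->
  {ae mu, forall x, D x -> f_ n x @[n --> \oo] --> f x} ->
  mu.-integrable D (EFin \o g) ->
  {ae mu, forall x n, D x -> `|f_ n x| <= g x} ->
  \int[mu]_(x in D) f_ n x @[n --> \oo] --> \int[mu]_(x in D) f x.
Proof.
move=> mf_ mf f_f ig f_g.
have mf_' n : measurable_fun D (EFin \o f_ n) by exact/measurable_EFinP.
have mf' : measurable_fun D (EFin \o f) by exact/measurable_EFinP.
have f_f' : {ae mu, forall x, D x -> (EFin \o f_ n) x @[n --> \oo] --> (EFin \o f) x}.
  apply: filterS f_f => x h Dx; apply: cvg_EFin; first exact: nearW.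
  exact: h.
have f_g' : {ae mu, forall x n, D x -> (`|(EFin \o f_ n) x| <= (EFin \o g) x)%E}.
  by apply: filterS f_g => x h n Dx; rewrite lee_fin h.
have [intf _ H] := dominated_convergence mD mf_' mf' f_f' ig f_g'.
by apply: fine_cvg; rewrite fineK//; exact: integrable_fin_num.
Qed.

End integrable_bounded.

Section ftc_helpers.
Context {R : realType}.
Local Notation mu := (@lebesgue_measure R).

Lemma is_derive_continuous (f : R -> R) (x df : R) : is_derive x 1 f df -> {for x, continuous f}.
Proof.
by move=> [fd _]; apply: differentiable_continuous; exact/derivable1_diffP.
Qed.

Lemma Rintegral_is_derive (f df : R -> R) (a b : R) : a < b ->
  (forall x : R, a <= x <= b -> is_derive x 1 f (df x)) ->
  (forall x : R, a <= x <= b -> {for x, continuous df}) ->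
  \int[mu]_(x in `[a, b]) df x = f b - f a.
Proof.
move=> ab fd cd; have ab' := ltW ab.
rewrite /Rintegral (@continuous_FTC2 R df f a b ab)//.
- apply/continuous_within_itvP => //; split.
  + by move=> x; rewrite in_itv/= => /andP[/ltW h1 /ltW h2]; apply: cd; rewrite h1.
  + by apply: cvg_at_right_filter; apply: cd; rewrite lexx.
  + by apply: cvg_at_left_filter; apply: cd; rewrite lexx ab'.
- split.
  + move=> x; rewrite in_itv/= => /andP[/ltW h1 /ltW h2].
    by have [] : is_derive x 1 f (df x) by apply: fd; rewrite h1.
  + apply: cvg_at_right_filter; apply: (@is_derive_continuous f a (df a)).
    by apply: fd; rewrite lexx.
  + apply: cvg_at_left_filter; apply: (@is_derive_continuous f b (df b)).
    by apply: fd; rewrite lexx ab'.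
- move=> x; rewrite in_itv/= => /andP[/ltW h1 /ltW h2]; rewrite derive1E.
  by have [_ ->] : is_derive x 1 f (df x) by apply: fd; rewrite h1.
Qed.

End ftc_helpers.

Section du_bois_reymond.
Context {R : realType}.
Local Notation mu := (@lebesgue_measure R).
Implicit Types (F g : R -> R) (a b x : R).

(** The error is at most 2 M times the average of |F - F x| over the support of
    the kernel, which tends to 0 by definition of a Lebesgue point. *)
Lemma kernel_cvg F (K : nat -> R -> R) a b x (M : R) :
  measurable_fun setT F -> mu.-integrable `[a, b] (EFin \o F) -> lebesgue_pt F x ->
  (forall k, continuous (K k)) -> (forall k t, `|K k t| <= k.+1%:R * M) ->
  (forall k t, K k t != 0 -> `|t - x| < k.+1%:R^-1) ->
  (\forall k \near \oo, \int[mu]_(t in `[a, b]) K k t = 1) ->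
  \int[mu]_(t in `[a, b]) (F t * K k t) @[k --> \oo] --> F x.
Proof.
move=> mF iF Fx cK KM Kx K1.
have mK k : measurable_fun setT (K k) by exact: continuous_measurable_fun.
have mab : measurable (`[a, b]%classic : set (measurableTypeR R)) by exact: measurable_itv.
have iK k : mu.-integrable `[a, b] (EFin \o (K k : measurableTypeR R -> R)).
  apply: continuous_compact_integrable; first exact: segment_compact.
  exact: continuous_subspaceT.
have iFK k : mu.-integrable `[a, b] (EFin \o (fun t : measurableTypeR R => F t * K k t)).
  apply: (integrable_mul_bounded _ iF _ (fun x _ => KM k x)) => //.
  by apply: measurable_funTS; exact: mK.
have M0 : 0 <= M by have := KM 0%N 0; rewrite mul1r; apply: le_trans.
apply/cvgrPdist_le => e e0.
have davg0 : davg F x k.+1%:R^-1 @[k --> \oo] --> 0%E.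
  move/cvge_at_rightP : Fx => /(_ (fun k => k.+1%:R^-1)); apply.
  by split; [move=> n; rewrite invr_gt0|exact: cvg_harmonic].
(* M may be 0, hence the division by M + 1. *)
have e1 : 0 < e / (2 * (M + 1)) by rewrite divr_gt0// mulr_gt0// ltr_wpDl.
have davge : \forall k \near \oo, (davg F x k.+1%:R^-1 <= (e / (2 * (M + 1)))%:E)%E.
  move/fine_cvgP : davg0 => [dfin dcvg]; near=> k.
  rewrite -[davg _ _ _]fineK; last by near: k.
  by rewrite lee_fin; near: k; move/cvgr_le : dcvg; apply.
near=> k.
have K1k : \int[mu]_(t in `[a, b]) K k t = 1 by near: k.
have iFxK : mu.-integrable `[a, b] (EFin \o (fun t : measurableTypeR R => F x * K k t)).
  by have := integrableZl mab (F x) (iK k).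
have iFFK : mu.-integrable `[a, b] (EFin \o (fun t : measurableTypeR R => (F x - F t) * K k t)).
  have := integrableB mab iFxK (iFK k).
  by apply: eq_integrable => // t _; rewrite /= -EFinB mulrBl.
have -> : F x - \int[mu]_(t in `[a, b]) (F t * K k t) =
    \int[mu]_(t in `[a, b]) ((F x - F t) * K k t).
  under [RHS]eq_Rintegral do rewrite mulrBl.
  by rewrite RintegralB// RintegralZl// K1k mulr1.
rewrite -lee_fin EFin_normr_Rintegral//.
apply: le_trans (le_abse_integral _ _ _) _ => //; first exact: measurable_int iFFK.
have mFFK : measurable_fun `[a, b]
    (fun t : measurableTypeR R => (`|(F x - F t) * K k t|)%:E).
  apply/measurable_EFinP; apply: measurableT_comp => //.
  by apply/measurable_EFinP; exact: measurable_int iFFK.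
have r0 : 0 < (k.+1%:R : R)^-1 by rewrite invr_gt0.
have mball : measurable (ball x k.+1%:R^-1 : set (measurableTypeR R)) by exact: measurable_ball.
have mFx (D : set (measurableTypeR R)) : measurable_fun D (fun t : measurableTypeR R => `|(F t - F x)%:E|%E).
  apply: measurable_funTS; apply: measurableT_comp => //; apply/measurable_EFinP.
  by apply: measurable_funB => //; exact: mF.
apply: (@le_trans _ _ (\int[mu]_(t in ball x k.+1%:R^-1) ((k.+1%:R * M)%:E * `|(F t - F x)%:E|))%E).
  rewrite integral_mkcond [leRHS]integral_mkcond; apply: ge0_le_integral => //=.
  - by move=> t _; rewrite patchE; case: ifPn.
  - exact: ((measurable_restrictT _ mab).1 mFFK).
  - apply: ((measurable_restrictT _ mball).1 _); exact: emeasurable_funM.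
  - move=> t _; rewrite !patchE; case: ifPn => tab; case: ifPn => tball //.
    + rewrite /= -EFinM lee_fin normrM mulrC distrC ler_wpM2r//.
    + rewrite (_ : K k t = 0) ?mulr0 ?normr0//.
      apply/eqP; apply: contraNT tball => /Kx; rewrite inE /ball/= distrC//.
    + by rewrite mule_ge0// lee_fin mulr_ge0.
rewrite ge0_integralZl//; last by rewrite lee_fin mulr_ge0.
have dE : davg F x k.+1%:R^-1 = ((k.+1%:R / 2)%:E * \int[mu]_(t in ball x k.+1%:R^-1) `|(F t - F x)%:E|)%E.
  rewrite /davg /iavg lebesgue_measure_ball ?ltW//; congr (_ * _)%E.
  rewrite inver mulr2n gt_eqF ?addr_gt0//; congr EFin.
  by field; rewrite addrC natr1 pnatr_eq0.
have : (davg F x k.+1%:R^-1 <= (e / (2 * (M + 1)))%:E)%E by near: k.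
rewrite dE => h.
have k2 : (0 <= (2 * M)%:E)%E by rewrite lee_fin mulr_ge0.
have -> : (k.+1%:R * M)%:E = ((2 * M)%:E * (k.+1%:R / 2)%:E)%E.
  by rewrite -EFinM; congr EFin; field.
rewrite -muleA; apply: le_trans (lee_wpmul2l k2 h) _.
rewrite -EFinM lee_fin.
have -> : 2 * M * (e / (2 * (M + 1))) = e * (M / (M + 1)).
  by field; rewrite gt_eqF// ltr_wpDl.
rewrite ger_pMr// ler_pdivrMr ?ltr_wpDl// mul1r lerDl//.
Unshelve. all: by end_near. Qed.

(** The derivative of the plateau is a kernel at a minus a kernel at b. *)
Lemma du_bois_reymond F g a b : a < b ->
  measurable_fun setT F -> mu.-integrable `[a, b] (EFin \o F) ->
  mu.-integrable `[a, b] (EFin \o g) ->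
  lebesgue_pt F a -> lebesgue_pt F b ->
  (forall k : nat, \int[mu]_(t in `[a, b])
     (F t * (plateau k.+1%:R a b)^`()%classic t + g t * plateau k.+1%:R a b t) = 0) ->
  F b - F a = \int[mu]_(t in `[a, b]) g t.
Proof.
move=> ab mF iF ig Fa Fb FG0.
have [d [cd sd d0 [M dM]]] := @step_derive R.
pose Ka (k : nat) t := k.+1%:R * d (k.+1%:R * (t - a)).
pose Kb (k : nat) t := k.+1%:R * d (k.+1%:R * (b - t)).
have k0 (k : nat) : 0 < (k.+1%:R : R) by [].
have sDa (k : nat) (t : R) : is_derive t 1 (fun t : R => step (k.+1%:R * (t - a))) (Ka k t).
  rewrite /Ka mulrC; have := is_derive_affine k.+1%:R (- (k.+1%:R * a)) t.
  under [X in is_derive _ _ X _]eq_fun do rewrite -mulrBr.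
  move=> H; have := sd (k.+1%:R * (t - a)) => H2.
  exact: (@is_derive1_comp _ step (fun t : R => k.+1%:R * (t - a)) t _ _ H2 H).
have sDb (k : nat) (t : R) : is_derive t 1 (fun t : R => step (k.+1%:R * (b - t))) (- Kb k t).
  rewrite /Kb mulrC -mulrN; have := is_derive_affine (- k.+1%:R) (k.+1%:R * b) t.
  under [X in is_derive _ _ X _]eq_fun do rewrite mulNr addrC -mulrBr.
  move=> H; have := sd (k.+1%:R * (b - t)) => H2.
  exact: (@is_derive1_comp _ step (fun t : R => k.+1%:R * (b - t)) t _ _ H2 H).
have Ka0 (k : nat) (t : R) : Ka k t != 0 -> a < t < a + k.+1%:R^-1.
  rewrite /Ka mulf_eq0 negb_or => /andP[_] h.
  have : 0 < k.+1%:R * (t - a) < 1 by apply: contraNT h => /d0 ->.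
  by rewrite pmulr_rgt0// subr_gt0 -ltr_pdivlMl// mulr1 ltrBlDl.
have Kb0 (k : nat) (t : R) : Kb k t != 0 -> b - k.+1%:R^-1 < t < b.
  rewrite /Kb mulf_eq0 negb_or => /andP[_] h.
  have : 0 < k.+1%:R * (b - t) < 1 by apply: contraNT h => /d0 ->.
  by rewrite pmulr_rgt0// subr_gt0 -ltr_pdivlMl// mulr1 ltrBlDl addrC -ltrBlDl addrC andbC.
have caff (c e : R) : continuous (fun t : R => c * (t - e)).
  move=> t; apply: cvgMr; apply: cvgB; [exact: cvg_id|exact: cvg_cst].
have cKa k : continuous (Ka k).
  move=> t; apply: cvgMr; apply: (@continuous_comp _ _ _ (fun t : R => k.+1%:R * (t - a)) d).
    exact: caff.
  exact: cd.
have cKb k : continuous (Kb k).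
  move=> t; apply: cvgMr; apply: (@continuous_comp _ _ _ (fun t : R => k.+1%:R * (b - t)) d).
    apply: cvgMr; apply: cvgB; [exact: cvg_cst|exact: cvg_id].
  exact: cd.
have cstep : continuous (@step R).
  by move=> t; apply: differentiable_continuous; apply/derivable1_diffP; have [] := sd t.
have kab : \forall k \near \oo, 1 <= k.+1%:R * (b - a).
  near=> k; rewrite -ler_pdivrMr ?subr_gt0// mul1r.
  rewrite (@le_trans _ _ k%:R)// ?ler_nat//; near: k; exact: nbhs_infty_ger.
have ca : \int[mu]_(t in `[a, b]) (F t * Ka k t) @[k --> \oo] --> F a.
  apply: (kernel_cvg (M := M)) => //.
  - by move=> k t; rewrite normrM normr_nat ler_wpM2l.
  - move=> k t /Ka0 /andP[h1 h2]; rewrite gtr0_norm ?subr_gt0//.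
    by rewrite ltrBlDl.
  - near=> k.
    have kb1 : 1 <= k.+1%:R * (b - a) by near: k.
    rewrite (Rintegral_is_derive ab (fun x _ => sDa k x) (fun x _ => cKa k x)).
    by rewrite subrr mulr0 (step_le0 (lexx 0)) (step_ge1 kb1)/= subr0.
have cb : \int[mu]_(t in `[a, b]) (F t * Kb k t) @[k --> \oo] --> F b.
  apply: (kernel_cvg (M := M)) => //.
  - by move=> k t; rewrite normrM normr_nat ler_wpM2l.
  - move=> k t /Kb0 /andP[h1 h2]; rewrite ltr0_norm ?subr_lt0//.
    by rewrite opprB ltrBlDl -ltrBlDr.
  - near=> k.
    have kb1 : 1 <= k.+1%:R * (b - a) by near: k.
    have sDb' x : is_derive x 1 (fun t : R => - step (k.+1%:R * (b - t))) (Kb k x).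
      by rewrite -[Kb k x]opprK; exact: is_deriveN.
    rewrite (Rintegral_is_derive ab (fun x _ => sDb' x) (fun x _ => cKb k x)).
    by rewrite subrr mulr0 (step_le0 (lexx 0)) (step_ge1 kb1)/= oppr0 sub0r opprK.
have mpl k : measurable_fun setT (plateau k.+1%:R a b).
  by apply: continuous_measurable_fun; apply: smooth1_continuous; exact: plateau_smooth1.
have pl01 (k : nat) (t : R) : `|plateau k.+1%:R a b t| <= 1.
  by rewrite normrM !ger0_norm ?step_ge0// mulr_ile1 ?step_ge0 ?step_le1.
have mab : measurable (`[a, b]%classic : set (measurableTypeR R)) by exact: measurable_itv.
have igp k : mu.-integrable `[a, b]
    (EFin \o (fun t : measurableTypeR R => g t * plateau k.+1%:R a b t)).
  apply: (integrable_mul_bounded _ ig _ (fun x _ => pl01 k x)) => //.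
  by apply: measurable_funTS; exact: mpl.
have ae_ab : {ae mu, forall t, t != a /\ t != b}.
  exists ([set a] `|` [set b]); split; first exact: measurableU.
    by rewrite measureU0//; exact: lebesgue_measure_set1.
  move=> t /= /not_andP[|] /negP; rewrite negbK => /eqP ->; [by left|by right].
have cg : \int[mu]_(t in `[a, b]) (g t * plateau k.+1%:R a b t) @[k --> \oo] -->
    \int[mu]_(t in `[a, b]) g t.
  apply: (@Rintegral_dominated_cvg _ (measurableTypeR R) R mu _ mab _ _ (fun t => `|g t|)).
  - by move=> k; apply/measurable_EFinP; exact: measurable_int (igp k).
  - by apply/measurable_EFinP; exact: measurable_int ig.
  - apply: (@filterS _ _ (ae_filter_ringOfSetsType mu) _ _ _ ae_ab) => t [ta tb].
    rewrite /= in_itv/= => /andP[at_ tb_].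
    apply: cvg_near_cst; near=> k => /=.
    have ct : 0 < t - a by rewrite subr_gt0 lt_neqAle eq_sym ta.
    have ct' : 0 < b - t by rewrite subr_gt0 lt_neqAle tb.
    rewrite /plateau !step_ge1 ?mulr1//.
    + rewrite -ler_pdivrMr// mul1r (@le_trans _ _ k%:R)// ?ler_nat//.
      by near: k; exact: nbhs_infty_ger.
    + rewrite -ler_pdivrMr// mul1r (@le_trans _ _ k%:R)// ?ler_nat//.
      by near: k; exact: nbhs_infty_ger.
  - exact: integrable_norm.
  - by apply: aeW => t k _; rewrite normrM ler_piMr//; exact: pl01.
have pld (k : nat) (t : R) : 2 <= k.+1%:R * (b - a) ->
    (plateau k.+1%:R a b)^`()%classic t = Ka k t - Kb k t.
  move=> k2; rewrite derive1E /plateau.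
  have [_ ->] := is_deriveM (sDa k t) (sDb k t).
  rewrite /GRing.scale/= mulrN addrC mulrC; congr (_ - _).
    have [->|/Ka0/andP[t1 t2]] := eqVneq (Ka k t) 0; first by rewrite mul0r.
    rewrite step_ge1 ?mulr1//.
    have : k.+1%:R * (t - a) <= 1 by rewrite -ler_pdivlMl// mulr1 lerBlDl ltW.
    by lra.
  have [->|/Kb0/andP[t1 t2]] := eqVneq (Kb k t) 0; first by rewrite mulr0.
  rewrite step_ge1 ?mul1r//.
  have : k.+1%:R * (b - t) <= 1 by rewrite -ler_pdivlMl// mulr1 lerBlDl addrC -lerBlDl ltW.
  by lra.
have iFc (K : nat -> R -> R) k : continuous (K k) -> (forall t, `|K k t| <= k.+1%:R * M) ->
    mu.-integrable `[a, b] (EFin \o (fun t : measurableTypeR R => F t * K k t)).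
  move=> cK KM; apply: (integrable_mul_bounded _ iF _ (fun x _ => KM x)) => //.
  by apply: measurable_funTS; exact: continuous_measurable_fun.
have iFa k : mu.-integrable `[a, b] (EFin \o (fun t : measurableTypeR R => F t * Ka k t)).
  by apply: iFc => // t; rewrite normrM normr_nat ler_wpM2l.
have iFb k : mu.-integrable `[a, b] (EFin \o (fun t : measurableTypeR R => F t * Kb k t)).
  by apply: iFc => // t; rewrite normrM normr_nat ler_wpM2l.
have lim0 : (\int[mu]_(t in `[a, b]) (F t * Ka k t) - \int[mu]_(t in `[a, b]) (F t * Kb k t))
    + \int[mu]_(t in `[a, b]) (g t * plateau k.+1%:R a b t) @[k --> \oo] --> (0 : R).
  apply: cvg_near_cst; near=> k.
  have iFab : mu.-integrable `[a, b] (EFin \o (fun t : measurableTypeR R => F t * Ka k t - F t * Kb k t)).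
    exact: (integrableB mab (iFa k) (iFb k)).
  rewrite -RintegralB// -RintegralD// -[RHS](FG0 k).
  apply: eq_Rintegral => t _; rewrite pld; first by rewrite mulrBr.
  near: k; near=> k; rewrite -ler_pdivrMr ?subr_gt0//.
  rewrite (@le_trans _ _ k%:R)// ?ler_nat//; near: k; exact: nbhs_infty_ger.
have lim1 : (\int[mu]_(t in `[a, b]) (F t * Ka k t) - \int[mu]_(t in `[a, b]) (F t * Kb k t))
    + \int[mu]_(t in `[a, b]) (g t * plateau k.+1%:R a b t) @[k --> \oo] -->
    F a - F b + \int[mu]_(t in `[a, b]) g t.
  by apply: cvgD cg; exact: cvgB.
have : F a - F b + \int[mu]_(t in `[a, b]) g t = 0 by exact: (cvg_unique _ lim1 lim0).
by lra.
Unshelve. all: by end_near. Qed.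

End du_bois_reymond.

(** * Slices parallel to a coordinate axis *)

Section slices.
Context {R : realType} {n : nat} (i : 'I_n.+1).
Local Notation lam := (@lebesgue_measure R).
Local Notation mu := (@lebesgueN R n).
Local Notation RL := (measurableTypeR R).
Implicit Types (f : 'rV[R]_n.+1 -> R) (y : 'rV[R]_n).

Lemma measurable_slice d (T : measurableType d) (f : 'rV[R]_n.+1 -> T) y :
  measurable_fun setT f ->
  measurable_fun setT (fun t : RL => f (insert i (t, y))).
Proof.
move=> mf; apply: (measurableT_comp mf).
exact: (measurableT_comp (measurable_insert i) (measurable_pair2 y)).
Qed.

Lemma integrable_insert (f : 'rV[R]_n.+1 -> \bar R) :
  (@lebesgueN R n.+1).-integrable setT f ->
  (lam \x mu)%E.-integrable setT (f \o insert i).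
Proof.
move=> intf.
exact/(integrable_transferP (measurable_insert i) (lebesgueN_insert i) (measurable_int _ intf)).
Qed.

Lemma ae_integrable_slice f :
  (@lebesgueN R n.+1).-integrable setT (EFin \o f) ->
  {ae mu, forall y, lam.-integrable setT (fun t : RL => (f (insert i (t, y)))%:E)}.
Proof. by move=> /integrable_insert /ae_integrable2. Qed.

Definition slice_integral f y : R := \int[lam]_t f (insert i (t, y)).

Lemma slice_integral_fubini f :
  (@lebesgueN R n.+1).-integrable setT (EFin \o f) ->
  mu.-integrable setT (EFin \o slice_integral f) /\
  \int[@lebesgueN R n.+1]_x f x = \int[mu]_y slice_integral f y.
Proof.
move=> intf; have intfi := integrable_insert intf.
have mf := measurable_int _ intf.
have mG := measurable_fubini_G intfi.
have iG : mu.-integrable setT (fubini_G lam ((EFin \o f) \o insert i)).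
  apply/integrableP; split => //.
  have := (integrable21ltyP lam mu (measurable_int _ intfi)).1 intfi.
  apply: le_lt_trans.
  apply: ge0_le_integral => //.
  - exact: measurableT_comp.
  - apply: (@measurable_fun_fubini_tonelli_G _ _ _ _ _ lam (fun z => `|(EFin \o f) (insert i z)|%E)) => //.
    by apply: measurableT_comp => //; exact: (measurable_int _ intfi).
  - by move=> y _; apply: le_abse_integral => //; exact: measurable_slice.
have GE : {ae mu, forall y, setT y -> fubini_G lam ((EFin \o f) \o insert i) y = (EFin \o slice_integral f) y}.
  have := ae_integrable_slice intf.
  apply: (@filterS _ _ (ae_filter_ringOfSetsType mu)) => y iy _.
  by rewrite /slice_integral /= fineK//; exact: integrable_fin_num.
have mS : measurable_fun setT (EFin \o slice_integral f).
  by apply/measurable_EFinP; exact: (measurableT_comp (fine_measurable measurableT) mG).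
split.
  apply/integrableP; split => //.
  have /integrableP[_] := iG; congr (_ < _)%E; apply: ae_eq_integral => //.
  - exact: measurableT_comp.
  - exact: measurableT_comp.
  - by apply: (@filterS _ _ (ae_filter_ringOfSetsType mu) _ _ _ GE) => y /= h /h ->.
rewrite /Rintegral (integral_transfer (measurable_insert i) (lebesgueN_insert i) intf).
by rewrite -(integral21_prod_meas1 intfi); congr fine; apply: ae_eq_integral.
Qed.

Lemma measurable_slice_set (A : set 'rV[R]_n.+1) y : measurable A ->
  measurable [set t : RL | A (insert i (t, y))].
Proof.
move=> mA; rewrite -[X in measurable X]setTI.
exact: (measurableT_comp (measurable_insert i) (measurable_pair2 y)).
Qed.

(** Cavalieri principle: Tonelli applied to the indicator of A. *)
Lemma lebesgueN_slices (A : set 'rV[R]_n.+1) : measurable A ->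
  measurable_fun setT (fun y => lam [set t | A (insert i (t, y))]) /\
  lebesgueN A = (\int[mu]_y lam [set t | A (insert i (t, y))])%E.
Proof.
move=> mA; pose f x : \bar R := (\1_A x)%:E.
have mf : measurable_fun setT f by apply/measurable_EFinP; exact: measurable_indic.
have mfi : measurable_fun setT (f \o insert i).
  exact: (measurableT_comp mf (measurable_insert i)).
have sE y : fubini_G lam (f \o insert i) y = lam [set t | A (insert i (t, y))].
  rewrite -[RHS]/(lam [set t | A (insert i (t, y))]) -[X in lam X]setIT.
  rewrite -integral_indic//; exact: measurable_slice_set.
split.
  have := @measurable_fun_fubini_tonelli_G _ _ _ _ _ lam (f \o insert i) mfi.
  by under [X in _ -> measurable_fun _ X]eq_fun do rewrite -sE; apply=> x; rewrite lee_fin.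
have f0 x : (0 <= f x)%E by rewrite lee_fin.
under eq_integral do rewrite -sE.
rewrite -fubini_tonelli2//; last by move=> x; rewrite lee_fin.
transitivity (\int[@lebesgueN R n.+1]_x f x)%E; first by rewrite /f integral_indic// setIT.
by rewrite (ge0_integral_transfer (measurable_insert i) (lebesgueN_insert i) mf f0).
Qed.

(** The previous lemma for the complement: a nonnegative function with zero
    integral vanishes almost everywhere. *)
Lemma ae_slices (A : set 'rV[R]_n.+1) : measurable A ->
  {ae @lebesgueN R n.+1, forall x, A x} <->
  {ae mu, forall y, {ae lam, forall t, A (insert i (t, y))}}.
Proof.
move=> mA; have mAC := measurableC mA.
have [mS lE] := lebesgueN_slices mAC.
have aeE : lebesgueN (~` A) = 0%E <->
    {ae mu, forall y, setT y -> lam [set t | (~` A) (insert i (t, y))] = 0%E}.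
  rewrite lE; apply: (iff_trans _ (ae_eq_integral_abs mu measurableT mS)).
  suff -> : (\int[mu]_y lam [set t | (~` A) (insert i (t, y))] =
    \int[mu]_y `|lam [set t | (~` A) (insert i (t, y))]|)%E by [].
  by apply: eq_integral => y _; rewrite gee0_abs.
apply: (iff_trans (B := lebesgueN (~` A) = 0%E)).
  split=> [[N [mN N0 sN]]|A0]; first exact: (subset_measure0 mAC mN).
  by exists (~` A); split.
rewrite aeE; split; apply: (@filterS _ _ (ae_filter_ringOfSetsType mu)) => y.
  by move=> /(_ I) y0; exists [set t | (~` A) (insert i (t, y))]; split => //;
    exact: measurable_slice_set.
move=> [N [mN N0 sN]] _; apply: (subset_measure0 _ mN) => //.
exact: measurable_slice_set.
Qed.

End slices.

(** * Weak gradients along lines *)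

Section local_integrability.
Context d (T : measurableType d) (R : realType) (mu : {measure set T -> \bar R}).

(** |f| <= 1 + |f|^p. *)
Lemma Lfun_integrable_finite (p : R) (f : T -> R) (A : set T) : 1 <= p ->
  f \in Lfun mu p%:E -> measurable A -> (mu A < +oo)%E ->
  mu.-integrable A (EFin \o f).
Proof.
move=> p1 fp mA Aoo.
have mf : measurable_fun setT f by move: fp; rewrite inE => /andP[/[!inE]].
have ifp := Lfun_integrable p1 fp.
have ip : mu.-integrable A (EFin \o (fun x => 1 + `|f x| `^ p)).
  have i1 : mu.-integrable A (cst 1%E).
    apply/integrableP; split => //.
    by under eq_integral do rewrite gee0_abs//; rewrite integral_cst// mul1e.
  by have := integrableD mA i1 (integrableS measurableT mA (@subsetT _ A) ifp).
apply: le_integrable ip => //; first by apply/measurable_EFinP; exact: measurable_funTS.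
move=> x Ax /=; rewrite lee_fin [leRHS]ger0_norm ?addr_ge0 ?powR_ge0//.
have [f1|f1] := leP `|f x| 1; first by rewrite (le_trans f1)// lerDl powR_ge0.
by apply: le_trans (_ : `|f x| `^ p <= _); [exact: le1r_powR (ltW f1) p1|rewrite lerDr].
Qed.

Lemma integrable_mul_support (f h : T -> R) (A : set T) (M : R) : measurable A ->
  mu.-integrable A (EFin \o f) -> measurable_fun setT h ->
  (forall x, `|h x| <= M) -> (forall x, ~ A x -> h x = 0) ->
  mu.-integrable setT (EFin \o (fun x => f x * h x)).
Proof.
move=> mA fi mh hM h0.
have := integrable_mul_bounded mA fi (measurable_funTS mh) (fun x _ => hM x).
rewrite integrable_mkcond//; apply: eq_integrable => // x _.
by rewrite patchE; case: ifPn => //; rewrite notin_setE => /h0 /= ->; rewrite mulr0.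
Qed.

End local_integrability.

Section smooth_gen_facts.
Context {R : realType} {N : nat}.
Local Notation RN := 'rV[R]_N.

Lemma smooth_gen_coord_comp e (i : 'I_N) : smooth1 e -> smooth_gen (fun x : RN => e (x ord0 i)).
Proof. by move=> se; exact: (@smooth_gen_comp _ _ e _ se (smooth_gen_coord i)). Qed.

Lemma smooth_gen_prod (I : Type) (s : seq I) (F : I -> RN -> R) :
  (forall j, smooth_gen (F j)) -> smooth_gen (fun x => \prod_(j <- s) F j x).
Proof.
move=> sF; elim: s => [|j s IH].
  by under eq_fun do rewrite big_nil; exact: smooth_gen_cst.
by under eq_fun do rewrite big_cons; exact: smooth_genM.
Qed.

Lemma measurable_smooth_gen (g : RN -> R) : smooth_gen g -> measurable_fun setT g.
Proof.
elim=> [c|i|e g0 se _ IH|g1 g2 _ IH1 _ IH2|g1 g2 _ IH1 _ IH2].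
- exact: measurable_cst.
- exact: measurable_coor.
- apply: measurableT_comp => //.
  by apply: continuous_measurable_fun; exact: smooth1_continuous.
- exact: measurable_funD.
- exact: measurable_funM.
Qed.

Lemma is_derive_invariant (g : RN -> R) x v :
  (forall h, g (h *: v + x) = g x) -> is_derive x v g 0.
Proof.
move=> gv.
have H : h^-1 *: ((g \o shift x) (h *: v) - g x) @[h --> 0^'] --> (0 : R).
  by apply: cvg_near_cst; near=> h; rewrite /= gv subrr scaler0.
by apply: DeriveDef; [apply/cvg_ex; exists (0 : R)|exact: cvg_lim].
Unshelve. all: by end_near. Qed.

End smooth_gen_facts.

(** Contrary to that of a plateau, the limit as k tends to infinity is the
    indicator of the half-open interval ]a, b] at every point, so that products
    of such functions converge to indicators of half-open boxes. *)
Definition half_plateau {R : realType} (k a b t : R) : R :=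
  step (k * (t - a)) * step (1 + k * (b - t)).

Section half_plateau.
Context {R : realType}.
Implicit Types a b k t : R.

Lemma half_plateau_smooth1 k a b : smooth1 (half_plateau k a b).
Proof.
apply: flat_gen_smooth1; apply: flat_genM.
  have := flat_gen_affine k (- k * a) step_gen.
  by under eq_fun do rewrite mulNr -mulrBr.
have := flat_gen_affine (- k) (1 + k * b) step_gen.
by under eq_fun do rewrite mulNr addrC -addrA -mulrBr.
Qed.

Lemma half_plateau_ge0 k a b t : 0 <= half_plateau k a b t.
Proof. by rewrite mulr_ge0 ?step_ge0. Qed.

Lemma half_plateau_le1 k a b t : half_plateau k a b t <= 1.
Proof. by rewrite mulr_ile1 ?step_ge0 ?step_le1. Qed.

Lemma half_plateau_support k a b t : 1 <= k ->
  half_plateau k a b t != 0 -> a < t <= b + 1.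
Proof.
move=> k1; have k0 : 0 < k by exact: lt_le_trans k1.
rewrite mulf_eq0 negb_or => /andP[h1 h2]; apply/andP; split.
  by rewrite ltNge; apply: contra h1 => ta; rewrite step_le0// pmulr_rle0// subr_le0.
rewrite leNgt; apply: contra h2 => tb; rewrite step_le0//.
have : k * (b - t) <= - k by nra.
by lra.
Qed.

Lemma half_plateau_cvg a b t :
  half_plateau k.+1%:R a b t @[k --> \oo] --> (\1_(`]a, b]%classic) t : R).
Proof.
have [ta|ta] := leP t a.
  rewrite indicE memNset; last by rewrite /= in_itv/= ltNge ta.
  apply: cvg_near_cst; near=> k.
  by rewrite /half_plateau step_le0 ?mul0r// pmulr_rle0// subr_le0.
have big (c : R) : 0 < c -> \forall k \near \oo, 1 <= k.+1%:R * c.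
  move=> c0; near=> k; rewrite -ler_pdivrMr// mul1r.
  by rewrite (@le_trans _ _ k%:R)// ?ler_nat//; near: k; exact: nbhs_infty_ger.
have [tb|tb] := leP t b.
  rewrite indicE mem_set; last by rewrite /= in_itv/= ta tb.
  apply: cvg_near_cst; near=> k.
  rewrite /half_plateau !step_ge1 ?mulr1//.
    by rewrite lerDl mulr_ge0// subr_ge0.
  by near: k; apply: big; rewrite subr_gt0.
rewrite indicE memNset; last by rewrite /= in_itv/= ta leNgt tb.
apply: cvg_near_cst; near=> k.
rewrite /half_plateau [X in _ * X]step_le0 ?mulr0//.
have : 1 <= k.+1%:R * (t - b) by near: k; apply: big; rewrite subr_gt0.
by lra.
Unshelve. all: by end_near. Qed.

End half_plateau.

Section plateau_facts.
Context {R : realType}.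
Implicit Types a b k t : R.

Lemma plateau_support k a b t : 0 < k -> plateau k a b t != 0 -> a < t < b.
Proof.
move=> k0; rewrite mulf_eq0 negb_or => /andP[h1 h2]; apply/andP; split.
  by rewrite ltNge; apply: contra h1 => ta; rewrite step_le0// pmulr_rle0// subr_le0.
by rewrite ltNge; apply: contra h2 => ta; rewrite step_le0// pmulr_rle0// subr_le0.
Qed.

Lemma plateau_le1 k a b t : `|plateau k a b t| <= 1.
Proof. by rewrite normrM !ger0_norm ?step_ge0// mulr_ile1 ?step_ge0 ?step_le1. Qed.

Lemma plateau_ge0 k a b t : 0 <= plateau k a b t.
Proof. by rewrite mulr_ge0 ?step_ge0. Qed.

Lemma continuous_dplateau k a b : continuous (plateau k a b)^`()%classic.
Proof. exact/smooth1_continuous/smooth1_derive1/plateau_smooth1. Qed.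

Lemma dplateau_support k a b t : 0 < k ->
  (plateau k a b)^`()%classic t != 0 -> a <= t <= b.
Proof.
move=> k0 h; apply/andP; split; rewrite leNgt; apply: contra h => ht; apply/eqP;
  rewrite derive1E -(derive_cst (0 : R) t (1 : R)); apply: near_eq_derive; near=> s;
  apply/eqP; apply/negP => /negP/(plateau_support k0)/andP[h1 h2].
  have : s < a by near: s; exact: lt_nbhsl.
  by rewrite ltNge (ltW h1).
have : b < s by near: s; exact: lt_nbhsr.
by rewrite ltNge (ltW h2).
Unshelve. all: by end_near. Qed.

Lemma dplateau_bounded k a b : 0 < k -> a < b ->
  exists M : R, forall t, `|(plateau k a b)^`()%classic t| <= M.
Proof.
move=> k0 ab; set d := (plateau k a b)^`()%classic.
have dc : continuous d by exact: continuous_dplateau.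
have [c _ hc] := @EVT_max R (fun t => `|d t|) a b (ltW ab)
  (continuous_subspaceT (fun x => continuous_comp (dc x) (@norm_continuous _ _ _))).
exists `|d c| => t; have [->|/(dplateau_support k0) tab] := eqVneq (d t) 0.
  by rewrite normr0.
by apply: hc; rewrite in_itv.
Qed.

End plateau_facts.

Section weak_slices.
Context {R : realType} {n : nat} (i : 'I_n.+1) (p : R).
Hypothesis p1 : 1 <= p.
Variables (u : 'rV[R]_n.+1 -> R) (G : 'rV[R]_n.+1 -> 'rV[R]_n.+1).
Hypotheses (uLp : u \in Lfun (@lebesgueN R n.+1) p%:E).
Hypothesis wG : weak_gradient p u G.
Local Notation lam := (@lebesgue_measure R).
Local Notation mu := (@lebesgueN R n).
Local Notation muS := (@lebesgueN R n.+1).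
Local Notation RL := (measurableTypeR R).
Let Gi x : R := G x ord0 i.

Definition others (x : 'rV[R]_n.+1) : 'rV[R]_n := \row_j x ord0 (lift i j).

Lemma others_insert t y : others (insert i (t, y)) = y.
Proof. by apply/rowP => j; rewrite mxE insert_lift. Qed.

Lemma measurable_others : measurable_fun setT others.
Proof.
apply/measurable_fun_rVP => j; under eq_fun do rewrite mxE.
exact: measurable_coor.
Qed.

(** The test functions of the slicing argument: a fixed function of the i-th
    coordinate, and approximate indicators in the others. *)
Definition tensor (k a b l : R) (c d : 'I_n -> R) (x : 'rV[R]_n.+1) : R :=
  plateau k a b (x ord0 i) *
  \prod_(j < n) half_plateau l (c j) (d j) (x ord0 (lift i j)).

Lemma smooth_gen_tensor k a b l c d : smooth_gen (tensor k a b l c d).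
Proof.
apply: smooth_genM.
  exact/smooth_gen_coord_comp/plateau_smooth1.
apply: smooth_gen_prod => j.
exact/smooth_gen_coord_comp/half_plateau_smooth1.
Qed.

Lemma tensor_support k a b l c d x : 0 < k -> 1 <= l -> tensor k a b l c d x != 0 ->
  a < x ord0 i < b /\ forall j, c j < x ord0 (lift i j) <= d j + 1.
Proof.
move=> k0 l1; rewrite mulf_eq0 negb_or => /andP[/(plateau_support k0) -> h2].
split=> // j; apply: (half_plateau_support l1); apply: contraNneq h2 => h.
by rewrite prodf_seq_eq0; apply/hasP; exists j; rewrite ?mem_index_enum//= h.
Qed.

Lemma tensor_test k a b l c d : 0 < k -> 1 <= l -> test_function (tensor k a b l c d).
Proof.
move=> k0 l1.
pose M := `|a| + `|b| + \sum_(j < n) (`|c j| + `|d j + 1|).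
have sM j : `|c j| + `|d j + 1| <= \sum_(j < n) (`|c j| + `|d j + 1|).
  by rewrite (bigD1 j)//= lerDl sumr_ge0// => m _; rewrite addr_ge0.
have s0 : 0 <= \sum_(j < n) (`|c j| + `|d j + 1|).
  by rewrite sumr_ge0// => m _; rewrite addr_ge0.
apply: (@smooth_gen_test _ _ _ M); first exact: smooth_gen_tensor.
move=> x /(tensor_support k0 l1)[/andP[h1 h2] h3] j.
have [m ->|->] := unliftP i j.
  have /andP[h4 h5] := h3 m; have := sM m; have := ler_norm (- c m).
  have := ler_norm (d m + 1); rewrite normrN ler_norml /M.
  have := normr_ge0 a; have := normr_ge0 b; have := normr_ge0 (c m); have := normr_ge0 (d m + 1).
  by move=> *; apply/andP; split; lra.
have := ler_norm (- a); have := ler_norm b; rewrite normrN ler_norml /M.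
have := normr_ge0 a; have := normr_ge0 b.
by move=> *; apply/andP; split; lra.
Qed.

Lemma partial_tensor k a b l c d x : partial i (tensor k a b l c d) x =
  (plateau k a b)^`()%classic (x ord0 i) *
  \prod_(j < n) half_plateau l (c j) (d j) (x ord0 (lift i j)).
Proof.
have d1 : is_derive x (delta_mx ord0 i) (fun x => plateau k a b (x ord0 i))
    ((plateau k a b)^`()%classic (x ord0 i)).
  have sg : smooth_gen (fun x : 'rV[R]_n.+1 => plateau k a b (x ord0 i)).
    exact/smooth_gen_coord_comp/plateau_smooth1.
  apply: DeriveDef; first exact/diff_derivable/smooth_gen_differentiable.
  have := @partial_comp R n.+1 i (plateau k a b) (fun x => x ord0 i) x (@plateau_smooth1 R k a b)
    (smooth_gen_differentiable (smooth_gen_coord i) x).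
  rewrite /partial => ->; have [_ ->] := is_derive_coord i x (delta_mx ord0 i).
  by rewrite mxE !eqxx mulr1.
have d2 : is_derive x (delta_mx ord0 i : 'rV[R]_n.+1)
    (fun x => \prod_(j < n) half_plateau l (c j) (d j) (x ord0 (lift i j))) 0.
  apply: is_derive_invariant => h; apply: eq_bigr => j _.
  by rewrite !mxE eqxx/= eq_sym (negbTE (neq_lift _ _)) mulr0 add0r.
rewrite /partial; have [_ ->] := is_deriveM d1 d2.
by rewrite scaler0 add0r /GRing.scale/= mulrC.
Qed.

Section fixed_plateau.
Variables (k a b : R).
Hypotheses (k0 : 0 < k) (ab : a < b).
Local Notation eta := (plateau k a b).
Local Notation deta := ((plateau k a b)^`()%classic).

Let H x := u x * deta (x ord0 i) + Gi x * eta (x ord0 i).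

Lemma tested_integrable (chi : 'rV[R]_n -> R) (M : R) (c d : 'I_n -> R) :
  measurable_fun setT chi -> (forall y, `|chi y| <= M) ->
  (forall y, ~ cube c d y -> chi y = 0) ->
  [/\ muS.-integrable setT (EFin \o (fun x => u x * (deta (x ord0 i) * chi (others x)))),
   muS.-integrable setT (EFin \o (fun x => Gi x * (eta (x ord0 i) * chi (others x)))) &
   muS.-integrable setT (EFin \o (fun x => H x * chi (others x)))].
Proof.
move=> mchi chiM chi0.
(* The support in the i-th coordinate is [a, b], and boxes are open on the left. *)
pose c' j := if unlift i j is Some m then c m else a - 1.
pose d' j := if unlift i j is Some m then d m else b.
have mQ : measurable (cube c' d') by exact: measurable_cube.
have Qoo : (muS (cube c' d') < +oo)%E by exact: lebesgueN_cube_lty.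
have iu := Lfun_integrable_finite p1 uLp mQ Qoo.
have iG := Lfun_integrable_finite p1 (wG i).1 mQ Qoo.
have M0 : 0 <= M by apply: le_trans (chiM 0).
have mchi' : measurable_fun setT (chi \o others) by exact: measurableT_comp mchi measurable_others.
have [D dD] := dplateau_bounded k0 ab.
have D0 : 0 <= D by apply: le_trans (dD 0).
have inQ (x : 'rV[R]_n.+1) : a <= x ord0 i <= b -> cube c d (others x) -> cube c' d' x.
  move=> /andP[h1 h2] h3 j /=; rewrite /c' /d'; case: (unliftP i j) => [m ->|->].
    by have := h3 m; rewrite /= mxE.
  by rewrite in_itv/= h2 andbT; lra.
have i1 : muS.-integrable setT (EFin \o (fun x => u x * (deta (x ord0 i) * chi (others x)))).
  apply: (integrable_mul_support (M := D * M) mQ iu).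
  - apply: measurable_funM => //.
    apply: (measurableT_comp _ (measurable_coor i)).
    by apply: continuous_measurable_fun; exact: continuous_dplateau.
  - by move=> x; rewrite normrM ler_pM.
  - move=> x xQ; have [cx|/chi0 ->] := pselect (cube c d (others x)); last by rewrite mulr0.
    have [->|/(dplateau_support k0) xab] := eqVneq (deta (x ord0 i)) 0; first by rewrite mul0r.
    by exfalso; apply: xQ; exact: inQ.
have i2 : muS.-integrable setT (EFin \o (fun x => Gi x * (eta (x ord0 i) * chi (others x)))).
  apply: (integrable_mul_support (M := 1 * M) mQ iG).
  - apply: measurable_funM => //.
    apply: (measurableT_comp _ (measurable_coor i)).
    by apply: continuous_measurable_fun; apply: smooth1_continuous; exact: plateau_smooth1.
  - by move=> x; rewrite normrM ler_pM//; exact: plateau_le1.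
  - move=> x xQ; have [cx|/chi0 ->] := pselect (cube c d (others x)); last by rewrite mulr0.
    have [->|/(plateau_support k0) /andP[/ltW xa /ltW xb]] := eqVneq (eta (x ord0 i)) 0; first by rewrite mul0r.
    by exfalso; apply: xQ; apply: inQ => //; rewrite xa.
split => //.
have := integrableD measurableT i1 i2; apply: eq_integrable => // x _.
by rewrite /= -EFinD mulrDl !mulrA.
Qed.

Lemma tested_half_plateau (l : R) c d : 1 <= l ->
  \int[muS]_x (H x * \prod_(j < n) half_plateau l (c j) (d j) (others x ord0 j)) = 0.
Proof.
move=> l1; pose chi (y : 'rV[R]_n) := \prod_(j < n) half_plateau l (c j) (d j) (y ord0 j).
have mchi : measurable_fun setT chi.
  apply: measurable_smooth_gen; apply: smooth_gen_prod => j.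
  exact/smooth_gen_coord_comp/half_plateau_smooth1.
have chi1 y : `|chi y| <= 1.
  rewrite normr_prod; apply: prodr_ile1 => j _.
  by rewrite normr_ge0/= ger0_norm ?half_plateau_le1// half_plateau_ge0.
have chi0 y : ~ cube c (fun j => d j + 1) y -> chi y = 0.
  apply: contra_notP => /eqP h j /=; rewrite in_itv/=; apply: (half_plateau_support l1).
  apply: contraNneq h => hj; rewrite prodf_seq_eq0; apply/hasP.
  by exists j; rewrite ?mem_index_enum//= hj.
have [i1 i2 i3] := tested_integrable mchi chi1 chi0.
have [_ /(_ (tensor k a b l c d) (tensor_test _ _ _ _ k0 l1))] := wG i.
have E x : \prod_(j < n) half_plateau l (c j) (d j) (others x ord0 j) =
    \prod_(j < n) half_plateau l (c j) (d j) (x ord0 (lift i j)).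
  by apply: eq_bigr => j _; rewrite mxE.
under eq_Rintegral do rewrite partial_tensor -E.
under [X in _ = - X -> _]eq_Rintegral do rewrite /tensor -E.
move=> h; have -> : \int[muS]_x (H x * \prod_(j < n) half_plateau l (c j) (d j) (others x ord0 j)) =
    \int[muS]_x (u x * (deta (x ord0 i) * chi (others x)) + Gi x * (eta (x ord0 i) * chi (others x))).
  by apply: eq_Rintegral => x _; rewrite mulrDl !mulrA.
by rewrite RintegralD// h addNr.
Qed.

(** Dominated convergence from half plateaus to the indicator of a box. *)
Lemma tested_cube c d : \int[muS]_x (H x * \1_(cube c d) (others x)) = 0.
Proof.
pose chi (l : nat) (y : 'rV[R]_n) := \prod_(j < n) half_plateau l.+1%:R (c j) (d j) (y ord0 j).
have lim1 : \int[muS]_x (H x * chi l (others x)) @[l --> \oo] --> (0 : R).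
  by apply: cvg_near_cst; near=> l; apply: tested_half_plateau; rewrite ler1n.
pose d1 j := d j + 1.
have mQ : measurable (cube c d1) by exact: measurable_cube.
have ind1 y : `|\1_(cube c d1) y : R| <= 1.
  by rewrite indicE; case: (_ \in _); rewrite ?normr1 ?normr0.
have ind0 y : ~ cube c d1 y -> \1_(cube c d1) y = 0 :> R.
  by move=> h; rewrite indicE memNset.
have [_ _ iH] := tested_integrable (@measurable_indic _ _ _ _ _ mQ) ind1 ind0.
have sub : cube c d `<=` cube c d1.
  move=> y h j; have := h j; rewrite /= !in_itv/= /d1 => /andP[-> h2].
  by rewrite (le_trans h2)// lerDl.
have mchi l : measurable_fun setT (chi l).
  apply: measurable_smooth_gen; apply: smooth_gen_prod => j.
  exact/smooth_gen_coord_comp/half_plateau_smooth1.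
have chi1 l y : `|chi l y| <= 1.
  rewrite normr_prod; apply: prodr_ile1 => j _.
  by rewrite normr_ge0/= ger0_norm ?half_plateau_le1// half_plateau_ge0.
have chi0 l y : ~ cube c d1 y -> chi l y = 0.
  apply: contra_notP => /eqP h j /=; rewrite in_itv/=.
  apply: (@half_plateau_support _ l.+1%:R); first by rewrite ler1n.
  apply: contraNneq h => hj; rewrite prodf_seq_eq0; apply/hasP.
  by exists j; rewrite ?mem_index_enum//= hj.
have chiE l y : chi l y = chi l y * \1_(cube c d1) y.
  rewrite indicE; case: (boolP (_ \in _)); rewrite ?mulr1//.
  by rewrite notin_setE => /chi0 ->; rewrite mul0r.
have indE y : \1_(cube c d) y = \prod_(j < n) \1_(`]c j, d j]%classic) (y ord0 j) :> R.
  rewrite indicE; case: (boolP (_ \in _)) => [|].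
    rewrite inE => h; rewrite big1// => j _; rewrite indicE mem_set//; exact: h.
  rewrite notin_setE => h; apply/esym/eqP; rewrite prodf_seq_eq0.
  apply/negPn; apply: contra_notN h => /hasPn h j /=.
  have := h j; rewrite mem_index_enum/= => /(_ isT).
  by rewrite indicE; case: (boolP (_ \in _)); rewrite ?inE//= eqxx.
have chicvg y : chi l y @[l --> \oo] --> (\1_(cube c d) y : R).
  rewrite indE /chi; elim: (index_enum 'I_n) => [|j s IH].
    by rewrite big_nil; under eq_fun do rewrite big_nil; exact: cvg_cst.
  rewrite big_cons; under eq_fun do rewrite big_cons.
  by apply: cvgM => //; exact: half_plateau_cvg.
have mQ' : measurable (cube c d) by exact: measurable_cube.
have ind1' y : `|\1_(cube c d) y : R| <= 1.
  by rewrite indicE; case: (_ \in _); rewrite ?normr1 ?normr0.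
have ind0' y : ~ cube c d y -> \1_(cube c d) y = 0 :> R.
  by move=> h; rewrite indicE memNset.
have [_ _ iH'] := tested_integrable (@measurable_indic _ _ _ _ _ mQ') ind1' ind0'.
have lim2 : \int[muS]_x (H x * chi l (others x)) @[l --> \oo] -->
    \int[muS]_x (H x * \1_(cube c d) (others x)).
  apply: (@Rintegral_dominated_cvg _ _ _ muS setT measurableT _ _ (fun x => `|H x * \1_(cube c d1) (others x)|)).
  - move=> l; have [_ _ h] := tested_integrable (mchi l) (chi1 l) (chi0 l).
    by apply/measurable_EFinP; exact: measurable_int h.
  - by apply/measurable_EFinP; exact: measurable_int iH'.
  - by apply: aeW => x _; apply: cvgMr; exact: chicvg.
  - exact: integrable_norm.
  - apply: aeW => x l _; rewrite chiE mulrCA normrM ler_piMl//; exact: chi1.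
exact: (cvg_unique _ lim2 lim1).
Unshelve. all: by end_near. Qed.

(** By Fubini, the integral over the i-th coordinate has zero integral over
    every box in the other coordinates, so it vanishes almost everywhere. *)
Lemma tested_slice : {ae mu, forall y,
  \int[lam]_(t in `[a, b]) (u (insert i (t, y)) * deta t + Gi (insert i (t, y)) * eta t) = 0}.
Proof.
pose Q (M : nat) : set 'rV[R]_n := cube (fun=> - M%:R) (fun=> M%:R).
pose K M y := slice_integral i (fun x => H x * \1_(Q M) (others x)) y.
have ind1 (A : set 'rV[R]_n) y : `|\1_A y : R| <= 1.
  by rewrite indicE; case: (_ \in _); rewrite ?normr1 ?normr0.
have mQ M : measurable (Q M) by exact: measurable_cube.
have ind0 (A : set 'rV[R]_n) y : ~ A y -> \1_A y = 0 :> R.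
  by move=> h; rewrite indicE memNset.
have iH M : muS.-integrable setT (EFin \o (fun x => H x * \1_(Q M) (others x))).
  by have [_ _] := tested_integrable (@measurable_indic _ _ _ _ _ (mQ M)) (ind1 _) (@ind0 _).
have K0 M : {ae mu, forall y, K M y = 0}.
  have [iK _] := slice_integral_fubini i (iH M).
  apply: cube_integral_eq0_ae => c d.
    by apply: integrableS iK => //; exact: measurable_cube.
  have mcd : measurable (cube c d) by exact: measurable_cube.
  pose c' j := Num.max (- M%:R) (c j); pose d' j := Num.min M%:R (d j).
  have QE : Q M `&` cube c d = cube c' d'.
    apply/seteqP; split=> y.
      move=> [xab xcd] j; have := xab j; have := xcd j.
      by rewrite /= !in_itv/= gt_max le_min => /andP[-> ->] /andP[-> ->].
    move=> h; split => j; have := h j; rewrite /= !in_itv/= gt_max le_min.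
      by move=> /andP[/andP[-> _] /andP[-> _]].
    by move=> /andP[/andP[_ ->] /andP[_ ->]].
  have i1 : muS.-integrable setT (EFin \o (fun x => H x * \1_(cube c' d') (others x))).
    by have [_ _] := tested_integrable (@measurable_indic _ _ _ _ _ (measurable_cube c' d')) (ind1 _) (@ind0 _).
  have [iK' KE] := slice_integral_fubini i i1.
  have E y : slice_integral i (fun x => H x * \1_(cube c' d') (others x)) y =
      K M y * \1_(cube c d) y.
    rewrite /K /slice_integral -QE.
    under eq_Rintegral do rewrite others_insert indicI mulrA.
    under [in RHS]eq_Rintegral do rewrite others_insert.
    rewrite [\1_(cube c d) y]indicE; case: (_ \in _); rewrite ?mulr0 ?mulr1.
      by under eq_Rintegral do rewrite mulr1.
    under eq_Rintegral do rewrite mulr0.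
    by rewrite /Rintegral integral0.
  have : \int[mu]_y (K M y * \1_(cube c d) y) = 0.
    by rewrite -(tested_cube c' d') KE; apply: eq_Rintegral => y _; rewrite E.
  rewrite /Rintegral; set I := (X in fine X) => I0.
  have If : I \is a fin_num.
    have := integrable_fin_num measurableT iK'.
    by under eq_integral do rewrite /= E.
  have -> : (\int[mu]_(y in cube c d) (K M y)%:E)%E = I.
    rewrite integral_mkcond; apply: eq_integral => y _.
    by rewrite patchE indicE; case: ifPn; rewrite ?mulr1 ?mulr0.
  by rewrite -(fineK If) I0.
have : {ae mu, forall y, forall M, K M y = 0} by apply: ae_foralln.
apply: (@filterS _ _ (ae_filter_ringOfSetsType mu)) => y Ky.
have : [set: 'rV[R]_n] y by [].
rewrite -cube_cover => -[M _ yM].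
rewrite -(Ky M) /K /slice_integral Rintegral_mkcond; apply: eq_Rintegral => t _.
rewrite others_insert indicE mem_set// mulr1 /H insert_id/= patchE.
case: ifPn => // tab; apply/esym.
have tab' : ~~ (a <= t <= b) by move: tab; rewrite notin_setE/= in_itv/= => /negP.
have -> : deta t = 0.
  by apply/eqP; apply: contraNT tab' => /(dplateau_support k0).
have -> : eta t = 0.
  by apply/eqP; apply: contraNT tab' => /(plateau_support k0) /andP[/ltW -> /ltW ->].
by rewrite !mulr0 addr0.
Qed.

End fixed_plateau.

End weak_slices.

(** * The weak gradient of a radial function *)

Section weak_derivative_line.
Context {R : realType}.
Local Notation lam := (@lebesgue_measure R).
Implicit Types (H g : R -> R) (a b t : R).

(** g is a weak derivative of H as far as the plateaus of [a, b] can tell. *)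
Definition weak_tested H g a b := forall k : nat, \int[lam]_(t in `[a, b])
   (H t * (plateau k.+1%:R a b)^`()%classic t + g t * plateau k.+1%:R a b t) = 0.

Lemma continuous_lebesgue_ptT H t : continuous H -> lebesgue_pt H t.
Proof.
move=> cH; apply: (@continuous_lebesgue_pt _ H t setT) => //.
  by split=> //; exact: openT.
  exact: continuous_measurable_fun.
exact: cH.
Qed.

Lemma eq_on_rat_itv (h : R -> R) a b c : (forall t, a < t < b -> {for t, continuous h}) ->
  (forall r : rat, a < ratr r < b -> h (ratr r) = c) ->
  forall t, a < t < b -> h t = c.
Proof.
move=> ch hr t tab; apply/eqP; apply: contraT => htc.
have htc0 : `|h t - c| > 0 by rewrite normr_gt0 subr_eq0.
have /andP[ta tb] := tab.
have : \forall s \near t, a < s < b /\ `|h t - h s| < `|h t - c|.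
  near=> s; split.
    apply/andP; split; near: s; [exact: lt_nbhsr|exact: lt_nbhsl].
  by near: s; move/cvgrPdist_lt: (ch t tab); apply.
move=> /nbhs_ballP[e /= e0 he].
have /rat_in_itvoo[r] : t - e < t + e by rewrite ltrD2l gtrN.
rewrite in_itv/= => /andP[r1 r2].
have [rab] : a < ratr r < b /\ `|h t - h (ratr r)| < `|h t - c|.
  by apply: he; rewrite /ball/= ltr_distlC r1.
by rewrite hr// ltxx.
Unshelve. all: by end_near. Qed.

Lemma integrable_itv_sub g a b (M : nat) : - M%:R <= a -> b <= M%:R ->
  lam.-integrable `[- M%:R, M%:R] (EFin \o g) -> lam.-integrable `[a, b] (EFin \o g).
Proof.
move=> aM bM; apply: integrableS; [exact: measurable_itv|exact: measurable_itv|].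
by apply: subset_itv; rewrite bnd_simp.
Qed.

Section locally_integrable_line.
Variable g : R -> R.
Hypotheses (mg : measurable_fun setT (g : measurableTypeR R -> R)).
Hypothesis ig : forall M : nat, lam.-integrable `[- M%:R, M%:R] (EFin \o g).

Lemma integrable_itvT a b : lam.-integrable `[a, b] (EFin \o g).
Proof.
pose M := Num.bound (`|a| + `|b|).
have : `|a| + `|b| < M%:R by rewrite archi_boundP.
move=> hM; apply: (@integrable_itv_sub _ _ _ M) => //.
  have := ler_norm (- a); rewrite normrN; have := normr_ge0 b; lra.
have := ler_norm b; have := normr_ge0 a; lra.
Qed.

Lemma locally_integrable_itv : locally_integrable setT g.
Proof.
split => //; first exact: openT.
move=> K _ cK; have [M0 [_ /(_ (`|M0| + 1))]] := compact_bounded cK.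
have M0lt : M0 < `|M0| + 1 by rewrite (le_lt_trans (ler_norm _))// ltrDl.
move=> /(_ M0lt) KM.
pose M := Num.bound (`|M0| + 1).
have sK : K `<=` `[- M%:R, M%:R]%classic.
  move=> x /KM/= xM; rewrite in_itv/= -ler_norml (le_trans xM)// ltW// archi_boundP//.
have /integrableP[_] : lam.-integrable K (EFin \o g).
  have mK : measurable (K : set (measurableTypeR R)) by exact: compact_measurable.
  have mM : measurable (`[- M%:R, M%:R]%classic : set (measurableTypeR R)).
    exact: measurable_itv.
  exact: (@integrableS _ (measurableTypeR R) R lam _ _ _ mM mK sK (ig M)).
by [].
Qed.

Lemma primitive_continuous a s b : a < s < b ->
  {for s, continuous (fun x => \int[lam]_(t in `[a, x]) g t)}.
Proof.
move=> /andP[h1 h2]; have ab : a < b by exact: lt_trans h2.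
have := parameterized_integral_continuous (ltW ab) (integrable_itvT _ _).
move=> /(continuous_within_itvP _ ab)[h _ _].
by apply: h; rewrite in_itv/= h1.
Qed.

End locally_integrable_line.

Lemma continuous_itv_integrable (H : measurableTypeR R -> R) a b : continuous (H : R -> R) ->
  lam.-integrable `[a, b] (EFin \o H).
Proof.
move=> cH; apply: continuous_compact_integrable; first exact: segment_compact.
exact: continuous_subspaceT.
Qed.

Lemma weak_ftc H g (r s : rat) : continuous H ->
  (forall M : nat, lam.-integrable `[- M%:R, M%:R] (EFin \o g)) -> r < s ->
  weak_tested H g (ratr r) (ratr s) ->
  H (ratr s) - H (ratr r) = \int[lam]_(t in `[ratr r, ratr s]) g t.
Proof.
move=> cH ig rs Hg; apply: du_bois_reymond => //.
- by rewrite ltr_rat.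
- exact: continuous_measurable_fun.
- exact: continuous_itv_integrable.
- exact: integrable_itvT.
- exact: continuous_lebesgue_ptT.
- exact: continuous_lebesgue_ptT.
Qed.

(** Rational endpoints suffice to identify the continuous function H with a
    primitive of g; this matters because exceptional sets depend on the
    endpoints. Lebesgue differentiation then concludes. *)
Lemma weak_derivative_ae H g : continuous H -> measurable_fun setT (g : measurableTypeR R -> R) ->
  (forall M : nat, lam.-integrable `[- M%:R, M%:R] (EFin \o g)) ->
  (forall r s : rat, r < s -> weak_tested H g (ratr r) (ratr s)) ->
  {ae lam, forall t : R, is_derive t 1 H (g t)}.
Proof.
move=> cH mg ig Hg; have lg := locally_integrable_itv mg ig.
have step1 (M : nat) : {ae lam, forall t : R, - M.+1%:R < t < M.+1%:R -> is_derive t 1 H (g t)}.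
  have := FTC1 (a := BLeft (- M.+1%:R)) (fun y => integrable_itvT ig _ y) lg.
  set F := (X in let _ := X in _) => /=.
  apply: (@filterS _ _ (ae_filter_ringOfSetsType lam)) => t /[swap] /andP[t1 t2].
  rewrite lte_fin => /(_ t1)[dF eF].
  have HF : forall s, - M.+1%:R < s < M.+1%:R -> (H \- F) s = H (- M.+1%:R).
    apply: eq_on_rat_itv.
      by move=> s sM; apply: cvgB; [exact: cH|exact: primitive_continuous sM].
    move=> r /andP[r1 r2] /=.
    pose q : rat := - M.+1%:R.
    have qE : ratr q = - M.+1%:R :> R by rewrite /q rmorphN/= ratr_nat.
    have qr : q < r by rewrite -(ltr_rat R) qE.
    have := weak_ftc cH ig qr (Hg _ _ qr).
    by rewrite qE /F => <-; rewrite opprB addrC subrK.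
  have FH : \forall s \near t, F s + H (- M.+1%:R) = H s.
    near=> s.
    have sM : - M.+1%:R < s < M.+1%:R.
      by apply/andP; split; near: s; [exact: lt_nbhsr|exact: lt_nbhsl].
    by rewrite -(HF s sM)/= addrC subrK.
  have dFt : is_derive t 1 F (g t) by apply: DeriveDef; [exact: dF|rewrite -derive1E; exact: eF].
  have dFc : is_derive t 1 (fun s => F s + H (- M.+1%:R)) (g t).
    by rewrite -[g t]addr0; apply: is_deriveD.
  apply: near_eq_is_derive dFc => //.
have := @ae_foralln _ _ _ lam (fun M t => - M.+1%:R < t < M.+1%:R -> is_derive t 1 H (g t)) step1.
apply: (@filterS _ _ (ae_filter_ringOfSetsType lam)) => t /(_ (Num.bound `|t|)); apply.
rewrite -ltr_norml; apply: lt_trans (archi_boundP _) _ => //.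
by rewrite ltr_nat.
Unshelve. all: by end_near. Qed.

End weak_derivative_line.

Section radial_profile.
Context {R : realType}.
Local Notation lam := (@lebesgue_measure R).
Local Notation RL := (measurableTypeR R).

Lemma nsq_insert n (i : 'I_n.+1) (t : R) (y : 'rV[R]_n) : nsq (insert i (t, y)) = t ^+ 2 + nsq y.
Proof.
rewrite /nsq /dotp (bigD1_ord i)//= insert_id/= expr2; congr (_ + _).
by apply: eq_bigr => j _; rewrite insert_lift.
Qed.

(** On every line parallel to the first axis the first coordinate is nonzero
    except at one point. *)
Lemma ae_neq0 n : {ae @lebesgueN R n.+1, forall y, 0 < nsq y}.
Proof.
have m0 : measurable [set y : 'rV[R]_n.+1 | y ord0 ord0 != 0].
  rewrite (_ : [set _ | _] = ~` [set y : 'rV[R]_n.+1 | y ord0 ord0 = 0]); last first.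
    by apply/seteqP; split=> y /= /eqP.
  apply: measurableC; rewrite -[X in measurable X]setTI.
  exact: (@measurable_coor R n.+1 ord0 measurableT [set 0] (measurable_set1 0)).
have := (ae_slices ord0 m0).2; move=> h.
have : {ae @lebesgueN R n.+1, forall y : 'rV[R]_n.+1, y ord0 ord0 != 0}.
  apply: h; apply: aeW => y /=; exists [set 0]; split; first exact: measurable_set1.
    exact: lebesgue_measure_set1.
  by move=> t /= /negP; rewrite insert_id negbK => /eqP.
apply: (@filterS _ _ (ae_filter_ringOfSetsType _)) => y y0.
by apply: lt_le_trans (nsq_coor y ord0); rewrite exprn_even_gt0.
Qed.

Lemma nsq_delta n : nsq (delta_mx ord0 ord0 : 'rV[R]_n.+1) = 1.
Proof.
rewrite /nsq /dotp (bigD1 ord0)//= big1 ?addr0; last first.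
  by move=> j j0; rewrite mxE (negbTE j0) andbF mul0r.
by rewrite mxE !eqxx !mulr1.
Qed.

(** Parametrised by |x|^2, which unlike |x| is smooth at the origin. *)
Definition profile n (u : 'rV[R]_n.+1 -> R) (s : R) : R :=
  u (Num.sqrt s *: delta_mx ord0 ord0).

(** A derivative that is measurable without any assumption of
    differentiability. *)
Definition upper_derivative (V : R -> R) (s : R) : R :=
  fine (limn_esup (fun n : nat => (n.+1%:R * (V (s + n.+1%:R^-1) - V s))%:E)).

Lemma upper_derivativeE (V : R -> R) (s l : R) : is_derive s 1 V l -> upper_derivative V s = l.
Proof.
move=> [dV eV]; rewrite /upper_derivative.
have cV : (n.+1%:R * (V (s + n.+1%:R^-1) - V s))%:E @[n --> \oo] --> l%:E.
  apply: cvg_EFin; first exact: nearW.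
  have : h^-1 *: (V (h + s) - V s) @[h --> 0^'] --> l.
    have /cvg_ex[l' hl'] := dV.
    have <- : l' = l by rewrite -eV; apply/esym/cvg_lim.
    apply: cvg_trans hl'; apply: near_eq_cvg; near=> h.
    by rewrite /= /GRing.scale/= mulr1.
  move/cvgr_dnbhsP => /(_ (fun n => n.+1%:R^-1)) h.
  have : n.+1%:R^-1^-1 *: (V (n.+1%:R^-1 + s) - V s) @[n --> \oo] --> l.
    apply: h; split; last exact: cvg_harmonic.
    by move=> n; rewrite invr_eq0.
  apply: cvg_trans; apply: near_eq_cvg; near=> n.
  by rewrite /= /GRing.scale/= invrK [_^-1 + s]addrC.
by rewrite is_cvg_limn_esupE; [rewrite (cvg_lim _ cV)|apply/cvg_ex; exists l%:E].
Unshelve. all: by end_near. Qed.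

Lemma measurable_upper_derivative (V : RL -> R) : measurable_fun setT V ->
  measurable_fun setT (upper_derivative V : RL -> R).
Proof.
move=> mV; apply: (measurableT_comp (fine_measurable measurableT)).
apply: measurable_fun_limn_esup => n; apply/measurable_EFinP.
apply: measurable_funM => //; apply: measurable_funB => //.
apply: measurableT_comp => //; exact: measurable_funD.
Qed.

Section fixed_u.
Variables (n : nat) (u : 'rV[R]_n.+1 -> R).
Hypotheses (hrad : radial u) (hcont : forall x, x != 0 -> {for x, continuous u}).
Let V := profile u.

Lemma profileE x : u x = V (nsq x).
Proof.
apply: hrad; rewrite /enorm; congr Num.sqrt.
rewrite -/(nsq x) -/(nsq (_ *: _)) nsqZ sqr_sqrtr ?nsq_ge0//.
by rewrite nsq_delta mulr1.
Qed.

Lemma profile_continuous s : 0 < s -> {for s, continuous V}.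
Proof.
move=> s0; rewrite /V /profile.
apply: (@continuous_comp _ _ _ (fun s => Num.sqrt s *: delta_mx ord0 ord0) u).
  apply: cvgZr_tmp; exact: sqrt_continuous.
apply: hcont; rewrite scaler_eq0 negb_or sqrtr_eq0 -ltNge s0/=.
by apply/eqP => /rowP/(_ ord0); rewrite !mxE !eqxx => /eqP; rewrite oner_eq0.
Qed.

Lemma measurable_profile : measurable_fun setT (V : RL -> R).
Proof.
rewrite (_ : V = fun s => if 0 < s then V s else u 0); last first.
  apply/funext => s; case: ifPn => // s0; rewrite /V /profile.
  by rewrite ler0_sqrtr ?scale0r// leNgt.
apply: measurable_fun_if => //=; first exact: measurable_fun_ltr.
rewrite setTI (_ : (fun s : R => 0 < s) @^-1` [set true] = `]0, +oo[%classic); last first.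
  by apply/seteqP; split=> s; rewrite /= in_itv/= andbT.
apply: open_continuous_measurable_fun; first exact: interval_open.
by move=> s; rewrite inE/= in_itv/= andbT => /profile_continuous.
Qed.

End fixed_u.

Section slices_of_radial.
Variables (n : nat) (u : 'rV[R]_n.+2 -> R) (G : 'rV[R]_n.+2 -> 'rV[R]_n.+2) (p : R).
Hypotheses (hrad : radial u) (hcont : forall x, x != 0 -> {for x, continuous u}).
Hypotheses (p1 : 1 <= p) (uLp : u \in Lfun (@lebesgueN R n.+2) p%:E).
Hypothesis wG : weak_gradient p u G.
Local Notation mu := (@lebesgueN R n.+1).
Local Notation muS := (@lebesgueN R n.+2).
Local Notation V := (profile u).
Local Notation w := (upper_derivative V).

(** Truncate to large boxes and apply Fubini. *)
Lemma integrable_slice_itv (i : 'I_n.+2) (h : 'rV[R]_n.+2 -> R) :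
  h \in Lfun (@lebesgueN R n.+2) p%:E ->
  {ae mu, forall y, forall M : nat,
    lam.-integrable `[- M%:R, M%:R] (fun t : RL => (h (insert i (t, y)))%:E)}.
Proof.
move=> hLp.
pose Q (M : nat) : set 'rV[R]_n.+2 := cube (fun=> - M%:R) (fun=> M%:R).
have mQ M : measurable (Q M) by exact: measurable_cube.
have iQ M : {ae mu, forall y, lam.-integrable setT (fun t : RL => (h (insert i (t, y)) * \1_(Q M) (insert i (t, y)))%:E)}.
  apply: (ae_integrable_slice i (f := fun x => h x * \1_(Q M) x)).
  have iA : muS.-integrable (Q M) (EFin \o h).
    by apply: (Lfun_integrable_finite p1 hLp); [exact: mQ|exact: lebesgueN_cube_lty].
  apply: (integrable_mul_support (mQ M) iA (M := 1)).
  - exact: measurable_indic.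
  - by move=> x; rewrite indicE; case: (_ \in _); rewrite ?normr1 ?normr0.
  - by move=> x h0; rewrite indicE memNset.
have := ae_foralln iQ; apply: (@filterS _ _ (ae_filter_ringOfSetsType mu)) => y Hy M.
pose yM := Num.bound (\sum_j `|y ord0 j|).
have yjM j : `|y ord0 j| < yM%:R.
  apply: le_lt_trans (archi_boundP _); last by rewrite sumr_ge0.
  by rewrite (bigD1 j)//= lerDl sumr_ge0.
pose K := (M + yM).+1.
have mM : measurable (`[- M%:R, M%:R]%classic : set RL) by exact: measurable_itv.
have := integrableS measurableT mM (@subsetT _ _) (Hy K).
apply: eq_integrable => // t; rewrite inE/= in_itv/= => /andP[t1 t2].
have KM : M%:R < K%:R :> R by rewrite ltr_nat ltnS leq_addr.
have Ky : yM%:R <= K%:R :> R by rewrite ler_nat ltnW// ltnS leq_addl.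
rewrite indicE mem_set ?mulr1// => j /=; rewrite in_itv/=.
have [m ->|->] := unliftP i j.
  rewrite insert_lift/=; have := yjM m; rewrite ltr_norml => /andP[h1 h2].
  by apply/andP; split; lra.
by rewrite insert_id/=; apply/andP; split; lra.
Qed.

(** There are only countably many triples of two rational endpoints and a
    sharpness. *)
Lemma weak_tested_slice (i : 'I_n.+2) : {ae mu, forall y, forall r s : rat, r < s ->
  weak_tested (fun t => u (insert i (t, y))) (fun t => G (insert i (t, y)) ord0 i)
    (ratr r) (ratr s)}.
Proof.
pose P (rsk : rat * rat * nat) y := let '(r, s, k) := rsk in r < s ->
  \int[lam]_(t in `[ratr r, ratr s]) (u (insert i (t, y)) *
    (plateau k.+1%:R (ratr r) (ratr s))^`()%classic t +
    G (insert i (t, y)) ord0 i * plateau k.+1%:R (ratr r) (ratr s) t) = 0.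
have HP rsk : {ae mu, forall y, P rsk y}.
  case: rsk => -[r s] k; rewrite /P; case: (boolP (r < s)) => rs; last first.
    by apply: aeW => y.
  have rs' : ratr r < ratr s :> R by rewrite ltr_rat.
  have k0 : 0 < k.+1%:R :> R by [].
  have := tested_slice i p1 uLp wG k0 rs'.
  by apply: (@filterS _ _ (ae_filter_ringOfSetsType mu)) => y Hy _.
(* The triples are encoded as natural numbers to intersect countably many sets. *)
have : {ae mu, forall y, forall N : nat, if unpickle N is Some rsk then P rsk y else True}.
  apply: ae_foralln => N; case: (unpickle N) => [rsk|]; [exact: HP|exact: aeW].
apply: (@filterS _ _ (ae_filter_ringOfSetsType mu)) => y Hy r s rs k.
have := Hy (pickle (r, s, k)); rewrite pickleK; exact.
Qed.

(** The line through the origin is excluded, since V need not be continuous at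
    0. *)
Lemma slice_derivative (i : 'I_n.+2) : {ae mu, forall y, {ae lam, forall t : R,
  is_derive t 1 (fun t => V (t ^+ 2 + nsq y)) (G (insert i (t, y)) ord0 i)}}.
Proof.
have mG : measurable_fun setT (fun x => G x ord0 i).
  by have [] := wG i; rewrite inE => /andP[/[!inE]].
have H1 := weak_tested_slice i; have H2 := integrable_slice_itv i (wG i).1.
have H3 := @ae_neq0 n; move: H1 H2 H3; apply: (@filterS3 _ _ (ae_filter_ringOfSetsType mu)).
move=> y Hy iy y0.
have uE t : u (insert i (t, y)) = V (t ^+ 2 + nsq y) by rewrite (profileE hrad) nsq_insert.
apply: weak_derivative_ae.
- move=> t; apply: (@continuous_comp _ _ _ (fun t : R => t ^+ 2 + nsq y) V).
    by apply: cvgD; [exact: exprn_continuous|exact: cvg_cst].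
  by apply: profile_continuous => //; rewrite ltr_wpDl// sqr_ge0.
- exact: (measurable_slice i y mG).
- exact: iy.
- move=> r s rs k; rewrite -[RHS](Hy r s rs k); apply: eq_Rintegral => t _.
  by rewrite uE.
Qed.

(** On either side of 0 the map from t to t^2 + c is inverted by a square root. *)
Lemma profile_derive (c t l : R) : 0 < c -> t != 0 ->
  is_derive t 1 (fun t => V (t ^+ 2 + c)) l -> is_derive (t ^+ 2 + c) 1 V (l / (2 * t)).
Proof.
move=> c0 t0 dt; pose e : R := Num.sg t.
have ee : e * e = 1 by rewrite /e -expr2 sqr_sg t0.
have tE : t = e * Num.sqrt (t ^+ 2) by rewrite sqrtr_sqr -numEsg.
have t2 : 0 < t ^+ 2 by rewrite exprn_even_gt0.
pose h (s : R) := e * (s - c) `^ 2^-1.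
have hs : h (t ^+ 2 + c) = t by rewrite /h addrK powR12_sqrt ?ltW//.
have dh : is_derive (t ^+ 2 + c) 1 h (2 * t)^-1.
  have d1 : is_derive (t ^+ 2 + c) 1 (fun s : R => s - c) 1.
    by have := is_derive_affine 1 (- c) (t ^+ 2 + c); under [X in is_derive _ _ X _]eq_fun do rewrite mul1r.
  have t2' : 0 < t ^+ 2 + c - c by rewrite addrK.
  have := @is_derive1_comp R (fun x : R => x `^ 2^-1) (fun s => s - c) (t ^+ 2 + c) _ _ (is_derive1_powR 2^-1 t2') d1.
  move=> d2; have := @is_deriveZ _ _ _ _ e _ _ _ d2.
  rewrite /GRing.scale/= mulr1 addrK => d3.
  have -> : (2 * t)^-1 = e * (2^-1 * (t ^+ 2) `^ (2^-1 - 1)).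
    have -> : (2^-1 - 1 : R) = - 2^-1 by lra.
    rewrite powRN powR12_sqrt ?ltW// [in LHS]tE !invfM.
    have e0 : e != 0 by rewrite /e sgr_eq0.
    have -> : e^-1 = e by apply: (mulfI e0); rewrite divff.
    by rewrite mulrCA.
  exact: d3.
have dt' : is_derive (h (t ^+ 2 + c)) 1 (fun t => V (t ^+ 2 + c)) l by rewrite hs.
have := @is_derive1_comp R _ h (t ^+ 2 + c) _ _ dt' dh.
apply: near_eq_is_derive; near=> s => /=.
have sc : 0 < s - c by rewrite subr_gt0; near: s; apply: lt_nbhsr; rewrite ltrDr.
by rewrite /h exprMn expr2 ee mul1r powR12_sqrt ?ltW// sqr_sqrtr ?ltW// subrK.
Unshelve. all: by end_near. Qed.

Lemma measurable_eq_set d (T : measurableType d) (f g : T -> R) :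
  measurable_fun setT f -> measurable_fun setT g -> measurable [set x | f x = g x].
Proof.
move=> mf mg; rewrite (_ : [set _ | _] = setT `&` (f \- g) @^-1` [set 0]).
  exact: measurable_funB.
by apply/seteqP; split=> x /=; [move=> ->; rewrite subrr|move=> [_ /eqP]; rewrite subr_eq0 => /eqP].
Qed.

Lemma measurable_upper_profile : measurable_fun setT (w : RL -> R).
Proof. exact: (measurable_upper_derivative (measurable_profile hcont)). Qed.

(** The slices of u are t |-> V(t^2 + |y|^2), so their derivative 2 t V'
    involves the same function V' on all lines and for all axes. *)
Lemma gradient_radial : {ae muS, forall x, forall i, G x ord0 i = 2 * x ord0 i * w (nsq x)}.
Proof.
have Hi i : {ae muS, forall x, G x ord0 i = 2 * x ord0 i * w (nsq x)}.
  have mG : measurable_fun setT (fun x => G x ord0 i).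
    by have [] := wG i; rewrite inE => /andP[/[!inE]].
  have mw : measurable_fun setT (fun x : 'rV[R]_n.+2 => w (nsq x)).
    have mq : measurable_fun setT (@nsq R n.+2 : _ -> RL) by exact: measurable_nsq.
    exact: (measurableT_comp measurable_upper_profile mq).
  have mA : measurable [set x | G x ord0 i = 2 * x ord0 i * w (nsq x)].
    apply: measurable_eq_set => //.
    by apply: measurable_funM => //; apply: measurable_funM => //; exact: measurable_coor.
  apply: (ae_slices i mA).2.
  have := slice_derivative i; move: (@ae_neq0 n).
  apply: (@filterS2 _ _ (ae_filter_ringOfSetsType mu)) => y y0.
  have : {ae lam, forall t : R, t != 0}.
    exists [set 0]; split; [exact: measurable_set1|exact: lebesgue_measure_set1|].
    by move=> t /= /negP; rewrite negbK => /eqP.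
  apply: (@filterS2 _ _ (ae_filter_ringOfSetsType lam)) => t t0 /(profile_derive y0 t0).
  move=> /upper_derivativeE; rewrite /= nsq_insert insert_id/= => ->.
  by rewrite mulrCA divff ?mulr1// mulf_eq0 negb_or t0 pnatr_eq0.
have : {ae muS, forall x, forall k : nat, if insub k is Some i then G x ord0 i = 2 * x ord0 i * w (nsq x) else True}.
  apply: ae_foralln => k; case: insubP => [i _ _|_]; [exact: Hi|exact: aeW].
apply: (@filterS _ _ (ae_filter_ringOfSetsType muS)) => x Hx i.
have := Hx i; by rewrite valK.
Qed.

End slices_of_radial.
End radial_profile.

(** * The weak equation against radial plateaus *)

Section radial_test.
Context {R : realType} {N : nat}.
Local Notation RN := 'rV[R]_N.

Lemma smooth_gen_nsq : smooth_gen (@nsq R N).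
Proof.
rewrite /nsq /dotp; elim: (index_enum _) => [|i s IH].
  by under eq_fun do rewrite big_nil; exact: smooth_gen_cst.
under eq_fun do rewrite big_cons; apply: smooth_genD => //.
by apply: smooth_genM; exact: smooth_gen_coord.
Qed.

Lemma partial_nsq i (x : RN) : partial i (@nsq R N) x = 2 * x ord0 i.
Proof.
rewrite /partial -[RHS]addr0; have d1 (j : 'I_N) : is_derive x (delta_mx ord0 i : RN)
    (fun x : RN => x ord0 j * x ord0 j) (if j == i then 2 * x ord0 i else 0).
  have h := is_derive_coord j x (delta_mx ord0 i : RN).
  apply: is_derive_eq (is_deriveM h h) _; rewrite /GRing.scale/= mxE eqxx/=.
  by case: eqVneq => [->|_]; rewrite ?mulr1 ?mulr0 ?addr0// mulr2n mulrDl mul1r.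
have := @is_derive_sum _ _ _ N (fun j (x : RN) => x ord0 j * x ord0 j) x (delta_mx ord0 i) _ d1.
rewrite -big_mkcond big_pred1_eq => -[_ <-]; rewrite addr0; congr ('D__ _ _).
by apply/funext => z; rewrite fct_sumE.
Qed.

Variables (k a b : R).
Hypotheses (k0 : 0 < k).
Local Notation eta := (plateau k a b).

Lemma radial_test_function : test_function (eta \o @nsq R N).
Proof.
apply: (@smooth_gen_test _ _ _ (b + 1)).
  by apply: smooth_gen_comp; [exact: plateau_smooth1|exact: smooth_gen_nsq].
move=> x /= /(plateau_support k0)/andP[_ xb] i.
have := le_lt_trans (nsq_coor x i) xb; rewrite -real_normK ?num_real// => h.
by have := normr_ge0 (x ord0 i); nra.
Qed.

Lemma grad_radial_test (x : RN) : grad (eta \o @nsq R N) x = (2 * eta^`()%classic (nsq x)) *: x.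
Proof.
apply/rowP => i; rewrite !mxE partial_comp; last 2 first.
- exact: plateau_smooth1.
- exact/smooth_gen_differentiable/smooth_gen_nsq.
by rewrite partial_nsq; ring.
Qed.

End radial_test.

Section power_bounds.
Context {R : realType}.

(** Some coordinate carries at least the mean of the squares. *)
Lemma powR_norm_coor N (p c : R) (x : 'rV[R]_N.+1) : 0 < p -> 0 <= c ->
  (c * Num.sqrt (nsq x)) `^ p <= N.+1%:R `^ p * \sum_i (c * `|x ord0 i|) `^ p.
Proof.
move=> p0 c0.
have [i hi] : exists i, nsq x <= N.+1%:R * x ord0 i ^+ 2.
  apply/existsP; apply: contraT => /existsPn h.
  have : \sum_(i < N.+1) N.+1%:R * x ord0 i ^+ 2 < \sum_(i < N.+1) nsq x.
    by apply: ltr_sum => [|i _]; [apply/hasP; exists ord0; rewrite ?mem_index_enum|rewrite ltNge h].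
  rewrite -mulr_sumr sumr_const card_ord -[nsq x *+ _]mulr_natl.
  have -> : \sum_i x ord0 i ^+ 2 = nsq x by apply: eq_bigr => j _; rewrite expr2.
  by rewrite ltxx.
have s0 (j : 'I_N.+1) : 0 <= (c * `|x ord0 j|) `^ p by exact: powR_ge0.
apply: (@le_trans _ _ ((N.+1%:R * (c * `|x ord0 i|)) `^ p)).
  apply: ge0_ler_powR; rewrite ?nnegrE ?mulr_ge0 ?sqrtr_ge0 ?(ltW p0)//.
  rewrite mulrCA ler_wpM2l// -[leRHS]ger0_norm ?mulr_ge0// -sqrtr_sqr.
  rewrite ler_sqrt ?sqr_ge0// exprMn real_normK ?num_real// (le_trans hi)// ler_wpM2r ?sqr_ge0//.
  by rewrite -natrX ler_nat expnS expn1 leq_pmulr.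
rewrite powRM ?mulr_ge0// ler_wpM2l ?powR_ge0//.
by rewrite (bigD1 i)//= lerDl sumr_ge0.
Qed.

Lemma powR_le_1D (p a z : R) : 0 <= a <= p -> 0 <= z -> z `^ a <= 1 + z `^ p.
Proof.
move=> /andP[a0 ap] z0; have [z1|z1] := leP z 1.
  apply: (@le_trans _ _ 1); last by rewrite lerDl powR_ge0.
  have := ge0_ler_powR a0 (_ : z \in Num.nneg) (_ : 1 \in Num.nneg) z1.
  by rewrite !nnegrE powR1; apply.
by apply: (@le_trans _ _ (z `^ p)); [apply: ler_powR => //; exact: ltW|rewrite lerDr].
Qed.

Lemma powR_norm_mul (p z : R) : 1 < p -> `|(`|z| `^ (p - 2) * z)| = `|z| `^ (p - 1).
Proof.
move=> p1; have [->|z0] := eqVneq z 0.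
  by rewrite mulr0 normr0 powR0// gt_eqF// subr_gt0.
rewrite normrM ger0_norm ?powR_ge0// -[X in _ * X]powRr1 ?normr_ge0//.
rewrite -powRD; last by rewrite normr_eq0 z0 implybT.
by congr (_ `^ _); lra.
Qed.

End power_bounds.

Section radial_weak_form.
Context {R : realType}.
Variables (n : nat) (u : 'rV[R]_n.+2 -> R) (G : 'rV[R]_n.+2 -> 'rV[R]_n.+2).
Variables (p m mu : R) (f : R -> R).
Hypotheses (hrad : radial u) (hcont : forall x, x != 0 -> {for x, continuous u}).
Hypotheses (p1 : 1 < p) (cf : continuous f).
Hypotheses (wG : weak_gradient p u G) (hsol : weak_solution p mu m f u).
Local Notation lam := (@lebesgue_measure R).
Local Notation RL := (measurableTypeR R).
Local Notation muS := (@lebesgueN R n.+2).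
Local Notation V := (profile u).
Local Notation w := (upper_derivative V).
Local Notation om := (radial_density n.+2).

Let p1' : 1 <= p := ltW p1.
Let uLp : u \in Lfun muS p%:E. Proof. by have [[[]]] := hsol. Qed.
Let ae_grad : {ae muS, forall x, forall i, G x ord0 i = 2 * x ord0 i * w (nsq x)} :=
  gradient_radial hrad hcont p1' uLp wG.

(** The radial derivative of u at radius sqrt s. *)
Definition slope (s : R) : R := 2 * Num.sqrt s * w s.

(** The coefficient of the derivative of eta in the weak form tested against
    eta(|x|^2). *)
Definition flux (s : R) : R := `|slope s| `^ (p - 2) * slope s * (2 * Num.sqrt s).

(** The zeroth-order terms of the equation, moved to one side. *)
Definition source (s : R) : R :=
  m * (`|V s| `^ (p - 2) * V s) - mu / Num.sqrt s `^ p * (`|V s| `^ (p - 2) * V s) - f (V s).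

Let mnsq : measurable_fun setT (@nsq R n.+2 : _ -> RL). Proof. exact: measurable_nsq. Qed.
Let mV : measurable_fun setT (V : RL -> R). Proof. exact: measurable_profile. Qed.
Let mw : measurable_fun setT (w : RL -> R). Proof. exact: measurable_upper_derivative. Qed.
Let msqrt : measurable_fun setT (@Num.sqrt R : RL -> R).
Proof. apply: continuous_measurable_fun; exact: sqrt_continuous. Qed.

Lemma measurable_slope : measurable_fun setT (slope : RL -> R).
Proof. by apply: measurable_funM => //; apply: measurable_funM. Qed.

Lemma measurable_powR_norm_mul d (T : measurableType d) (h : T -> R) :
  measurable_fun setT h -> measurable_fun setT (fun x => `|h x| `^ (p - 2) * h x).
Proof.
move=> mh; apply: measurable_funM => //.
apply: (measurableT_comp (measurable_powR (p - 2))); exact: measurableT_comp.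
Qed.

Lemma measurable_flux : measurable_fun setT (flux : RL -> R).
Proof.
apply: measurable_funM; last exact: measurable_funM.
by apply: measurable_powR_norm_mul; exact: measurable_slope.
Qed.

Lemma measurable_source : measurable_fun setT (source : RL -> R).
Proof.
apply: measurable_funB; last first.
  by apply: (measurableT_comp (continuous_measurable_fun cf)).
apply: measurable_funB.
  by apply: measurable_funM => //; exact: measurable_powR_norm_mul.
apply: measurable_funM; last exact: measurable_powR_norm_mul.
apply: measurable_funM => //.
under eq_fun do rewrite -powRN.
exact: (measurableT_comp (measurable_powR (- p))).
Qed.

(** |slope(|x|^2)| is the Euclidean norm of the weak gradient. *)
Lemma integrable_slope_nsq : muS.-integrable setT (EFin \o (fun x => `|slope (nsq x)| `^ p)).
Proof.
pose h (x : 'rV[R]_n.+2) := n.+2%:R `^ p * \sum_i (`|2 * x ord0 i * w (nsq x)|) `^ p.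
have mh : measurable_fun setT h.
  apply: measurable_funM => //; apply: measurable_sum => i.
  apply: (measurableT_comp (measurable_powR p)); apply: measurableT_comp => //.
  apply: measurable_funM; last exact: (measurableT_comp mw mnsq).
  by apply: measurable_funM => //; exact: measurable_coor.
pose hG (x : 'rV[R]_n.+2) := n.+2%:R `^ p * \sum_i (`|G x ord0 i|) `^ p.
have ihG : muS.-integrable setT (EFin \o hG).
  rewrite (_ : EFin \o hG = fun x => ((n.+2%:R `^ p)%:E * (\sum_i (`|G x ord0 i| `^ p)%:E))%E); last first.
    by apply/funext => x; rewrite /= EFinM -sumEFin.
  apply: integrableZl => //; apply: integrable_sum => // i _.
  exact: (Lfun_integrable p1' (wG i).1).
have ih : muS.-integrable setT (EFin \o h).
  have /integrableP[mhG hGoo] := ihG.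
  apply/integrableP; split; first exact/measurable_EFinP.
  suff E : (\int[muS]_x `|(EFin \o h) x| = \int[muS]_x `|(EFin \o hG) x|)%E by rewrite E.
  apply: ae_eq_integral => //.
  - by apply: measurableT_comp => //; exact/measurable_EFinP.
  - exact: measurableT_comp.
  - apply: (@filterS _ _ (ae_filter_ringOfSetsType muS) _ _ _ ae_grad) => x Gx _.
    by rewrite /= /h /hG; under [in RHS]eq_bigr do rewrite Gx.
apply: le_integrable ih => //.
  apply/measurable_EFinP; apply: (measurableT_comp (measurable_powR p)).
  by apply: measurableT_comp => //; exact: (measurableT_comp measurable_slope mnsq).
move=> x _ /=; rewrite lee_fin [leLHS]ger0_norm ?powR_ge0// [leRHS]ger0_norm; last first.
  by rewrite mulr_ge0 ?powR_ge0// sumr_ge0// => i _; exact: powR_ge0.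
have -> : `|slope (nsq x)| = (2 * `|w (nsq x)|) * Num.sqrt (nsq x).
  by rewrite !normrM ger0_norm// ger0_norm ?sqrtr_ge0// mulrAC.
apply: le_trans (powR_norm_coor _ (lt_trans ltr01 p1) _) _; first by rewrite mulr_ge0.
rewrite ler_wpM2l ?powR_ge0//; apply: ler_sum => i _.
by rewrite !normrM [`|2|]ger0_norm// mulrAC.
Qed.

(** |flux| is at most 2 sqrt s (1 + |slope|^p). *)
Lemma integrable_flux_mul (h : RL -> R) (M B : R) : measurable_fun setT h ->
  (forall s, `|h s| <= B) -> (forall s, M < s -> h s = 0) ->
  muS.-integrable setT (EFin \o (fun x => flux (nsq x) * h (nsq x))).
Proof.
move=> mh hB hM.
have B0 : 0 <= B by apply: le_trans (hB 0).
pose A := [set x : 'rV[R]_n.+2 | nsq x <= `|M| + 1].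
have mA : measurable A by exact: measurable_nsq_le.
have Aoo : (muS A < +oo)%E by rewrite lebesgueN_ball ?ltry// ltr_wpDl.
have iA : muS.-integrable A (EFin \o (fun x => 1 + `|slope (nsq x)| `^ p)).
  have i1 : muS.-integrable A (cst 1%E).
    apply/integrableP; split => //.
    by under eq_integral do rewrite gee0_abs//; rewrite integral_cst// mul1e.
  exact: (integrableD mA i1 (integrableS measurableT mA (@subsetT _ A) integrable_slope_nsq)).
have iA' : muS.-integrable A (EFin \o (fun x => (1 + `|slope (nsq x)| `^ p) * (2 * Num.sqrt (`|M| + 1) * B))).
  exact: (integrable_mul_bounded (M := `|2 * Num.sqrt (`|M| + 1) * B|) mA iA (measurable_cst _)).
have : muS.-integrable A (EFin \o (fun x => flux (nsq x) * h (nsq x))).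
  apply: le_integrable iA' => //.
    apply/measurable_EFinP; apply: measurable_funTS; apply: measurable_funM.
      exact: (measurableT_comp measurable_flux mnsq).
    exact: (measurableT_comp mh mnsq).
  move=> x Ax /=; rewrite lee_fin normrM.
  rewrite [leRHS]ger0_norm; last by rewrite !mulr_ge0 ?sqrtr_ge0// addr_ge0// powR_ge0.
  rewrite mulrA; apply: ler_pM => //.
  rewrite /flux normrM powR_norm_mul//; apply: ler_pM => //.
    by apply: powR_le_1D => //; rewrite subr_ge0 p1' lerBlDr lerDl ler01.
  rewrite ger0_norm ?mulr_ge0 ?sqrtr_ge0// ler_wpM2l//.
  by rewrite ler_sqrt// ltr_wpDl.
rewrite integrable_mkcond//; apply: eq_integrable => // x _.
rewrite patchE; case: ifPn => //; rewrite notin_setE /A/= => /negP; rewrite -ltNge => xM.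
rewrite hM ?mulr0//; apply: le_lt_trans xM.
by rewrite (le_trans (ler_norm M))// lerDl.
Qed.

Hypothesis hpos : forall x, x != 0 -> 0 < u x.

Lemma profile_gt0 s : 0 < s -> 0 < V s.
Proof.
move=> s0; apply: hpos; rewrite scaler_eq0 negb_or sqrtr_eq0 -ltNge s0/=.
by apply/eqP => /rowP/(_ ord0); rewrite !mxE !eqxx => /eqP; rewrite oner_eq0.
Qed.

Lemma source_continuous s : 0 < s -> {for s, continuous source}.
Proof.
move=> s0; have cV := profile_continuous hcont s0.
have cVp : {for s, continuous (fun s => `|V s| `^ (p - 2) * V s)}.
  apply: cvgM; last exact: cV.
  apply: (@continuous_comp _ _ _ (fun s => `|V s|) (fun x => x `^ (p - 2))).
    by apply: (@continuous_comp _ _ _ V Num.norm) => //; exact: norm_continuous.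
  by apply: continuous_powR; rewrite normr_gt0 gt_eqF// profile_gt0.
apply: cvgB; last by apply: (@continuous_comp _ _ _ V f) => //; exact: cf.
apply: cvgB; first exact: cvgMr.
apply: cvgM => //; apply: cvgMr; apply: cvgV.
  by rewrite gt_eqF// powR_gt0// sqrtr_gt0.
apply: (@continuous_comp _ _ _ Num.sqrt (fun x => x `^ p)).
  exact: sqrt_continuous.
by apply: continuous_powR; rewrite sqrtr_gt0.
Qed.

Lemma density_continuous (s : R) : 0 < s -> {for s, continuous (om : R -> R)}.
Proof.
move=> s0; have : (fun t => ball_vol n.+2 * (n.+2%:R / 2) * t `^ (n.+2%:R / 2 - 1)) t @[t --> s] --> om s.
  by rewrite /radial_density s0; apply: cvgMr; exact: continuous_powR.
apply: cvg_trans; apply: near_eq_cvg; near=> t; rewrite /radial_density ifT//.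
by near: t; exact: lt_nbhsr.
Unshelve. all: by end_near. Qed.

Section fixed_plateau.
Variables (k a b : R).
Hypotheses (k0 : 0 < k) (a0 : 0 < a) (ab : a < b).
Local Notation eta := (plateau k a b).
Local Notation deta := ((plateau k a b)^`()%classic).

Let meta : measurable_fun setT (eta : RL -> R).
Proof. by apply: continuous_measurable_fun; apply: smooth1_continuous; exact: plateau_smooth1. Qed.

Let mdeta : measurable_fun setT (deta : RL -> R).
Proof. by apply: continuous_measurable_fun; exact: continuous_dplateau. Qed.

Lemma integrable_mul_plateau (c : RL -> R) : measurable_fun setT c ->
  (forall s : R, 0 < s -> {for s, continuous (c : R -> R)}) ->
  muS.-integrable setT (EFin \o (fun x => c (nsq x) * eta (nsq x))).
Proof.
move=> mc cc; have [B hB] : exists B : R, forall s, `|c s * eta s| <= B.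
  have [|s0 _ hs] := @EVT_max R (fun t => `|c t|) a b (ltW ab).
    apply: continuous_in_subspaceT => x; rewrite inE/= in_itv/= => /andP[ax _].
    apply: (@continuous_comp _ _ _ (c : R -> R) Num.norm); last exact: norm_continuous.
    by apply: cc; exact: lt_le_trans ax.
  exists `|c s0| => s; have [->|/(plateau_support k0)/andP[h1 h2]] := eqVneq (eta s) 0.
    by rewrite mulr0 normr0.
  rewrite normrM -[leRHS]mulr1; apply: ler_pM => //; last exact: plateau_le1.
  by apply: hs; rewrite in_itv/= !ltW.
pose A := [set x : 'rV[R]_n.+2 | nsq x <= b].
have mA : measurable A by exact: measurable_nsq_le.
have Aoo : (muS A < +oo)%E by rewrite lebesgueN_ball ?ltry// (lt_trans a0).
have i1 : muS.-integrable A (EFin \o (fun=> 1)).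
  apply/integrableP; split; first exact: measurable_cst.
  by under eq_integral do rewrite gee0_abs//; rewrite integral_cst// mul1e.
have mce : measurable_fun setT (fun x : 'rV[R]_n.+2 => c (nsq x) * eta (nsq x)).
  by apply: measurable_funM; [exact: (measurableT_comp mc mnsq)|exact: (measurableT_comp meta mnsq)].
have := integrable_mul_support mA i1 mce (fun x => hB (nsq x)).
under eq_fun do rewrite mul1r; apply => x; rewrite /A/= => /negP; rewrite -ltNge => xb.
have [->|/(plateau_support k0)/andP[h1 h2]] := eqVneq (eta (nsq x)) 0; first by rewrite mulr0.
by move: h2; rewrite ltNge ltW.
Qed.

Let phi := eta \o @nsq R n.+2.

(** Radial gradients are parallel to x, so the scalar product in the weak form
    reduces to a function of |x|^2. *)
Lemma weak_form_radial : muS.-integrable setT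
    (EFin \o (fun x => flux (nsq x) * deta (nsq x) + (source (nsq x) + f (V (nsq x))) * eta (nsq x))) /\
  weak_form p mu m u G phi = \int[muS]_x
    (flux (nsq x) * deta (nsq x) + (source (nsq x) + f (V (nsq x))) * eta (nsq x)).
Proof.
have [D dD] := dplateau_bounded k0 ab.
have iflux : muS.-integrable setT (EFin \o (fun x => flux (nsq x) * deta (nsq x))).
  apply: (integrable_flux_mul mdeta dD (M := b)) => s bs.
  by apply/eqP; apply: contraLR bs => /(dplateau_support k0)/andP[_]; rewrite leNgt.
have mfV : measurable_fun setT ((f \o V) : RL -> R).
  exact: (measurableT_comp (continuous_measurable_fun cf) mV).
have isrc : muS.-integrable setT (EFin \o (fun x => (source (nsq x) + f (V (nsq x))) * eta (nsq x))).
  apply: (@integrable_mul_plateau (fun s => source s + f (V s))).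
    by apply: measurable_funD; [exact: measurable_source|exact: mfV].
  move=> s s0; apply: cvgD; first exact: source_continuous.
  apply: (@continuous_comp _ _ _ V f); [exact: profile_continuous|exact: cf].
have iJ := integrableD measurableT iflux isrc.
have mG i : measurable_fun setT (fun x => G x ord0 i).
  by have [] := wG i; rewrite inE => /andP[/[!inE]].
have mu_ : measurable_fun setT u by move: uLp; rewrite inE => /andP[/[!inE]].
have mdot (x y : 'rV[R]_n.+2 -> 'rV[R]_n.+2) : (forall i, measurable_fun setT (fun z => x z ord0 i)) ->
    (forall i, measurable_fun setT (fun z => y z ord0 i)) -> measurable_fun setT (fun z => dotp (x z) (y z)).
  by move=> mx my; apply: measurable_sum => i; exact: measurable_funM.
split; first by apply: eq_integrable iJ => // x _.
rewrite /weak_form /Rintegral; congr fine; apply: ae_eq_integral => //.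
- apply/measurable_EFinP.
  have mphi : measurable_fun setT phi by exact: (measurableT_comp meta mnsq).
  apply: measurable_funD; last first.
    by apply: measurable_funM => //; apply: measurable_funM => //; exact: measurable_powR_norm_mul.
  apply: measurable_funB.
    apply: measurable_funM.
      apply: (measurableT_comp (measurable_powR (p - 2))).
      by apply: (measurableT_comp msqrt); exact: mdot.
    apply: mdot => // i; under eq_fun do rewrite grad_radial_test mxE.
    apply: measurable_funM; last exact: measurable_coor.
    by apply: measurable_funM => //; exact: (measurableT_comp mdeta mnsq).
  apply: measurable_funM => //; apply: measurable_funM; last exact: measurable_powR_norm_mul.
  apply: measurable_funM => //; under eq_fun do rewrite -powRN.
  by apply: (measurableT_comp (measurable_powR (- p))); exact: (measurableT_comp msqrt mnsq).
- by apply: measurable_int; exact: iJ.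
- apply: (@filterS _ _ (ae_filter_ringOfSetsType muS) _ _ _ ae_grad) => x Gx _ /=; congr EFin.
  have GE : G x = (2 * w (nsq x)) *: x by apply/rowP => i; rewrite mxE Gx; ring.
  have sq : Num.sqrt (nsq x) * Num.sqrt (nsq x) = nsq x by rewrite -expr2 sqr_sqrtr// nsq_ge0.
  have -> : enorm (G x) = `|slope (nsq x)|.
    rewrite /enorm -/(nsq (G x)) GE nsqZ sqrtrM ?sqr_ge0// sqrtr_sqr /slope !normrM.
    by rewrite [`|Num.sqrt _|]ger0_norm ?sqrtr_ge0// mulrAC.
  have -> : dotp (G x) (grad phi x) = slope (nsq x) * (2 * Num.sqrt (nsq x)) * deta (nsq x).
    rewrite GE grad_radial_test /dotp.
    under eq_bigr do rewrite !mxE.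
    rewrite (eq_bigr (fun i => (2 * w (nsq x) * (2 * deta (nsq x))) * (x ord0 i * x ord0 i))); last first.
      by move=> i _; ring.
    rewrite -mulr_sumr -/(dotp x x) -/(nsq x) -[X in _ * X = _]sq /slope; ring.
  by rewrite /flux /source (profileE hrad) /phi/= /enorm -/(nsq x); ring.
Qed.

(** Plateaus are nonnegative, so being a sub- and a supersolution gives an
    equality; polar coordinates turn it into one on the half-line. *)
Lemma profile_tested : \int[lam]_(t in `[a, b])
  (flux t * om t * deta t + source t * om t * eta t) = 0.
Proof.
have [iW WE] := weak_form_radial.
have tphi := radial_test_function a b k0 : test_function phi.
have phi0 x : 0 <= phi x by exact: plateau_ge0.
have [[_ /(_ G wG phi tphi phi0) sub] [_ /(_ G wG phi tphi phi0) sup]] := hsol.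
have eqW : weak_form p mu m u G phi = \int[muS]_x (f (V (nsq x)) * eta (nsq x)).
  transitivity (\int[muS]_x (f (u x) * phi x)); first by apply/eqP; rewrite eq_le sub.
  by apply: eq_Rintegral => x _; rewrite (profileE hrad).
have mfV : measurable_fun setT ((f \o V) : RL -> R).
  exact: (measurableT_comp (continuous_measurable_fun cf) mV).
have ifV : muS.-integrable setT (EFin \o (fun x => f (V (nsq x)) * eta (nsq x))).
  apply: (@integrable_mul_plateau (f \o V) mfV) => s s0.
  apply: (@continuous_comp _ _ _ V f); [exact: profile_continuous|exact: cf].
pose J s := flux s * deta s + source s * eta s.
have iJ : muS.-integrable setT (EFin \o (fun x => J (nsq x))).
  have := integrableB measurableT iW ifV; apply: eq_integrable => // x _.
  by rewrite /= -EFinB /J; congr EFin; ring.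
have J0 : \int[muS]_x J (nsq x) = 0.
  transitivity (\int[muS]_x ((flux (nsq x) * deta (nsq x) + (source (nsq x) + f (V (nsq x))) * eta (nsq x))
    - f (V (nsq x)) * eta (nsq x))).
    by apply: eq_Rintegral => x _; rewrite /J; ring.
  by rewrite RintegralB// -WE eqW subrr.
have mJ : measurable_fun setT ((EFin \o J) : RL -> \bar R).
  apply/measurable_EFinP; apply: measurable_funD; apply: measurable_funM => //.
    exact: measurable_flux.
  exact: measurable_source.
rewrite -J0 /Rintegral.
have := integral_radial (isT : (1 < n.+2)%N) mJ iJ => /= ->.
congr fine; rewrite integral_mkcond; apply: eq_integral => t _.
rewrite patchE; case: ifPn => [_|]; first by rewrite -EFinM /J; congr EFin; ring.
rewrite notin_setE/= in_itv/= => /negP tab.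
have dt0 : deta t = 0 by apply/eqP; apply: contraNT tab => /(dplateau_support k0).
have et0 : eta t = 0.
  by apply/eqP; apply: contraNT tab => /(plateau_support k0)/andP[/ltW -> /ltW ->].
by rewrite /J dt0 et0 !mulr0 addr0 mul0e.
Qed.

End fixed_plateau.

End radial_weak_form.

(** * Regularity of the profile *)

Section signed_power.
Context {R : realType}.
Implicit Types r x y : R.

(** Signed powers, for which spow (p - 1) is the nonlinearity of the p-Laplacian
    in one dimension and spow (1 / (p - 1)) its inverse. *)
Definition spow r x : R := `|x| `^ (r - 1) * x.

Lemma spow0 r : spow r 0 = 0. Proof. by rewrite /spow mulr0. Qed.

Lemma powRB1_mul r x : 0 < x -> x `^ (r - 1) * x = x `^ r.
Proof.
move=> x0; rewrite -[X in _ * X]powRr1 ?(ltW x0)// -powRD; last by rewrite (gt_eqF x0) implybT.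
by congr (_ `^ _); lra.
Qed.

Lemma spow_gt0 r x : 0 < x -> spow r x = x `^ r.
Proof. by move=> x0; rewrite /spow gtr0_norm// powRB1_mul. Qed.

Lemma spowN r x : spow r (- x) = - spow r x.
Proof. by rewrite /spow normrN mulrN. Qed.

Lemma normr_spow r x : r != 0 -> `|spow r x| = `|x| `^ r.
Proof.
move=> r0; have [->|x0] := eqVneq x 0; first by rewrite spow0 normr0 powR0.
by rewrite /spow normrM ger0_norm ?powR_ge0// powRB1_mul// normr_gt0.
Qed.

Lemma spowK r r' x : r != 0 -> r * r' = 1 -> spow r' (spow r x) = x.
Proof.
move=> r0 rr; have [->|x0] := eqVneq x 0; first by rewrite !spow0.
wlog: x x0 / 0 < x => [hw|x0'].
  have [x1|] := leP x 0; last exact: hw.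
  apply: oppr_inj; rewrite -!spowN hw ?oppr_eq0//.
  by rewrite oppr_gt0 lt_neqAle x0.
by rewrite !spow_gt0 ?powR_gt0// -powRrM rr powRr1// ltW.
Qed.

Lemma continuous_spow r : 0 < r -> continuous (spow r).
Proof.
move=> r0 x; have [->|x0] := eqVneq x 0; last first.
  have cn : {for x, continuous (fun y : R => `|y| `^ (r - 1))}.
    apply: (@continuous_comp _ _ _ (fun y : R => `|y|) (fun y : R => y `^ (r - 1))).
      exact: norm_continuous.
    by apply: continuous_powR; rewrite normr_gt0.
  by apply: cvgM; [exact: cn|exact: cvg_id].
apply/cvgrPdist_lt => e e0; rewrite spow0; near=> y.
rewrite sub0r normrN normr_spow ?gt_eqF//.
have er0 : 0 < e `^ r^-1 by rewrite powR_gt0.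
have -> : e = (e `^ r^-1) `^ r by rewrite -powRrM mulVf ?powRr1 ?gt_eqF// ltW.
apply: gt0_ltr_powR; rewrite ?nnegrE ?(ltW er0)//.
near: y; exists (e `^ r^-1) => /= [|y]; first exact: powR_gt0.
by rewrite /ball_/= sub0r normrN.
Unshelve. all: by end_near. Qed.

End signed_power.

Section ae_witness.
Context {R : realType}.
Local Notation lam := (@lebesgue_measure R).

Lemma ae_itv_exists (P : R -> Prop) (a b : R) : {ae lam, forall t, P t} -> a < b ->
  exists t : R, a < t < b /\ P t.
Proof.
move=> [N [mN N0 sN]] ab; apply: contrapT => /forallNP h.
have : (lam `]a, b[%classic <= lam N)%E.
  apply: le_measure; rewrite ?inE; [exact: measurable_itv|exact: mN|].
  move=> t; rewrite /= in_itv/= => tab; apply: sN => /= Pt; apply: (h t); split => //.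
rewrite N0 lebesgue_measure_itv/= lte_fin ab -EFinD lee_fin.
by apply/negP; rewrite -ltNge subr_gt0.
Qed.

Lemma ae_ball_exists n (P : 'rV[R]_n -> Prop) (s : R) : {ae @lebesgueN R n, forall y, P y} -> 0 < s ->
  exists y, nsq y <= s /\ P y.
Proof.
move=> [N [mN N0 sN]] s0; apply: contrapT => /forallNP h.
have : (lebesgueN [set x : 'rV[R]_n | (nsq x <= s)%R] <= lebesgueN N)%E.
  apply: le_measure; rewrite ?inE//; first exact: measurable_nsq_le.
  by move=> y /= ys; apply: sN => /= Py; apply: (h y).
rewrite N0 lebesgueN_ball// lee_fin; apply/negP; rewrite -ltNge mulr_gt0 ?powR_gt0//.
exact: ball_vol_gt0.
Qed.

Lemma ae_slices_imp n (i : 'I_n.+1) (P : 'rV[R]_n.+1 -> Prop) :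
  {ae @lebesgueN R n.+1, forall x, P x} ->
  {ae @lebesgueN R n, forall y, {ae lam, forall t, P (insert i (t, y))}}.
Proof.
move=> [N [mN N0 sN]].
have aeN : {ae @lebesgueN R n.+1, forall x, (~` N) x} by exists N; split => // x /= /contrapT.
have := (ae_slices i (measurableC mN)).1 aeN.
apply: (@filterS _ _ (ae_filter_ringOfSetsType _)) => y.
apply: (@filterS _ _ (ae_filter_ringOfSetsType lam)) => t /= Nt.
by apply: contrapT => /sN.
Qed.

End ae_witness.

Section continuous_flux.
Context {R : realType}.
Variables (n : nat) (u : 'rV[R]_n.+2 -> R) (G : 'rV[R]_n.+2 -> 'rV[R]_n.+2).
Variables (p m mu : R) (f : R -> R).
Hypotheses (hrad : radial u) (hcont : forall x, x != 0 -> {for x, continuous u}).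
Hypotheses (p1 : 1 < p) (cf : continuous f).
Hypotheses (wG : weak_gradient p u G) (hsol : weak_solution p mu m f u).
Hypothesis hpos : forall x, x != 0 -> 0 < u x.
Local Notation lam := (@lebesgue_measure R).
Local Notation RL := (measurableTypeR R).
Local Notation muS := (@lebesgueN R n.+2).
Local Notation V := (profile u).
Local Notation w := (upper_derivative V).
Local Notation om := (@radial_density R n.+2).
Local Notation slope := (slope u).
Local Notation flux := (flux u p).
Local Notation source := (source u p m mu f).

Let p1' : 1 <= p := ltW p1.
Let uLp : u \in Lfun muS p%:E. Proof. by have [[[]]] := hsol. Qed.
Let F (s : R) : R := flux s * om s.
Let g (s : R) : R := source s * om s.

Let mF : measurable_fun setT (F : RL -> R).
Proof.
apply: measurable_funM; first exact: (measurable_flux p hcont).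
exact: measurable_radial_density.
Qed.

Let iF (M : nat) : lam.-integrable `[- M%:R, M%:R] (EFin \o (F : RL -> R)).
Proof.
pose h : RL -> R := \1_(`]-oo, M%:R]%classic).
have mh : measurable_fun setT h by apply: measurable_indic; exact: measurable_itv.
have h1 s : `|h s| <= 1 by rewrite /h indicE; case: (_ \in _); rewrite ?normr1 ?normr0.
have h0 (s : R) : M%:R < s -> h s = 0.
  by move=> Ms; rewrite /h indicE memNset//= in_itv/= leNgt Ms.
have mfh : measurable_fun setT ((EFin \o (fun s => flux s * h s)) : RL -> \bar R).
  by apply/measurable_EFinP; apply: measurable_funM => //; exact: (measurable_flux p hcont).
have := integrable_flux_mul hrad hcont p1 wG hsol mh h1 h0.
move=> /(integrable_radialP (isT : (1 < n.+2)%N) mfh) H.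
have mM : measurable (`[- M%:R, M%:R]%classic : set RL) by exact: measurable_itv.
have := integrableS measurableT mM (@subsetT _ _) H.
apply: eq_integrable => // s; rewrite inE/= in_itv/= => /andP[_ sM].
by rewrite /h indicE mem_set/= ?mulr1 ?in_itv//= -EFinM.
Qed.

Let cg (s : R) : 0 < s -> {for s, continuous g}.
Proof.
move=> s0; apply: cvgM; first exact: (source_continuous hcont cf hpos s0).
exact: density_continuous.
Qed.

Let ig (a b : R) : 0 < a -> lam.-integrable `[a, b] (EFin \o (g : RL -> R)).
Proof.
move=> a0; apply: continuous_compact_integrable; first exact: segment_compact.
apply: continuous_in_subspaceT => x; rewrite inE/= in_itv/= => /andP[ax _].
by apply: cg; exact: lt_le_trans ax.
Qed.

(** The flux is integrable near 0, so a base point a0 can be any Lebesgue point;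
    beyond it the source is continuous and its primitive is classical. *)
Lemma flux_continuous_version : exists (a0 : R) (Gam : R -> R), [/\ 0 < a0 < 1,
  {ae lam, forall s : R, a0 < s -> flux s * om s = Gam s} &
  forall s : R, a0 < s -> is_derive s 1 Gam (source s * om s)].
Proof.
have lF := lebesgue_differentiation (locally_integrable_itv mF iF).
have [a0 [a01 Fa0]] := ae_itv_exists lF (@ltr01 R).
have /andP[a00 a01'] := a01.
pose Gam (s : R) := \int[lam]_(t in `[a0, s]) g t + F a0.
exists a0, Gam; split => //.
  apply: (@filterS _ _ (ae_filter_ringOfSetsType lam) _ _ _ lF) => s Fs a0s.
  have tested (k : nat) : \int[lam]_(t in `[a0, s])
      (F t * (plateau k.+1%:R a0 s)^`()%classic t + g t * plateau k.+1%:R a0 s t) = 0.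
    by apply: (profile_tested hrad hcont p1 cf wG hsol hpos) => //.
  have := du_bois_reymond a0s mF (integrable_itvT iF _ _) (ig _ a00) Fa0 Fs tested.
  by rewrite /Gam => <-; rewrite subrK.
move=> s a0s; have s0 : 0 < s by exact: lt_trans a0s.
have ss1 : s < s + 1 by rewrite ltrDl.
have [d e] := @continuous_FTC1_closed _ g a0 s (s + 1) ss1 (ig _ a00) a0s (cg s0).
have dI : is_derive s 1 (fun x => \int[lam]_(t in `[a0, x]) g t) (g s).
  by apply: DeriveDef; [exact: d|rewrite -derive1E; exact: e].
rewrite -[_ * _]addr0; exact: is_deriveD.
Qed.

Lemma spow_pred (x : R) : `|x| `^ (p - 2) * x = spow (p - 1) x.
Proof. by rewrite /spow; congr (_ `^ _ * _); lra. Qed.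

Let om_gt0 (s : R) : 0 < s -> 0 < om s.
Proof.
move=> s0; rewrite /radial_density s0 mulr_gt0 ?powR_gt0// mulr_gt0//.
exact: ball_vol_gt0.
Qed.

(** Inverting the flux gives a continuous version Wc of the derivative of V.
    On one line at distance less than 1 from the origin, V is then a primitive of
    a continuous function, which covers all large s. *)
Lemma profile_C1 : exists Wc Gam : R -> R, {ae lam, forall s : R, 2 < s -> w s = Wc s} /\
  forall s : R, 2 < s -> [/\ is_derive s 1 V (Wc s), {for s, continuous Wc},
    Gam s = spow (p - 1) (2 * Num.sqrt s * Wc s) * (2 * Num.sqrt s) * om s &
    is_derive s 1 Gam (source s * om s)].
Proof.
have [a0 [Gam [/andP[a00 a01] aeG dG]]] := flux_continuous_version.
have p10 : 0 < p - 1 by rewrite subr_gt0.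
have pN0 : p - 1 != 0 by rewrite gt_eqF.
have pV0 : 0 < (p - 1)^-1 by rewrite invr_gt0.
have sq2 (s : R) : 0 < s -> 0 < 2 * Num.sqrt s by move=> s0; rewrite mulr_gt0// sqrtr_gt0.
pose Z (s : R) := Gam s / (om s * (2 * Num.sqrt s)).
pose Wc (s : R) := spow (p - 1)^-1 (Z s) / (2 * Num.sqrt s).
have GW (s : R) : 0 < s -> Gam s = spow (p - 1) (2 * Num.sqrt s * Wc s) * (2 * Num.sqrt s) * om s.
  move=> s0; have h1 := sq2 _ s0; have h2 := om_gt0 s0.
  have -> : 2 * Num.sqrt s * Wc s = spow (p - 1)^-1 (Z s).
    by rewrite /Wc mulrCA divff ?mulr1// gt_eqF.
  rewrite spowK ?gt_eqF ?mulVf//.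
  by rewrite /Z; field; rewrite !gt_eqF// sqrtr_gt0.
have wW (s : R) : 0 < s -> flux s * om s = Gam s -> w s = Wc s.
  move=> s0 fs; have h1 := sq2 _ s0; have h2 := om_gt0 s0.
  have : spow (p - 1) (slope s) = Z s.
    rewrite /Z -fs /flux spow_pred; by field; rewrite !gt_eqF// sqrtr_gt0.
  move=> hZ; rewrite /Wc -hZ spowK ?divff// /slope.
  by rewrite mulrAC divff ?mul1r// gt_eqF.
have csq (s : R) : {for s, continuous (fun s : R => 2 * Num.sqrt s)}.
  by apply: cvgMr; exact: sqrt_continuous.
have cW (s : R) : a0 < s -> {for s, continuous Wc}.
  move=> a0s; have s0 := lt_trans a00 a0s; have h1 := sq2 _ s0; have h2 := om_gt0 s0.
  have cZ : {for s, continuous Z}.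
    apply: cvgM; first exact: (is_derive_continuous (dG s a0s)).
    apply: cvgV; first by rewrite gt_eqF// mulr_gt0.
    by apply: cvgM; [exact: density_continuous|exact: csq].
  apply: cvgM; last by apply: cvgV; [rewrite gt_eqF|exact: csq].
  apply: (@continuous_comp _ _ _ Z (spow (p - 1)^-1)); first exact: cZ.
  exact: continuous_spow.
have aew : {ae lam, forall s : R, a0 < s -> w s = Wc s}.
  apply: (@filterS _ _ (ae_filter_ringOfSetsType lam) _ _ _ aeG) => s h a0s.
  by apply: wW; [exact: lt_trans a0s|exact: h].
exists Wc, Gam; split.
  apply: (@filterS _ _ (ae_filter_ringOfSetsType lam) _ _ _ aew) => s h s2.
  by apply: h; lra.
have aeGrad : {ae muS, forall x, a0 < nsq x -> G x ord0 ord0 = 2 * x ord0 ord0 * Wc (nsq x)}.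
  have h1 := ae_radial (isT : (1 < n.+2)%N) aew.
  have h2 := gradient_radial hrad hcont p1' uLp wG.
  move: h1 h2; apply: (@filterS2 _ _ (ae_filter_ringOfSetsType muS)) => x h1 h2 a0x.
  by rewrite h2 h1.
have aeSl := ae_slices_imp ord0 aeGrad.
have aeT := weak_tested_slice p1' uLp wG ord0.
have aeI := integrable_slice_itv p1' ord0 (wG ord0).1.
have ae0 := @ae_neq0 R n.
(* A line close to the origin on which all the almost everywhere statements hold. *)
have [y [yle [[y0 Sl] [T I]]]] : exists y : 'rV[R]_n.+1, nsq y <= 1 /\ ((0 < nsq y /\
   {ae lam, forall t, a0 < nsq (insert ord0 (t, y)) ->
     G (insert ord0 (t, y)) ord0 ord0 = 2 * insert ord0 (t, y) ord0 ord0 * Wc (nsq (insert ord0 (t, y)))}) /\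
   ((forall r s : rat, r < s ->
     weak_tested (fun t => u (insert ord0 (t, y))) (fun t => G (insert ord0 (t, y)) ord0 ord0)
    (ratr r) (ratr s)) /\ (forall M : nat,
    lam.-integrable `[- M%:R, M%:R] (fun t : RL => (G (insert ord0 (t, y)) ord0 ord0)%:E)))).
  apply: ae_ball_exists => //.
  have A1 := @filterS2 _ _ (ae_filter_ringOfSetsType (@lebesgueN R n.+1)) _ _ _ (fun y a b => conj a b) ae0 aeSl.
  have A2 := @filterS2 _ _ (ae_filter_ringOfSetsType (@lebesgueN R n.+1)) _ _ _ (fun y a b => conj a b) aeT aeI.
  exact: (@filterS2 _ _ (ae_filter_ringOfSetsType (@lebesgueN R n.+1)) _ _ _ (fun y a b => conj a b) A1 A2).
pose c := nsq y; pose H (t : R) := u (insert ord0 (t, y)).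
have HE (t : R) : H t = V (t ^+ 2 + c) by rewrite /H (profileE hrad) nsq_insert.
pose h (t : R) := 2 * t * Wc (t ^+ 2 + c).
have cH : continuous H.
  rewrite (_ : H = fun t : R => V (t ^+ 2 + c)); last exact/funext.
  move=> t; apply: (@continuous_comp _ _ _ (fun t : R => t ^+ 2 + c) V).
    by apply: cvgD; [exact: exprn_continuous|exact: cvg_cst].
  by apply: profile_continuous => //; rewrite ltr_wpDl// sqr_ge0.
have t1 (t : R) : 1 <= t -> a0 < t ^+ 2 + c.
  move=> t1; have : 1 <= t ^+ 2 by rewrite exprn_ege1.
  by rewrite /c; lra.
have ch (t : R) : 1 <= t -> {for t, continuous h}.
  move=> /t1 tc; apply: cvgM; first by apply: cvgMr; exact: cvg_id.
  apply: (@continuous_comp _ _ _ (fun t : R => t ^+ 2 + c) Wc).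
    by apply: cvgD; [exact: exprn_continuous|exact: cvg_cst].
  exact: cW.
have ih (b : R) : lam.-integrable `[1, b] (EFin \o (h : RL -> R)).
  apply: continuous_compact_integrable; first exact: segment_compact.
  by apply: continuous_in_subspaceT => x; rewrite inE/= in_itv/= => /andP[/ch].
have Hrat (r : rat) : 1 < ratr r :> R -> H (ratr r) = H 1 + \int[lam]_(t in `[1, ratr r]) h t.
  move=> r1; have r1' : 1 < r by rewrite -(ltr_rat R) rmorph1.
  have := weak_ftc cH I r1' (T _ _ r1'); rewrite rmorph1 => e.
  have -> : \int[lam]_(t in `[1, ratr r]) h t = H (ratr r) - H 1; last by rewrite addrC subrK.
  rewrite e /Rintegral; congr fine; apply: ae_eq_integral => //.
  - exact: (measurable_int _ (ih _)).
  - exact: (measurable_int _ (integrable_itvT I _ _)).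
  - apply: (@filterS _ _ (ae_filter_ringOfSetsType lam) _ _ _ Sl) => t + /=.
    rewrite nsq_insert insert_id/= in_itv/= => Ht /andP[/t1 tc _].
    by rewrite Ht.
have dH (t : R) : 1 < t -> is_derive t 1 H (h t).
  move=> tgt1.
  pose Phi (x : R) := \int[lam]_(t in `[1, x]) h t.
  have dPhi (x : R) : 1 < x -> is_derive x 1 Phi (h x).
    move=> x1; have xx1 : x < x + 1 by rewrite ltrDl.
    have [d e] := @continuous_FTC1_closed _ h 1 x (x + 1) xx1 (ih _) x1 (ch _ (ltW x1)).
    by apply: DeriveDef; [exact: d|rewrite -derive1E; exact: e].
  have HP (x : R) : 1 < x < t + 1 -> (H \- Phi) x = H 1.
    apply: eq_on_rat_itv => [z /andP[z1 _]|r /andP[r1 _]].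
      by apply: cvgB; [exact: cH|exact: (is_derive_continuous (dPhi z z1))].
    by rewrite /= Hrat// addrK.
  have dP1 : is_derive t 1 (fun x => Phi x + H 1) (h t).
    by rewrite -[h t]addr0; apply: is_deriveD; exact: dPhi.
  apply: near_eq_is_derive dP1; near=> x.
  have xt : 1 < x < t + 1.
    apply/andP; split; near: x; first exact: lt_nbhsr.
    by apply: lt_nbhsl; rewrite ltrDl.
  by rewrite -(HP x xt) /= addrC subrK.
move=> s s2; have s0 : 0 < s by lra.
have a0s : a0 < s by lra.
split; [|exact: cW|exact: GW|exact: dG].
pose t := Num.sqrt (s - c).
have sc : 1 < s - c by rewrite /c; lra.
have tE : t ^+ 2 + c = s by rewrite /t sqr_sqrtr ?subrK//; lra.
have tgt1 : 1 < t by rewrite /t -[X in X < _]sqrtr1 ltr_sqrt//; lra.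
have t0 : t != 0 by rewrite gt_eqF//; lra.
have HV : H = fun t => V (t ^+ 2 + nsq y) by apply/funext => x; rewrite HE.
have := dH t tgt1; rewrite HV => /(profile_derive y0 t0).
rewrite -/c tE /h tE mulrAC divff ?mul1r//.
by rewrite mulf_eq0 negb_or t0 pnatr_eq0.
Unshelve. all: by end_near. Qed.

(** The density of |x|^2 is bounded below away from 0, so the Sobolev norm of u
    controls the energy of the profile. *)
Lemma energy_bounded (Wc : R -> R) : {ae lam, forall s : R, 2 < s -> w s = Wc s} ->
  (forall s : R, 2 < s -> {for s, continuous Wc}) ->
  exists (E : R -> R) (L : R), forall s : R, 3 < s ->
    is_derive s 1 E (V s `^ p + `|2 * Num.sqrt s * Wc s| `^ p) /\ E s <= L.
Proof.
move=> aew cW; have p0 : 0 < p by exact: lt_trans p1.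
pose e (s : R) := V s `^ p + `|2 * Num.sqrt s * Wc s| `^ p.
have csq (s : R) : {for s, continuous (fun s : R => 2 * Num.sqrt s)}.
  by apply: cvgMr; exact: sqrt_continuous.
have cP (h : R -> R) (s : R) : {for s, continuous h} -> {for s, continuous (fun s => `|h s| `^ p)}.
  move=> ch; have -> : (fun s => `|h s| `^ p) = (fun s => `|spow p (h s)|).
    by apply/funext => x; rewrite normr_spow// gt_eqF.
  apply: (@continuous_comp _ _ _ (spow p \o h) Num.norm); last exact: norm_continuous.
  by apply: (@continuous_comp _ _ _ h (spow p)) => //; exact: continuous_spow.
have Vabs (s : R) : 0 < s -> `|V s| = V s by move=> s0; rewrite gtr0_norm// profile_gt0.
have ce (s : R) : 2 < s -> {for s, continuous e}.
  move=> s2; have s0 : 0 < s by lra.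
  apply: cvgD.
    apply: (@continuous_comp _ _ _ V (fun x => x `^ p)); first exact: profile_continuous.
    by apply: continuous_powR; exact: profile_gt0.
  have cs : {for s, continuous (fun s => 2 * Num.sqrt s * Wc s)}.
    by apply: cvgM; [exact: csq|exact: cW].
  exact: (cP _ _ cs).
have ie (b : R) : lam.-integrable `[3, b] (EFin \o (e : RL -> R)).
  apply: continuous_compact_integrable; first exact: segment_compact.
  apply: continuous_in_subspaceT => x; rewrite inE/= in_itv/= => /andP[x3 _].
  by apply: ce; lra.
pose k (s : R) := (`|V s| `^ p + `|slope s| `^ p) * om s.
have mp (h : RL -> R) : measurable_fun setT h -> measurable_fun setT (fun s => `|h s| `^ p).
  move=> mh; apply: (measurableT_comp (measurable_powR p)); exact: measurableT_comp.
have mV : measurable_fun setT (V : RL -> R) by exact: measurable_profile.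
have msl : measurable_fun setT (slope : RL -> R) by exact: measurable_slope.
have ik : lam.-integrable setT (EFin \o (k : RL -> R)).
  have m1 : measurable_fun setT ((EFin \o (fun s => `|V s| `^ p + `|slope s| `^ p)) : RL -> \bar R).
    by apply/measurable_EFinP; apply: measurable_funD; exact: mp.
  have : muS.-integrable setT ((EFin \o (fun s => `|V s| `^ p + `|slope s| `^ p)) \o @nsq R n.+2).
    have i1 := Lfun_integrable p1' uLp.
    have i2 := integrable_slope_nsq hrad hcont p1 wG hsol.
    have := integrableD measurableT i1 i2; apply: eq_integrable => // x _.
    by rewrite /= (profileE hrad) -EFinD.
  move=> /(integrable_radialP (isT : (1 < n.+2)%N) m1); apply: eq_integrable => //.
have k0 s : 0 <= k s by rewrite mulr_ge0 ?radial_density_ge0// addr_ge0 ?powR_ge0.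
pose c1 : R := ball_vol n.+2 * (n.+2%:R / 2).
have c10 : 0 < c1 by rewrite mulr_gt0// ball_vol_gt0.
have omc (s : R) : 3 <= s -> c1 <= om s.
  move=> s3; have s0 : 0 < s by lra.
  rewrite /radial_density s0 -/c1 ler_peMr ?(ltW c10)//.
  have e0 : 0 <= n.+2%:R / 2 - 1 :> R.
    by rewrite subr_ge0 ler_pdivlMr// mul1r (ler_nat R 2).
  have s1 : 1 <= s by lra.
  by have := ler_powR s1 e0; rewrite powRr0.
pose I (s : R) := \int[lam]_(t in `[3, s]) e t.
exists I, (c1^-1 * fine (\int[lam]_t (k t)%:E)) => s s3; split.
  have ss1 : s < s + 1 by rewrite ltrDl.
  have s2 : 2 < s by lra.
  have [d ee] := @continuous_FTC1_closed _ e 3 s (s + 1) ss1 (ie _) s3 (ce _ s2).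
  by apply: DeriveDef; [exact: d|rewrite -derive1E; exact: ee].
rewrite ler_pdivlMl// -lee_fin EFinM.
have m3 : measurable (`[3, s]%classic : set RL) by exact: measurable_itv.
have If : (I s)%:E = (\int[lam]_(t in `[3%R, s]) ((`|V t| `^ p + `|slope t| `^ p)%R)%:E)%E.
  rewrite /I /Rintegral fineK; last exact: (integrable_fin_num m3 (ie s)).
  apply: ae_eq_integral => //.
  - exact: (measurable_int _ (ie s)).
  - by apply: measurable_funTS; apply/measurable_EFinP; apply: measurable_funD; exact: mp.
  - apply: (@filterS _ _ (ae_filter_ringOfSetsType lam) _ _ _ aew) => t ht /=.
    rewrite in_itv/= => /andP[t3 _]; rewrite /e /slope ht; last by lra.
    by rewrite Vabs//; lra.
rewrite If fineK; last exact: (integrable_fin_num measurableT ik).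
rewrite -ge0_integralZl//; last 2 first.
- by apply: measurable_funTS; apply/measurable_EFinP; apply: measurable_funD; exact: mp.
- by rewrite lee_fin ltW.
apply: (@le_trans _ _ (\int[lam]_(t in `[3%R, s]) (k t)%:E)%E).
  apply: ge0_le_integral => //.
  - by move=> t _; rewrite -EFinM lee_fin mulr_ge0 ?(ltW c10)// addr_ge0 ?powR_ge0.
  - apply: measurable_funTS; apply: emeasurable_funM => //.
    by apply/measurable_EFinP; apply: measurable_funD; exact: mp.
  - by apply: measurable_funTS; exact: (measurable_int _ ik).
  - move=> t; rewrite /= in_itv/= => /andP[t3 _]; rewrite -EFinM lee_fin mulrC /k.
    by rewrite ler_wpM2l ?omc// addr_ge0 ?powR_ge0.
apply: ge0_subset_integral => //; first exact: (measurable_int _ ik).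
by move=> t _; rewrite lee_fin.
Qed.

End continuous_flux.

(** * Calculus on a half-line *)

Section half_line_calculus.
Context {R : realType}.
Implicit Types (f df : R -> R) (a b c r : R).

Definition derivative_beyond (r0 : R) f df := forall r : R, r0 < r -> is_derive r 1 f (df r).

Lemma derivative_beyond_continuous r0 f df r : derivative_beyond r0 f df -> r0 < r ->
  {for r, continuous f}.
Proof. by move=> fd /fd; exact: is_derive_continuous. Qed.

Lemma derivative_beyond_within r0 f df a b : derivative_beyond r0 f df -> r0 < a ->
  {within `[a, b], continuous f}.
Proof.
move=> fd ra; apply: continuous_in_subspaceT => x; rewrite inE/= in_itv/= => /andP[ax _].
exact: (derivative_beyond_continuous fd (lt_le_trans ra ax)).
Qed.

Lemma mean_value_beyond r0 f df a b : derivative_beyond r0 f df -> r0 < a -> a < b ->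
  exists c : R, a < c < b /\ f b - f a = df c * (b - a).
Proof.
move=> fd ra ab; have [|c] := @MVT R f df a b ab _ (derivative_beyond_within fd ra).
  by move=> x; rewrite in_itv/= => /andP[ax _]; apply: fd; exact: lt_trans ax.
by rewrite in_itv => cab e; exists c.
Qed.

Lemma nondecreasing_beyond r0 f df : derivative_beyond r0 f df -> (forall r, r0 < r -> 0 <= df r) ->
  forall a b, r0 < a -> a <= b -> f a <= f b.
Proof.
move=> fd df0 a b ra; rewrite le_eqVlt => /predU1P[->//|ab].
have [c [/andP[ac _] e]] := mean_value_beyond fd ra ab.
by rewrite -subr_ge0 e mulr_ge0 ?subr_ge0 ?(ltW ab)// df0// (lt_trans ra).
Qed.

Lemma bounded_growth r0 f df c L : derivative_beyond r0 f df -> 0 < c ->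
  (forall r, r0 < r -> c <= df r) -> (forall r, r0 < r -> f r <= L) -> False.
Proof.
move=> fd c0 cdf fL; pose a := r0 + 1; have ra : r0 < a by rewrite ltrDl.
(* At rate c the bound L is exceeded after this time. *)
pose d := (L - f a) / c + 1.
have La : 0 <= L - f a by rewrite subr_ge0 fL.
have d0 : 0 < d by rewrite ltr_wpDl// divr_ge0// ltW.
have ab : a < a + d by rewrite ltrDl.
have [x [/andP[ax _] e]] := mean_value_beyond fd ra ab.
have h1 := fL _ (lt_trans ra ab).
have h2 : c * d <= df x * (a + d - a).
  by rewrite (addrC a) addrK ler_wpM2r ?(ltW d0)// cdf// (lt_trans ra).
have h3 : c * d = L - f a + c by rewrite /d mulrDr mulr1 mulrC divfK// gt_eqF.
by move: h1 h2; rewrite -e h3; lra.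
Qed.

Lemma nondecreasing_bounded_cvg r0 f L : (forall a b, r0 < a -> a <= b -> f a <= f b) ->
  (forall r, r0 < r -> f r <= L) -> exists l : R, f r @[r --> +oo] --> l.
Proof.
move=> fn fL; pose S := [set f r | r in [set r | r0 < r]].
have hS : has_sup S.
  split; first by exists (f (r0 + 1)), (r0 + 1) => //=; rewrite ltrDl.
  by exists L => _ [r /= h <-]; exact: fL.
exists (sup S); apply/cvgrPdist_le => e e0.
have [_ [r1 /= hr1 <-] fr1] := sup_adherent e0 hS.
near=> r.
have r1r : r1 <= r by apply: ltW; near: r; apply: nbhs_pinfty_gt; exact: num_real.
have h1 : f r <= sup S.
  by apply: ub_le_sup; [exact: hS.2|exists r => //=; exact: lt_le_trans r1r].
have h2 := fn _ _ hr1 r1r.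
by rewrite ger0_norm ?subr_ge0//; lra.
Unshelve. all: by end_near. Qed.

(** Both g and g + f are nondecreasing and bounded above. *)
Lemma dominated_derivative_cvg r0 f df g dg L : derivative_beyond r0 f df ->
  derivative_beyond r0 g dg -> (forall r, r0 < r -> `|df r| <= dg r) ->
  (forall r, r0 < r -> g r <= L) -> exists l : R, f r @[r --> +oo] --> l.
Proof.
move=> fd gd fg gL.
have [l1 h1] : exists l : R, g r @[r --> +oo] --> l.
  apply: (nondecreasing_bounded_cvg _ gL); apply: nondecreasing_beyond gd _ => r /fg.
  exact: le_trans.
have [l2 h2] : exists l : R, (g r + f r) @[r --> +oo] --> l.
  pose a := r0 + 1; have ra : r0 < a by rewrite ltrDl.
  have fub r : a < r -> g r + f r <= 2 * L - g a + f a.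
    move=> ar; have := gL _ (lt_trans ra ar).
    have : f r - f a <= g r - g a.
      have gfd : derivative_beyond r0 (fun r => g r - f r) (fun r => dg r - df r).
        by move=> x x0; apply: is_deriveB; [exact: gd|exact: fd].
      have : g a - f a <= g r - f r.
        apply: (nondecreasing_beyond gfd) => //; last exact: ltW.
        by move=> x /fg; rewrite ler_norml subr_ge0 => /andP[].
      by lra.
    by lra.
  apply: (nondecreasing_bounded_cvg (r0 := a) _ fub) => x y ax.
  have gfd : derivative_beyond r0 (fun r => g r + f r) (fun r => dg r + df r).
    by move=> z z0; apply: is_deriveD; [exact: gd|exact: fd].
  apply: (nondecreasing_beyond gfd); last exact: lt_trans ax.
  by move=> z /fg; rewrite ler_norml -subr_ge0 opprK addrC => /andP[].
exists (l2 - l1); have -> : f = fun r => (g r + f r) - g r by apply/funext => r; rewrite addrC addKr.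
exact: cvgB.
Qed.

Lemma is_derive_lt_right f c l : is_derive c 1 f l -> l < 0 ->
  \forall t \near c^'+, f t < f c.
Proof.
move=> [dV eV] l0.
have cl : h^-1 *: (f (h + c) - f c) @[h --> 0^'] --> l.
  have /cvg_ex[l' hl'] := dV; have <- : l' = l by rewrite -eV; apply/esym/cvg_lim.
  apply: cvg_trans hl'; apply: near_eq_cvg; near=> h.
  by rewrite /= /GRing.scale/= mulr1.
have : \forall h \near 0^', h^-1 *: (f (h + c) - f c) < 0 by exact: (cvgr_lt _ cl).
move=> /= [e /= e0 he]; exists e => //= t; rewrite /ball_/= distrC => tc ct.
have t0 : 0 < t - c by rewrite subr_gt0.
have /= := he (t - c); rewrite /ball_/= sub0r normrN => /(_ tc); rewrite gt_eqF// => /(_ isT).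
by rewrite subrK /GRing.scale/= pmulr_rlt0 ?invr_gt0// subr_lt0.
Unshelve. all: by end_near. Qed.

(** Once below the level b, a function that decreases at rate c there cannot
    come back: at a minimum over an interval on which it exceeds b at the right
    end, its derivative would be negative. It then reaches 0. *)
Lemma positive_above_trap r0 f df b c : derivative_beyond r0 f df -> 0 < c ->
  (forall r, r0 < r -> 0 < f r) -> (forall r, r0 < r -> f r <= b -> df r <= - c) ->
  forall r, r0 < r -> b < f r.
Proof.
move=> fd c0 f0 fb a ra; rewrite ltNge; apply/negP => fab.
have stay x : a <= x -> f x <= b.
  rewrite le_eqVlt => /predU1P[<-//|ax]; rewrite leNgt; apply/negP => bfx.
  have [t] := EVT_min (ltW ax) (derivative_beyond_within (b := x) fd ra).
  rewrite in_itv/= => /andP[at_ tx] tmin.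
  have ftb : f t <= b by apply: le_trans fab; apply: tmin; rewrite in_itv/= lexx ltW.
  have tx' : t < x by rewrite lt_neqAle tx andbT; apply: contraTN bfx => /eqP <-; rewrite -leNgt.
  have rt : r0 < t by exact: lt_le_trans at_.
  have dft : df t < 0 by have := fb t rt ftb; lra.
  have := is_derive_lt_right (fd t rt) dft.
  have : \forall s \near t^'+, t < s < x.
    near=> s; apply/andP; split; near: s; [exact: nbhs_right_gt|exact: nbhs_right_lt].
  move=> h1 h2; have [s [/andP[ts sx] fst]] := @filter_ex _ (t^'+) _ _ (filterI h1 h2).
  have := tmin s; rewrite in_itv/= (ltW sx) (le_trans at_ (ltW ts)) => /(_ isT).
  by rewrite leNgt fst.
have fd' : derivative_beyond a (fun r => - f r) (fun r => - df r).
  by move=> x ax; apply: is_deriveN; apply: fd; exact: lt_trans ax.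
apply: (bounded_growth (L := 0) fd' c0).
  by move=> x ax; rewrite lerNr fb ?stay ?(ltW ax)// (lt_trans ra).
by move=> x ax; rewrite oppr_le0 ltW// f0// (lt_trans ra).
Unshelve. all: by end_near. Qed.

End half_line_calculus.

(** * The radial differential equation *)

Section radial_equation.
Context {R : realType}.
Variables (n : nat) (u : 'rV[R]_n.+2 -> R).
Variables (p m mu : R) (f : R -> R).
Hypotheses (hrad : radial u) (hcont : forall x, x != 0 -> {for x, continuous u}).
Hypotheses (p1 : 1 < p) (cf : continuous f).
Hypotheses (hsol : weak_solution p mu m f u).
Hypothesis hpos : forall x, x != 0 -> 0 < u x.
Local Notation v := (fun r : R => profile u (r ^+ 2)).

Lemma is_derive_sqr_comp (h : R -> R) (r dh : R) : is_derive (r ^+ 2) 1 h dh ->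
  is_derive r 1 (fun r => h (r ^+ 2)) (2 * r * dh).
Proof.
move=> dh'; have d2 : is_derive r 1 (fun r : R => r ^+ 2) (2 * r).
  by apply: is_derive_eq (is_deriveX 2 (is_derive_id r 1)) _; rewrite /GRing.scale/= expr1 mulr1.
by have := @is_derive1_comp R h (fun r : R => r ^+ 2) r _ _ dh' d2; rewrite mulrC.
Qed.

(** The flux times the density of |x|^2 is 2 r^d |v'|^(p-2) v' up to a constant,
    with d = N - 1, and differentiating in r instead of s = r^2 brings a factor
    2 r. *)
Lemma radial_equation : exists (v1 E : R -> R) (L : R), [/\ derivative_beyond 2 v v1,
  derivative_beyond 2 (fun r => spow (p - 1) (v1 r)) (fun r =>
    (m - mu / r `^ p) * v r `^ (p - 1) - f (v r) - (n.+1%:R / r) * spow (p - 1) (v1 r)),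
  derivative_beyond 2 E (fun r => 2 * r * (v r `^ p + `|v1 r| `^ p)) &
  forall r, 2 < r -> E r <= L].
Proof.
have [G wG] : exists G, weak_gradient p u G by have [[[]]] := hsol.
have [Wc [Gam [aew H]]] := profile_C1 hrad hcont p1 cf wG hsol hpos.
have [E [L HE]] := energy_bounded hrad hcont p1 wG hsol hpos aew
  (fun s h => let: And4 _ c _ _ := H s h in c).
have r2 (r : R) : 2 < r -> 3 < r ^+ 2 by move=> ?; nra.
have r2' (r : R) : 2 < r -> 2 < r ^+ 2 by move=> ?; nra.
pose v1 (r : R) := 2 * r * Wc (r ^+ 2).
exists v1, (fun r => E (r ^+ 2)), L; split.
- by move=> r rgt2; apply: is_derive_sqr_comp; have [] := H _ (r2' r rgt2).
- pose c0 : R := ball_vol n.+2 * (n.+2%:R / 2).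
  have c00 : 0 < c0 by rewrite mulr_gt0// ball_vol_gt0.
  have omE (r : R) : 0 < r -> radial_density n.+2 (r ^+ 2) = c0 * r ^+ n.
    (* The exponent N / 2 - 1 is n / 2. *)
    move=> r0; rewrite /radial_density exprn_gt0// /c0; congr (_ * _).
    rewrite -[r ^+ 2]powR_mulrn ?(ltW r0)// -powRrM.
    have -> : 2%:R * (n.+2%:R / 2 - 1) = n%:R :> R by rewrite -natr1 -natr1; field.
    by rewrite powR_mulrn// ltW.
  clearbody c0; move=> r rgt2; have r0 : 0 < r by lra.
  have PE (x : R) : 2 < x -> spow (p - 1) (v1 x) = Gam (x ^+ 2) * (2 * c0 * x ^+ n.+1)^-1.
    move=> x2; have x0 : 0 < x by lra.
    have [_ _ -> _] := H _ (r2' x x2).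
    rewrite omE// sqrtr_sqr ger0_norm ?(ltW x0)// -/(v1 x).
    by rewrite exprS; field; rewrite expf_eq0 !gt_eqF ?andbF.
  have [_ _ _ dG] := H _ (r2' r rgt2).
  have d1 := is_derive_sqr_comp dG.
  have d2 : is_derive r 1 (fun r : R => 2 * c0 * r ^+ n.+1) (2 * c0 * (n.+1%:R * r ^+ n)).
    have dX : is_derive r 1 (fun r : R => r ^+ n.+1) (n.+1%:R * r ^+ n).
      have := is_deriveX n.+1 (is_derive_id r (1 : R)).
      by rewrite exprfctE /GRing.scale/= mulr1.
    exact: (is_deriveZ (2 * c0) dX).
  have nz : 2 * c0 * r ^+ n.+1 != 0 by rewrite !mulf_eq0 expf_eq0 pnatr_eq0 (gt_eqF c00) (gt_eqF r0) andbF.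
  have d3 := is_deriveM d1 (@is_deriveV _ (fun r : R => 2 * c0 * r ^+ n.+1) r _ 1 nz d2).
  have PEr := PE r rgt2.
  have d4 : is_derive r 1 (fun r : R => Gam (r ^+ 2) * (2 * c0 * r ^+ n.+1)^-1)
     ((m - mu / r `^ p) * v r `^ (p - 1) - f (v r) - (n.+1%:R / r) * spow (p - 1) (v1 r)).
    apply: is_derive_eq d3 _; rewrite /GRing.scale/= omE// PEr.
    have v0 : 0 < v r by apply: profile_gt0 => //; rewrite exprn_gt0.
    rewrite /source sqrtr_sqr (ger0_norm (ltW r0)) spow_pred spow_gt0//.
    have rp0 : r `^ p != 0 by rewrite gt_eqF// powR_gt0.
    have rn0 : r ^+ n != 0 by rewrite gt_eqF// exprn_gt0.
    have cN0 : c0 != 0 by rewrite gt_eqF.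
    have rN0 : r != 0 by rewrite gt_eqF.
    move: (Gam _) (profile u _ `^ _) (f _) rp0; rewrite (exprS r n).
    move: (r `^ p) (r ^+ n) rn0 => rp rn rn0 Gm vp fv rp0.
    by field; rewrite rn0 cN0 rN0 rp0.
  apply: near_eq_is_derive d4; near=> x.
  have x2 : 2 < x by near: x; exact: lt_nbhsr.
  by rewrite PE.
- move=> r rgt2; have [dE _] := HE _ (r2 r rgt2).
  have := is_derive_sqr_comp dE.
  have r0 : 0 <= r by lra.
  by rewrite sqrtr_sqr (ger0_norm r0).
- by move=> r rgt2; have [] := HE _ (r2 r rgt2).
Unshelve. all: by end_near. Qed.

End radial_equation.

(** * Decay of positive solutions of the radial equation *)

Section decay_ode.
Context {R : realType}.
Implicit Types (r t : R).

Lemma near_pinfty_threshold (P : R -> Prop) (r0 : R) : (\forall r \near +oo, P r) ->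
  exists r1 : R, r0 <= r1 /\ forall r, r1 < r -> P r.
Proof.
move=> [M [_ hM]]; exists (Num.max r0 M); split; first by rewrite le_max lexx.
by move=> r; rewrite gt_max => /andP[_ /hM].
Qed.

Lemma is_derive_powR_comp (g : R -> R) (a r dg : R) : 0 < g r -> is_derive r 1 g dg ->
  is_derive r 1 (fun r => g r `^ a) (a * g r `^ (a - 1) * dg).
Proof.
by move=> g0 gd; exact: (@is_derive1_comp R (fun x => x `^ a) g r _ _ (is_derive1_powR a g0) gd).
Qed.

Lemma cvg_invr_pinfty : (r^-1 : R) @[r --> +oo] --> (0 : R).
Proof.
apply/cvgrPdist_lt => e e0; near=> r.
have re : e^-1 < r by near: r; apply: nbhs_pinfty_gt; exact: num_real.
have r0 : 0 < r by apply: lt_trans re; rewrite invr_gt0.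
by rewrite sub0r normrN gtr0_norm ?invr_gt0// invf_plt ?posrE.
Unshelve. all: by end_near. Qed.

Lemma powR_cvg0_pinfty (g : R -> R) (a : R) : 0 < a -> (\forall r \near +oo, 0 < g r) ->
  g r @[r --> +oo] --> (0 : R) -> g r `^ a @[r --> +oo] --> (0 : R).
Proof.
move=> a0 g0 gc; apply/cvgrPdist_lt => e e0.
have ea : 0 < e `^ a^-1 by rewrite powR_gt0.
near=> r.
have gr0 : 0 < g r by near: r.
have gre : g r < e `^ a^-1 by near: r; exact: (cvgr_lt _ gc).
rewrite sub0r normrN ger0_norm ?powR_ge0//.
have -> : e = (e `^ a^-1) `^ a by rewrite -powRrM mulVf ?powRr1 ?gt_eqF// ltW.
by apply: gt0_ltr_powR; rewrite ?nnegrE ?ltW.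
Unshelve. all: by end_near. Qed.

Variables (p m mu q d A delta : R) (f v v1 E : R -> R) (L : R).
Hypotheses (p1 : 1 < p) (m0 : 0 < m) (mu0 : 0 <= mu) (pq : p < q) (d0 : 0 <= d).
Hypotheses (A0 : 0 < A) (delta0 : 0 < delta).
Hypothesis fA : forall t, 0 < t -> t < delta -> `|f t| <= A * t `^ (q - 1).
Hypothesis v0 : forall r, 2 < r -> 0 < v r.
Hypothesis dv : derivative_beyond 2 v v1.
Hypothesis dP : derivative_beyond 2 (fun r => spow (p - 1) (v1 r)) (fun r =>
    (m - mu / r `^ p) * v r `^ (p - 1) - f (v r) - (d / r) * spow (p - 1) (v1 r)).
Hypothesis dE : derivative_beyond 2 E (fun r => 2 * r * (v r `^ p + `|v1 r| `^ p)).
Hypothesis EL : forall r, 2 < r -> E r <= L.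

Let p0 : 0 < p. Proof. exact: lt_trans p1. Qed.
Let pm0 : 0 < p - 1. Proof. by rewrite subr_gt0. Qed.

Lemma pos_near : \forall r \near +oo, 0 < v r.
Proof. by exists 2; split; [exact: num_real|exact: v0]. Qed.

(** By Young, |(v^p)'| is bounded by p times the energy density, so v^p
    converges; finite energy excludes a positive limit. *)
Lemma solution_cvg0 : v r @[r --> +oo] --> (0 : R).
Proof.
have dQ : derivative_beyond 2 (fun r => v r `^ p) (fun r => p * v r `^ (p - 1) * v1 r).
  by move=> r r2; apply: is_derive_powR_comp; [exact: v0|exact: dv].
have dpE : derivative_beyond 2 (fun r => p * E r) (fun r => p * (2 * r * (v r `^ p + `|v1 r| `^ p))).
  by move=> r r2; exact: (is_deriveZ p (dE r2)).
have [l Ql] : exists l : R, v r `^ p @[r --> +oo] --> l.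
  apply: (dominated_derivative_cvg (L := p * L) dQ dpE) => r r2; last first.
    by rewrite ler_wpM2l ?(ltW p0)// EL.
  have vr := v0 r2; rewrite -mulrA normrM (gtr0_norm p0) ler_wpM2l ?(ltW p0)//.
  rewrite normrM ger0_norm ?powR_ge0//.
  have S0 : 0 <= v r `^ p + `|v1 r| `^ p by rewrite addr_ge0 ?powR_ge0.
  apply: (@le_trans _ _ (v r `^ p + `|v1 r| `^ p)); last by nra.
  have [h|h] := leP `|v1 r| (v r).
    apply: (@le_trans _ _ (v r `^ p)); last by rewrite lerDl powR_ge0.
    by rewrite -(powRB1_mul p vr) ler_wpM2l ?powR_ge0.
  have w0 := lt_trans vr h.
  apply: (@le_trans _ _ (`|v1 r| `^ p)); last by rewrite lerDr powR_ge0.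
  rewrite -(powRB1_mul p w0) ler_wpM2r ?normr_ge0//.
  by apply: ge0_ler_powR; rewrite ?nnegrE ?(ltW pm0) ?(ltW vr) ?(ltW w0)// ltW.
have l0 : 0 <= l.
  rewrite leNgt; apply/negP => l0; have hr : \forall r \near +oo, v r `^ p < 0 by exact: (cvgr_lt _ Ql).
  by have [r] := filter_ex hr; rewrite ltNge powR_ge0.
have [l00|lN] := eqVneq l 0; last first.
  have lgt : 0 < l by rewrite lt_neqAle eq_sym lN.
  have : \forall r \near +oo, l / 2 < v r `^ p.
    by apply: (cvgr_gt _ Ql); lra.
  move=> /(near_pinfty_threshold 2)[r1 [r12 hr1]]; exfalso.
  apply: (bounded_growth (r0 := r1) (f := E) (L := L) _ lgt).
  - by move=> r rr; apply: dE; exact: le_lt_trans rr.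
  - move=> r rr; have := hr1 r rr; have : 0 <= `|v1 r| `^ p by exact: powR_ge0.
    have : 2 < r by exact: le_lt_trans rr.
    by move=> *; nra.
  - by move=> r rr; apply: EL; exact: le_lt_trans rr.
have pV0 : 0 < p^-1 by rewrite invr_gt0.
have := @powR_cvg0_pinfty (fun r => v r `^ p) p^-1 pV0.
rewrite l00 in Ql; move=> /(_ _ Ql) h.
have : (v r `^ p) `^ p^-1 @[r --> +oo] --> (0 : R).
  by apply: h; apply: filterS pos_near => r; exact: powR_gt0.
apply: cvg_trans; apply: near_eq_cvg; near=> r.
have vr : 0 < v r by near: r; exact: pos_near.
by rewrite -powRrM divff ?powRr1 ?gt_eqF// ltW.
Unshelve. all: by end_near. Qed.

(** The coefficient of v^(p-1) in the equation, which tends to m. *)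
Definition perturbation r : R := m - mu / r `^ p - f (v r) / v r `^ (p - 1).

(** The size of f(v) / v^(p-1). *)
Definition tail r : R := v r `^ (q - p).

Lemma tail_cvg0 : tail r @[r --> +oo] --> (0 : R).
Proof.
by apply: powR_cvg0_pinfty; [rewrite subr_gt0|exact: pos_near|exact: solution_cvg0].
Qed.

Lemma perturbation_bound : \forall r \near +oo, 2 < r /\
  `|perturbation r - m| <= mu / r `^ p + A * tail r.
Proof.
near=> r.
have r2 : 2 < r by near: r; apply: nbhs_pinfty_gt; exact: num_real.
split=> //; have vr := v0 r2.
have vd : v r < delta by near: r; exact: (cvgr_lt _ solution_cvg0).
have fr := fA vr vd.
have -> : perturbation r - m = - (mu / r `^ p) - f (v r) / v r `^ (p - 1).
  by rewrite /perturbation; ring.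
apply: le_trans (ler_normB _ _) _; rewrite normrN ger0_norm; last first.
  by rewrite divr_ge0// powR_ge0.
rewrite lerD2l normrM normfV [`|v r `^ _|]ger0_norm ?powR_ge0//.
rewrite ler_pdivrMr ?powR_gt0// -mulrA /tail -powRD; last by rewrite (gt_eqF vr) implybT.
by have -> : q - p + (p - 1) = q - 1 by ring.
Unshelve. all: by end_near. Qed.

Lemma perturbation_error_cvg0 : (mu / r `^ p + A * tail r) @[r --> +oo] --> (0 : R).
Proof.
have -> : 0 = mu * 0 + A * 0 :> R by rewrite !mulr0 addr0.
apply: cvgD; last by apply: cvgMr; exact: tail_cvg0.
apply: cvgMr.
have h : (r^-1 `^ p) @[r --> +oo] --> (0 : R).
  apply: powR_cvg0_pinfty => //; last exact: cvg_invr_pinfty.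
  near=> r; rewrite invr_gt0; near: r; apply: nbhs_pinfty_gt; exact: num_real.
apply: cvg_trans h; apply: near_eq_cvg; near=> r.
have r0 : 0 <= r by near: r; apply: nbhs_pinfty_ge; exact: num_real.
by rewrite -powR_inv1// -!powRrM mulN1r -powRN.
Unshelve. all: by end_near. Qed.

Lemma perturbation_near (e : R) : 0 < e ->
  \forall r \near +oo, 2 < r /\ m - e < perturbation r < m + e.
Proof.
move=> e0; near=> r.
have [r2 hr] : 2 < r /\ `|perturbation r - m| <= mu / r `^ p + A * tail r.
  by near: r; exact: perturbation_bound.
have he : mu / r `^ p + A * tail r < e by near: r; exact: (cvgr_lt _ perturbation_error_cvg0).
split=> //; have := le_lt_trans hr he; rewrite ltr_norml => /andP[h1 h2].
by apply/andP; split; lra.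
Unshelve. all: by end_near. Qed.

Lemma spow_ge0 a (x : R) : 0 < a -> (0 <= spow a x) = (0 <= x).
Proof.
move=> a0; have [->|x0] := eqVneq x 0; first by rewrite spow0.
by rewrite /spow pmulr_rge0// powR_gt0// normr_gt0.
Qed.

(** r^d |v'|^(p-2) v' increases once the perturbation is positive, so one
    nonnegative slope would make v nondecreasing ever after, against v -> 0. *)
Lemma solution_decreasing : exists r1 : R, 2 <= r1 /\ forall r, r1 < r -> v1 r < 0.
Proof.
have [r1 [r12 hr1]] := near_pinfty_threshold 2 (perturbation_near m0).
exists r1; split=> // r rr; rewrite ltNge; apply/negP => v1r.
have dK : derivative_beyond r1 (fun r => r `^ d * spow (p - 1) (v1 r))
    (fun r => r `^ d * (perturbation r * v r `^ (p - 1))).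
  move=> s rs; have s2 : 2 < s by exact: le_lt_trans rs.
  have s0 : 0 < s by lra.
  have h1 := is_deriveM (is_derive1_powR d s0) (dP s2).
  apply: is_derive_eq h1 _; rewrite /GRing.scale/=.
  have vs := v0 s2; have -> : s `^ d = s `^ (d - 1) * s by rewrite powRB1_mul.
  rewrite /perturbation; field.
  by rewrite !gt_eqF ?powR_gt0.
have K0 s : r < s -> 0 <= v1 s.
  move=> rs; rewrite -(spow_ge0 (v1 s) pm0).
  have s0 : 0 < s by have := lt_trans (le_lt_trans r12 rr) rs; lra.
  have := @nondecreasing_beyond R r1 _ _ dK _ r s rr (ltW rs).
  have -> : (forall x, r1 < x -> 0 <= x `^ d * (perturbation x * v x `^ (p - 1))) = True.
    apply/propext; split=> // _ x rx; rewrite mulr_ge0 ?powR_ge0// mulr_ge0 ?powR_ge0//.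
    by have [_ /andP[h _]] := hr1 x rx; lra.
  move=> /(_ I) h; have : 0 <= s `^ d * spow (p - 1) (v1 s).
    by apply: le_trans h; rewrite mulr_ge0 ?powR_ge0// spow_ge0.
  by rewrite pmulr_rge0// powR_gt0.
have dvr : derivative_beyond r v v1.
  by move=> s rs; apply: dv; rewrite (lt_trans _ rs)// (le_lt_trans r12).
have vmono := nondecreasing_beyond dvr K0.
have r1r : r < r + 1 by rewrite ltrDl.
have vr1 : 0 < v (r + 1) by apply: v0; rewrite (lt_trans _ r1r)// (le_lt_trans r12).
have h1 : \forall s \near +oo, v s < v (r + 1) by exact: (cvgr_lt _ solution_cvg0).
have h2 : \forall s \near +oo, r + 1 <= s by apply: nbhs_pinfty_ge; exact: num_real.
have [s [hs1 hs2]] := filter_ex (filterI h1 h2).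
by have := vmono _ _ r1r hs2; rewrite leNgt hs1.
Qed.

Let a := (p - 1)^-1.
Let a0 : 0 < a. Proof. by rewrite invr_gt0. Qed.
Let pm1a : (p - 1) * a = 1. Proof. by rewrite /a divff// gt_eqF. Qed.
Let paE : (p - 1) * (1 + a) = p. Proof. by rewrite mulrDr mulr1 pm1a subrK. Qed.

(** This is (-v'/v)^(p-1). In this variable the equation for the flux becomes a
    first-order equation without v. *)
Definition logflux r : R := - spow (p - 1) (v1 r) / v r `^ (p - 1).

Lemma logflux_powR r : 2 < r -> v1 r < 0 ->
  0 < logflux r /\ logflux r `^ a = - v1 r / v r.
Proof.
move=> r2 v1r; have vr := v0 r2.
have y0 : 0 < - v1 r / v r by rewrite divr_gt0// oppr_gt0.
have zE : logflux r = (- v1 r / v r) `^ (p - 1).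
  rewrite /logflux -spowN spow_gt0 ?oppr_gt0//.
  rewrite powRM ?oppr_ge0 ?(ltW v1r) ?invr_ge0 ?(ltW vr)//; congr (_ * _).
  have -> : (v r)^-1 = v r `^ (- 1) by rewrite powR_inv1// ltW.
  by rewrite -powRrM mulN1r powRN.
rewrite zE; split; first exact: powR_gt0.
by rewrite -powRrM pm1a powRr1// ltW.
Qed.

Lemma logflux_derive r1 : 2 <= r1 -> (forall r, r1 < r -> v1 r < 0) ->
  derivative_beyond r1 logflux (fun r => (p - 1) * logflux r `^ (1 + a) - d / r * logflux r - perturbation r).
Proof.
move=> r12 v1n r rr; have r2 := le_lt_trans r12 rr; have vr := v0 r2.
have [z0 zy] := logflux_powR r2 (v1n r rr).
have d1 : is_derive r 1 (fun r => - spow (p - 1) (v1 r)) (- ((m - mu / r `^ p) * v r `^ (p - 1) -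
    f (v r) - (d / r) * spow (p - 1) (v1 r))) by exact: (is_deriveN (dP r2)).
have d2 := is_derive_powR_comp (p - 1) vr (dv r2).
have nz : v r `^ (p - 1) != 0 by rewrite gt_eqF// powR_gt0.
have d3 := is_deriveM d1 (@is_deriveV _ (fun r => v r `^ (p - 1)) r _ 1 nz d2).
apply: is_derive_eq d3 _; rewrite /GRing.scale/=.
have -> : logflux r `^ (1 + a) = logflux r * (- v1 r / v r).
  by rewrite powRD ?(gt_eqF z0) ?implybT// powRr1 ?(ltW z0)// zy.
have -> : v r `^ (p - 1) = v r `^ (p - 1 - 1) * v r by rewrite powRB1_mul.
have nz' : v r `^ (p - 1 - 1) != 0 by rewrite gt_eqF// powR_gt0.
have r0 : r != 0 by rewrite gt_eqF//; lra.
rewrite /logflux /perturbation -(powRB1_mul (p - 1) vr).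
have rp0 : r `^ p != 0 by rewrite gt_eqF// powR_gt0//; lra.
have vN0 : v r != 0 by rewrite gt_eqF.
move: (v r `^ (p - 1 - 1)) nz' (spow _ _) (r `^ p) rp0 (f (v r)) => w nz' P rp rp0 fv.
by field; rewrite nz' r0 rp0 vN0.
Qed.

(** The function exp(-beta r) solves the limit equation
    (|v'|^(p-2) v')' = m v^(p-1). *)
Definition decay_rate : R := (m / (p - 1)) `^ p^-1.
Local Notation beta := decay_rate.
Definition limit_flux : R := beta `^ (p - 1).
Local Notation zs := limit_flux.

Let ma0 : 0 < m / (p - 1). Proof. by rewrite divr_gt0. Qed.

Lemma decay_rate_gt0 : 0 < beta. Proof. by rewrite powR_gt0. Qed.
Lemma limit_flux_gt0 : 0 < zs. Proof. by rewrite powR_gt0// decay_rate_gt0. Qed.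

Lemma limit_flux_powR : zs `^ a = beta.
Proof. by rewrite -powRrM pm1a powRr1// ltW// decay_rate_gt0. Qed.

Lemma limit_flux_eq : (p - 1) * zs `^ (1 + a) = m.
Proof.
rewrite -powRrM paE -powRrM mulVf ?gt_eqF// powRr1 ?(ltW ma0)//.
by rewrite mulrCA divff ?mulr1// gt_eqF.
Qed.

Let a1_gt0 : 0 < 1 + a. Proof. by rewrite ltr_wpDl. Qed.

(** Below the equilibrium the right-hand side of the Riccati equation is bounded
    away from 0 and negative, which would drive z below 0. *)
Lemma logflux_above (z2 : R) : 0 < z2 -> z2 < zs -> \forall r \near +oo, z2 < logflux r.
Proof.
move=> z20 z2s.
have [r1 [r12 v1n]] := solution_decreasing.
pose c := (m - (p - 1) * z2 `^ (1 + a)) / 2.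
have c0 : 0 < c.
  have h : z2 `^ (1 + a) < zs `^ (1 + a).
    by apply: gt0_ltr_powR; rewrite ?nnegrE ?(ltW z20) ?(ltW limit_flux_gt0).
  have : (p - 1) * z2 `^ (1 + a) < (p - 1) * zs `^ (1 + a) by rewrite ltr_pM2l.
  by rewrite limit_flux_eq /c => h'; rewrite divr_gt0// subr_gt0.
have c2 : 2 * c = m - (p - 1) * z2 `^ (1 + a) by rewrite /c mulrC divfK.
clearbody c.
have [r3 [r31 hr3]] := near_pinfty_threshold r1 (perturbation_near c0).
have dz : derivative_beyond r3 logflux (fun r => (p - 1) * logflux r `^ (1 + a) - d / r * logflux r - perturbation r).
  by move=> r rr; apply: logflux_derive r12 v1n _ _; exact: le_lt_trans rr.
exists r3; split; first exact: num_real.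
apply: (positive_above_trap dz c0) => r rr.
  by apply: (logflux_powR _ _).1; [exact: le_lt_trans (le_trans r12 r31) rr|apply: v1n; exact: le_lt_trans rr].
move=> zr; have [r2 /andP[h1 _]] := hr3 r rr.
have z0 : 0 < logflux r.
  by apply: (logflux_powR _ _).1 => //; apply: v1n; exact: le_lt_trans rr.
have h2 : (p - 1) * logflux r `^ (1 + a) <= (p - 1) * z2 `^ (1 + a).
  by rewrite ler_wpM2l ?(ltW pm0)//; apply: ge0_ler_powR; rewrite ?nnegrE ?(ltW a1_gt0) ?(ltW z20) ?(ltW z0).
have h3 : 0 <= d / r * logflux r by rewrite mulr_ge0 ?(ltW z0)// divr_ge0//; lra.
by lra.
Qed.

(** Above the equilibrium the superlinear term dominates and z^(-1/(p-1)) would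
    reach 0 at a finite radius. *)
Lemma logflux_below (z2 : R) : zs < z2 -> \forall r \near +oo, logflux r < z2.
Proof.
move=> z2s; have z20 : 0 < z2 by exact: lt_trans limit_flux_gt0 z2s.
have [r1 [r12 v1n]] := solution_decreasing.
pose x r := logflux r `^ (- a); pose x2 := z2 `^ (- a).
have am : a * m * z2 `^ (- a - 1) < 1.
  have -> : a * m = zs `^ (1 + a).
    transitivity (a * ((p - 1) * zs `^ (1 + a))); first by rewrite limit_flux_eq.
    by rewrite mulrA [a * _]mulrC pm1a mul1r.
  have -> : - a - 1 = - (1 + a) by ring.
  rewrite powRN ltr_pdivrMr ?powR_gt0// mul1r.
  by apply: gt0_ltr_powR; rewrite ?nnegrE ?(ltW z20) ?(ltW limit_flux_gt0).
pose w2 := z2 `^ (- a - 1); have w20 : 0 < w2 by exact: powR_gt0.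
(* Two of the four shares pay for the error terms, so the slope is at most -c. *)
pose c := (1 - a * m * w2) / 4.
have c0 : 0 < c by rewrite divr_gt0// subr_gt0.
have e0 : 0 < c / (a * w2) by rewrite divr_gt0// mulr_gt0.
have near1 : \forall r \near +oo, a * d * x2 / r < c.
  have : a * d * x2 / r @[r --> +oo] --> a * d * x2 * 0 by apply: cvgMr; exact: cvg_invr_pinfty.
  by rewrite mulr0 => h; exact: (cvgr_lt _ h).
have [r3 [r31 hr3]] := near_pinfty_threshold r1 (filterI (perturbation_near e0) near1).
have zpos r : r3 < r -> 2 < r /\ 0 < logflux r.
  move=> rr; have [[r2 _] _] := hr3 r rr; split=> //.
  by apply: (logflux_powR _ _).1 => //; apply: v1n; exact: le_lt_trans rr.
have dx : derivative_beyond r3 x (fun r => -1 + a * d * x r / r + a * perturbation r * logflux r `^ (- a - 1)).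
  move=> r rr; have [r2 z0] := zpos r rr; have r1r := le_lt_trans r31 rr.
  have h := is_derive_powR_comp (- a) z0 (logflux_derive r12 v1n r1r).
  apply: is_derive_eq h _; rewrite /x.
  have -> : logflux r `^ (- a) = logflux r `^ (- a - 1) * logflux r by rewrite powRB1_mul.
  have E1 : logflux r `^ (- a - 1) * logflux r `^ (1 + a) = 1.
    by rewrite -powRD ?(gt_eqF z0) ?implybT// (_ : _ + _ = 0) ?powRr0//; ring.
  have -> : - a * logflux r `^ (- a - 1) *
     ((p - 1) * logflux r `^ (1 + a) - d / r * logflux r - perturbation r) =
     - ((p - 1) * a) * (logflux r `^ (- a - 1) * logflux r `^ (1 + a))
     + a * d * (logflux r `^ (- a - 1) * logflux r) / r + a * perturbation r * logflux r `^ (- a - 1).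
    by ring.
  by rewrite E1 pm1a mulr1.
have trap r : r3 < r -> x2 < x r.
  apply: (positive_above_trap dx c0).
    by move=> s rs; apply: powR_gt0; have [] := zpos s rs.
  move=> s rs xs; have [s2 z0] := zpos s rs.
  have [[_ /andP[_ hp]] h1] := hr3 s rs.
  have s0 : 0 < s by lra.
  have x0 : 0 < x s by exact: powR_gt0.
  have zz : z2 <= logflux s.
    rewrite leNgt; apply/negP => zlt.
    have : logflux s `^ a < z2 `^ a by apply: gt0_ltr_powR; rewrite ?nnegrE ?(ltW z20) ?(ltW z0).
    move: xs; rewrite /x /x2 !powRN lef_pV2 ?posrE ?powR_gt0//.
    by rewrite leNgt => /negP.
  have h2 : a * d * x s / s <= a * d * x2 / s.
    by rewrite ler_wpM2r ?invr_ge0 ?(ltW s0)// ler_wpM2l// mulr_ge0// ltW.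
  have h3 : logflux s `^ (- a - 1) <= w2.
    rewrite /w2; have -> : - a - 1 = - (1 + a) by ring.
    rewrite !powRN lef_pV2 ?posrE ?powR_gt0//.
    by apply: ge0_ler_powR; rewrite ?nnegrE ?(ltW a1_gt0) ?(ltW z20) ?(ltW z0).
  have h4 : a * perturbation s * logflux s `^ (- a - 1) <= a * (m + c / (a * w2)) * w2.
    have l0 : 0 < logflux s `^ (- a - 1) by exact: powR_gt0.
    apply: (@le_trans _ _ (a * (m + c / (a * w2)) * logflux s `^ (- a - 1))).
      by rewrite ler_wpM2r ?(ltW l0)// ler_wpM2l ?(ltW a0)// ltW.
    by rewrite ler_wpM2l// mulr_ge0 ?(ltW a0)// addr_ge0 ?(ltW m0)// ltW.
  have h5 : a * (m + c / (a * w2)) * w2 = a * m * w2 + c by field; rewrite !gt_eqF.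
  have h6 : 4 * c = 1 - a * m * w2 by rewrite /c; field.
  by rewrite h5 in h4; lra.
exists r3; split; first exact: num_real.
move=> r rr; have [r2 z0] := zpos r rr; rewrite ltNge; apply/negP => zz.
have := trap r rr; rewrite /x /x2 !powRN ltf_pV2 ?posrE ?powR_gt0// ltNge => /negP; apply.
by apply: ge0_ler_powR; rewrite ?nnegrE ?(ltW a0) ?(ltW z20) ?(ltW z0).
Qed.

(** The Riccati nonlinearity minus the multiple of -v'/v that the derivative of
    ln v contributes. *)
Definition riccati_remainder (z : R) : R :=
  (p - 1) * z `^ (1 + a) - p * (p - 1) * zs * (z `^ a - beta) - m.

(** The derivative at x is p x^(a-1) (x - zs), so zs is a critical point. *)
Lemma riccati_remainder_quadratic : exists C : R, 0 <= C /\
  forall z, zs / 2 <= z <= 2 * zs -> `|riccati_remainder z| <= C * (z - zs) ^+ 2.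
Proof.
have s0 := limit_flux_gt0.
(* The sum covers both monotonicities of x^(a-1). *)
pose M := (zs / 2) `^ (a - 1) + (2 * zs) `^ (a - 1).
have M0 : 0 <= M by rewrite addr_ge0 ?powR_ge0.
exists (p * M); split; first by rewrite mulr_ge0// ltW.
have T0 : riccati_remainder zs = 0.
  by rewrite /riccati_remainder limit_flux_eq limit_flux_powR; ring.
pose dT x := p * x `^ (a - 1) * (x - zs).
have dTE : derivative_beyond 0 riccati_remainder dT.
  move=> x x0.
  have d1 := is_deriveZ (p - 1) (is_derive1_powR (1 + a) x0).
  have d2 := is_deriveZ (p * (p - 1) * zs) (is_deriveB (is_derive1_powR a x0) (is_derive_cst beta x 1)).
  have d3 := is_deriveB (is_deriveB d1 d2) (is_derive_cst m x 1).
  apply: is_derive_eq d3 _; rewrite /GRing.scale/= /dT !subr0.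
  have -> : 1 + a - 1 = a by ring.
  rewrite [(p - 1) * ((1 + a) * _)]mulrA paE -(powRB1_mul a x0).
  have -> : p * (p - 1) * zs * (a * x `^ (a - 1)) = p * ((p - 1) * a) * zs * x `^ (a - 1) by ring.
  by rewrite pm1a; ring.
have xM x : zs / 2 <= x <= 2 * zs -> x `^ (a - 1) <= M.
  move=> /andP[x1 x2]; have x0 : 0 < x by apply: lt_le_trans x1; rewrite divr_gt0.
  have [h|h] := leP 0 (a - 1).
    apply: (@le_trans _ _ ((2 * zs) `^ (a - 1))); last by rewrite lerDr powR_ge0.
    by apply: ge0_ler_powR; rewrite ?nnegrE ?mulr_ge0 ?(ltW x0) ?(ltW s0).
  apply: (@le_trans _ _ ((zs / 2) `^ (a - 1))); last by rewrite lerDl powR_ge0.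
  have -> : a - 1 = - (1 - a) by ring.
  rewrite !powRN lef_pV2 ?posrE ?powR_gt0 ?divr_gt0//.
  by apply: ge0_ler_powR; rewrite ?nnegrE ?(ltW x0) ?divr_ge0 ?(ltW s0)//; lra.
have bound x z : 0 < x -> zs / 2 <= x <= 2 * zs -> `|x - zs| <= `|z - zs| ->
    `|dT x * (z - zs)| <= p * M * (z - zs) ^+ 2.
  move=> x0 xz h; rewrite /dT !normrM (gtr0_norm p0) [`|_ `^ _|]ger0_norm ?powR_ge0//.
  rewrite -[(z - zs) ^+ 2]real_normK ?num_real// expr2 mulrA.
  rewrite ler_wpM2r//; apply: ler_pM => //; first by rewrite mulr_ge0 ?powR_ge0 ?(ltW p0).
  by rewrite ler_wpM2l ?(ltW p0)// xM.
move=> z /andP[z1 z2]; have z0 : 0 < z by apply: lt_le_trans z1; rewrite divr_gt0.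
have [zl|zg|->] := ltgtP z zs; last by rewrite T0 subrr normr0 expr0n mulr0.
  have [x [/andP[x1 x2] e]] := mean_value_beyond dTE z0 zl.
  have x0 := lt_trans z0 x1.
  have -> : riccati_remainder z = dT x * (z - zs).
    by move: e; rewrite T0 sub0r => e; rewrite -[zs - z]opprB mulrN in e; apply: oppr_inj.
  apply: bound => //; first by rewrite (le_trans z1 (ltW x1))/=; lra.
  by rewrite !ltr0_norm ?subr_lt0//; lra.
have [x [/andP[x1 x2] e]] := mean_value_beyond dTE s0 zg.
have x0 := lt_trans s0 x1.
have -> : riccati_remainder z = dT x * (z - zs) by rewrite -e T0 subr0.
apply: bound => //; first by rewrite (le_trans (ltW x2) z2) andbT; lra.
by rewrite !gtr0_norm ?subr_gt0//; lra.
Qed.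

(** Monotonicity of x^a: this makes the equilibrium repelling. *)
Lemma powR_gap (z : R) : 0 < z -> zs `^ a * (z - zs) ^+ 2 <= (z - zs) * (z `^ (1 + a) - zs `^ (1 + a)).
Proof.
move=> z0; have s0 := limit_flux_gt0.
have e (x : R) : 0 < x -> x `^ (1 + a) = x * x `^ a.
  by move=> x0; rewrite powRD ?(gt_eqF x0) ?implybT// powRr1// ltW.
rewrite !e//; have hz := powR_gt0 a z0.
have [h|h] := leP zs z.
  have : zs `^ a <= z `^ a by apply: ge0_ler_powR; rewrite ?nnegrE ?(ltW a0) ?(ltW s0) ?(ltW z0).
  by move: (zs `^ a) (z `^ a) => A1 A2 ?; have : 0 <= (z - zs) * z * (A2 - A1); [rewrite !mulr_ge0 ?subr_ge0// ltW|nra].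
have : z `^ a <= zs `^ a by apply: ge0_ler_powR; rewrite ?nnegrE ?(ltW a0) ?(ltW s0) ?(ltW z0) ?(ltW h).
by move: (zs `^ a) (z `^ a) => A1 A2 ?; have : 0 <= (zs - z) * z * (A1 - A2); [rewrite !mulr_ge0 ?subr_ge0// ltW|nra].
Qed.

Lemma weighted_young (c x y : R) : 0 < c -> x * y <= c / 2 * x ^+ 2 + y ^+ 2 / (2 * c).
Proof.
move=> c0; have -> : c / 2 * x ^+ 2 + y ^+ 2 / (2 * c) = x * y + (c * x - y) ^+ 2 / (2 * c).
  by field; rewrite gt_eqF.
by rewrite lerDl divr_ge0 ?sqr_ge0// mulr_ge0// ltW.
Qed.

Let kappa := d / (p * (p - 1)).

(** Every error term in the derivative of the functional is dominated by the
    derivative of a function that is bounded above: g1 handles v^(q-p), g2 and g3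
    the negative powers of r, and g4, a correction of (z - zs)^2 / 2 by g1 and g2,
    handles (z - zs)^2. *)
Lemma log_asymptotics : exists l : R,
  ln (v r) + beta * r + kappa * ln r @[r --> +oo] --> l.
Proof.
have s0 := limit_flux_gt0; have b0 := decay_rate_gt0.
have [CT [CT0 hCT]] := riccati_remainder_quadratic.
have [r1 [r12 v1n]] := solution_decreasing.
have zlow : \forall r \near +oo, zs / 2 < logflux r by apply: logflux_above; lra.
have zup : \forall r \near +oo, logflux r < 2 * zs by apply: logflux_below; lra.
have tail1 : \forall r \near +oo, tail r < 1 by exact: (cvgr_lt _ tail_cvg0).
have [r3 [r31 hr3]] := near_pinfty_threshold r1
  (filterI perturbation_bound (filterI tail1 (filterI zlow zup))).
pose y0 := (zs / 2) `^ a; have y00 : 0 < y0 by rewrite powR_gt0// divr_gt0.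
have facts r : r3 < r -> [/\ 2 < r, 0 < v r, 0 < logflux r, v1 r = - (logflux r `^ a * v r) & y0 <= logflux r `^ a].
  move=> rr; have [[r2 _] [_ [zl _]]] := hr3 r rr; have vr := v0 r2.
  have [z0 zy] := logflux_powR r2 (v1n _ (le_lt_trans r31 rr)); split=> //.
    by rewrite zy divfK ?gt_eqF// opprK.
  by apply: ge0_ler_powR; rewrite ?nnegrE ?(ltW a0) ?(ltW z0) ?divr_ge0 ?(ltW s0) ?(ltW zl).
have dz : derivative_beyond r3 logflux (fun r => (p - 1) * logflux r `^ (1 + a) - d / r * logflux r - perturbation r).
  by move=> r rr; apply: logflux_derive r12 v1n _ _; exact: le_lt_trans rr.
(* As -v'/v >= y0, the tail is at most a multiple of minus its derivative. *)
have qp0 : 0 < q - p by rewrite subr_gt0.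
pose g1 r := - ((q - p) * y0)^-1 * tail r.
pose dg1 r := y0^-1 * (tail r * logflux r `^ a).
have d_g1 : derivative_beyond r3 g1 dg1.
  move=> r rr; have [r2 vr z0 vE _] := facts r rr.
  have h1 := is_deriveZ (- ((q - p) * y0)^-1) (is_derive_powR_comp (q - p) vr (dv r2)).
  apply: is_derive_eq h1 _; rewrite /GRing.scale/= vE /dg1 /tail -(powRB1_mul (q - p) vr).
  by field; rewrite !gt_eqF.
have tail_dg1 r : r3 < r -> 0 <= tail r /\ tail r <= dg1 r.
  move=> rr; have [r2 vr z0 vE yy] := facts r rr; have t0 : 0 <= tail r by exact: powR_ge0.
  by split=> //; rewrite /dg1 ler_pdivlMl// mulrC ler_wpM2l.
have g1L r : g1 r <= 0 /\ True.
  split=> //; rewrite /g1 mulNr oppr_le0; apply: mulr_ge0 (powR_ge0 _ _).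
  by rewrite invr_ge0 mulr_ge0 ?(ltW qp0) ?(ltW y00).
clearbody g1 dg1.
pose g2 (r : R) := - r^-1.
have d_g2 : derivative_beyond r3 g2 (fun r => r^-1 * r^-1).
  move=> r rr; have [r2 _ _ _ _] := facts r rr; have rN0 : r != 0 by rewrite gt_eqF//; lra.
  have h := is_deriveN (@is_deriveV _ id r _ 1 rN0 (is_derive_id r 1)).
  by apply: is_derive_eq h _; rewrite /GRing.scale/= mulr1 opprK expr2 invfM.
pose g3 (r : R) := - (p - 1)^-1 * r `^ (1 - p).
have d_g3 : derivative_beyond r3 g3 (fun r => (r `^ p)^-1).
  move=> r rr; have [r2 _ _ _ _] := facts r rr; have rg0 : 0 < r by lra.
  have h := is_deriveZ (- (p - 1)^-1) (is_derive1_powR (1 - p) rg0).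
  apply: is_derive_eq h _; rewrite /GRing.scale/= (_ : 1 - p - 1 = - p); last by ring.
  by rewrite powRN; field; rewrite !gt_eqF ?powR_gt0.
have g3L r : g3 r <= 0 /\ True.
  split=> //; rewrite /g3 mulNr oppr_le0; apply: mulr_ge0 (powR_ge0 _ _).
  by rewrite invr_ge0 ltW.
clearbody g3.
pose zeta r := logflux r - zs.
pose dzeta r := (p - 1) * logflux r `^ (1 + a) - d / r * logflux r - perturbation r.
have dzeta_ r : r3 < r -> is_derive r 1 zeta (dzeta r).
  by move=> rr; rewrite -[dzeta r]subr0; exact: (is_deriveB (dz r rr) (is_derive_cst zs r 1)).
have zetaE r : zeta r = logflux r - zs by [].
have dzetaE r : dzeta r = (p - 1) * logflux r `^ (1 + a) - d / r * logflux r - perturbation r by [].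
clearbody zeta dzeta.
pose c0 := (p - 1) * zs `^ a; have c0E : c0 = (p - 1) * zs `^ a by [].
have c00 : 0 < c0 by exact: mulr_gt0 pm0 (powR_gt0 _ s0).
pose C1 := 2 * d * zs + mu.
have C10 : 0 <= C1.
  by apply: addr_ge0 mu0; apply: mulr_ge0 (ltW s0); exact: mulr_ge0 (ler0n _ 2) d0.
have C1E : C1 = 2 * d * zs + mu by [].
clearbody c0 C1.
(* The equilibrium repels at rate c0; half of it absorbs the product of z - zs
   with the errors, whose squares are paid for by g2 and g1. *)
pose g4 r := 2 / c0 * (zeta r ^+ 2 / 2 + (C1 ^+ 2 * g2 r + A ^+ 2 * g1 r) / c0).
pose dg4 r := 2 / c0 * (zeta r * dzeta r + (C1 ^+ 2 * (r^-1 * r^-1) + A ^+ 2 * dg1 r) / c0).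
have d_g4 : derivative_beyond r3 g4 dg4.
  move=> r rr.
  have h1 := dzeta_ r rr.
  have h2 : is_derive r 1 (fun r => zeta r ^+ 2 / 2) (zeta r * dzeta r).
    have := is_deriveM (is_deriveM h1 h1) (is_derive_cst (2^-1 : R) r 1).
    move=> h; apply: is_derive_eq h _; rewrite /GRing.scale/=.
    by rewrite mulr0 add0r; field.
  have h3 : is_derive r 1 (fun r => (C1 ^+ 2 * g2 r + A ^+ 2 * g1 r) / c0)
      ((C1 ^+ 2 * (r^-1 * r^-1) + A ^+ 2 * dg1 r) / c0).
    have k1 := is_deriveZ (C1 ^+ 2) (d_g2 r rr); have k2 := is_deriveZ (A ^+ 2) (d_g1 r rr).
    have := is_deriveM (is_deriveD k1 k2) (is_derive_cst (c0^-1 : R) r 1).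
    move=> h; apply: is_derive_eq h _; rewrite /GRing.scale/=.
    by rewrite mulr0 add0r mulrC.
  exact: (is_deriveZ (2 / c0) (is_deriveD h2 h3)).
have pert r : r3 < r -> True /\ `|perturbation r - m| <= mu / r `^ p + A * tail r.
  by move=> rr; have [[]] := hr3 r rr.
have rp_le r : r3 < r -> 0 < r^-1 <= 1 /\ 0 < (r `^ p)^-1 <= r^-1.
  move=> rr; have [r2 _ _ _ _] := facts r rr; have r0 : 0 < r by lra.
  split; first by rewrite invr_gt0 r0 invf_le1//; lra.
  rewrite invr_gt0 powR_gt0//= lef_pV2 ?posrE ?powR_gt0//.
  by have := @ler_powR R r _ 1 p (ltW p1); rewrite powRr1 ?(ltW r0)//; apply; lra.
have lyap r : r3 < r -> True /\ zeta r ^+ 2 <= dg4 r.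
  move=> rr; split => //; have [r2 vr z0 vE yy] := facts r rr.
  have [_ [t1 [zl zu]]] := hr3 r rr; have [t0 tdg] := tail_dg1 r rr.
  have [/andP[ri0 ri1] /andP[rp0 rp1]] := rp_le r rr.
  have gap := powR_gap z0; have [_ pb] := pert r rr.
  pose e2 := C1 * r^-1 + A * tail r.
  have e2E : e2 = C1 * r^-1 + A * tail r by [].
  clearbody e2.
  have h1 : c0 * zeta r ^+ 2 - `|zeta r| * e2 <= zeta r * dzeta r.
    have -> : zeta r * dzeta r = (p - 1) * (zeta r * (logflux r `^ (1 + a) - zs `^ (1 + a)))
       - zeta r * (d / r * logflux r + (perturbation r - m)).
      by rewrite [in LHS]dzetaE -[in RHS]limit_flux_eq; ring.
    apply: lerB; first by rewrite c0E -mulrA ler_wpM2l ?(ltW pm0)// zetaE.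
    apply: (le_trans (ler_norm _)); rewrite normrM ler_wpM2l//.
    apply: (le_trans (ler_normD _ _)).
    have n1 : `|d / r * logflux r| <= 2 * d * zs * r^-1.
      rewrite ger0_norm; last exact: mulr_ge0 (mulr_ge0 d0 (ltW ri0)) (ltW z0).
      have -> : 2 * d * zs * r^-1 = d / r * (2 * zs) by ring.
      exact: ler_wpM2l (mulr_ge0 d0 (ltW ri0)) _ _ (ltW zu).
    have n2 : mu / r `^ p <= mu * r^-1 by rewrite ler_wpM2l.
    rewrite e2E C1E mulrDl; move: n1 n2 pb; lra.
  have h2 : `|zeta r| * e2 <= c0 / 2 * zeta r ^+ 2 + e2 ^+ 2 / (2 * c0).
    by rewrite -[zeta r ^+ 2]real_normK ?num_real//; exact: weighted_young.
  have h3 : e2 ^+ 2 <= 2 * (C1 ^+ 2 * (r^-1 * r^-1) + A ^+ 2 * dg1 r).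
    have tt : tail r ^+ 2 <= dg1 r by apply: le_trans tdg; rewrite expr2 ler_piMl// ltW.
    have A2 : A ^+ 2 * tail r ^+ 2 <= A ^+ 2 * dg1 r by rewrite ler_wpM2l ?sqr_ge0.
    have : e2 ^+ 2 <= 2 * ((C1 * r^-1) ^+ 2 + (A * tail r) ^+ 2).
      rewrite e2E; move: (C1 * r^-1) (A * tail r) => s t.
      by have := sqr_ge0 (s - t); nra.
    rewrite !exprMn -[r^-1 * r^-1]expr2; move: A2; lra.
  have h4 : e2 ^+ 2 / (2 * c0) <= (C1 ^+ 2 * (r^-1 * r^-1) + A ^+ 2 * dg1 r) / c0.
    rewrite invfM mulrA; apply: ler_wpM2r; first by rewrite invr_ge0 ltW.
    by rewrite ler_pdivrMr// mulrC.
  have h5 : c0 / 2 * zeta r ^+ 2 <= zeta r * dzeta r + (C1 ^+ 2 * (r^-1 * r^-1) + A ^+ 2 * dg1 r) / c0.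
    move: h1 h2 h4.
    have -> : c0 * zeta r ^+ 2 = c0 / 2 * zeta r ^+ 2 + c0 / 2 * zeta r ^+ 2.
      by rewrite -mulrDl -splitr.
    by lra.
  rewrite /dg4 -ler_pdivrMl ?divr_gt0//.
  by have -> : (2 / c0)^-1 = c0 / 2 by rewrite invfM invrK mulrC.
(* The factor p (p - 1) zs is the one for which z cancels the linear part. *)
pose FF r := p * (p - 1) * zs * (ln (v r) + beta * r + kappa * ln r) + logflux r.
pose dFF r := p * (p - 1) * zs * (- logflux r `^ a + beta + kappa / r) + dzeta r.
have d_FF : derivative_beyond r3 FF dFF.
  move=> r rr; have [r2 vr z0 vE yy] := facts r rr; have r0 : 0 < r by lra.
  have k1 : is_derive r 1 (fun r => ln (v r)) (- logflux r `^ a).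
    have h := @is_derive1_comp R (@ln R) v r _ _ (is_derive1_ln vr) (dv r2).
    by apply: is_derive_eq h _; rewrite vE; field; rewrite gt_eqF.
  have k2 : is_derive r 1 (fun r => beta * r) beta.
    by apply: is_derive_eq (is_deriveZ beta (is_derive_id r 1)) _; rewrite /GRing.scale/= mulr1.
  have k3 : is_derive r 1 (fun r => kappa * ln r) (kappa / r).
    exact: (is_deriveZ kappa (is_derive1_ln r0)).
  rewrite /dFF dzetaE.
  exact: (is_deriveD (is_deriveZ (p * (p - 1) * zs) (is_deriveD (is_deriveD k1 k2) k3)) (dz r rr)).
pose GG r := (CT + d) * g4 r + d * g2 r + mu * g3 r + A * g1 r.
pose dGG r := (CT + d) * dg4 r + d * (r^-1 * r^-1) + mu * (r `^ p)^-1 + A * dg1 r.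
have d_GG : derivative_beyond r3 GG dGG.
  move=> r rr.
  have k1 := is_deriveZ (CT + d) (d_g4 r rr); have k2 := is_deriveZ d (d_g2 r rr).
  have k3 := is_deriveZ mu (d_g3 r rr); have k4 := is_deriveZ A (d_g1 r rr).
  exact: (is_deriveD (is_deriveD (is_deriveD k1 k2) k3) k4).
have bound r : r3 < r -> `|dFF r| <= dGG r.
  move=> rr; have [r2 vr z0 vE yy] := facts r rr; have [t0 tdg] := tail_dg1 r rr.
  have [_ [_ [zl zu]]] := hr3 r rr; have [/andP[ri0 ri1] _] := rp_le r rr.
  have -> : dFF r = riccati_remainder (logflux r) - (perturbation r - m) - d * zeta r * r^-1.
    have e : p * (p - 1) * zs * (kappa / r) = d * zs / r.
      by rewrite /kappa; field; rewrite !gt_eqF//; lra.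
    rewrite /dFF /riccati_remainder dzetaE mulrDr e zetaE; ring.
  have [_ l0] := lyap r rr; have [_ pb] := pert r rr.
  have q1 : `|riccati_remainder (logflux r)| <= CT * dg4 r.
    apply: (@le_trans _ _ (CT * zeta r ^+ 2)); last exact: ler_wpM2l.
    by rewrite zetaE; apply: hCT; rewrite (ltW zl) (ltW zu).
  have q2 : `|d * zeta r * r^-1| <= d * dg4 r + d * (r^-1 * r^-1).
    rewrite -mulrA normrM (ger0_norm d0) -mulrDr ler_wpM2l//.
    rewrite normrM (gtr0_norm ri0); apply: (@le_trans _ _ (`|zeta r| ^+ 2 + r^-1 * r^-1)).
      by have := sqr_ge0 (`|zeta r| - r^-1); have := normr_ge0 (zeta r); nra.
    by rewrite lerD2r real_normK ?num_real.
  have q3 : A * tail r <= A * dg1 r by rewrite ler_wpM2l ?(ltW A0).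
  have t1 := ler_normB (riccati_remainder (logflux r) - (perturbation r - m)) (d * zeta r * r^-1).
  have t2 := ler_normB (riccati_remainder (logflux r)) (perturbation r - m).
  by rewrite /dGG mulrDl; move: q1 q2 q3 t1 t2 pb; lra.
have GL r : r3 < r -> GG r <= (CT + d) * (2 / c0 * (zs ^+ 2 / 2)).
  move=> rr; have [r2 vr z0 vE yy] := facts r rr; have [/andP[ri0 ri1] _] := rp_le r rr.
  have [_ [_ [zl zu]]] := hr3 r rr.
  have u1 : d * g2 r <= 0 by rewrite /g2 mulrN oppr_le0 mulr_ge0// ltW.
  have [h1 _] := g1L r; have [h3 _] := g3L r.
  have u2 : mu * g3 r <= 0 by exact: mulr_ge0_le0.
  have u3 : A * g1 r <= 0 by exact: mulr_ge0_le0 (ltW A0) h1.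
  have u4 : g4 r <= 2 / c0 * (zs ^+ 2 / 2).
    rewrite /g4 ler_wpM2l ?divr_ge0 ?(ltW c00)//.
    have : zeta r ^+ 2 <= zs ^+ 2 by rewrite zetaE; nra.
    have : (C1 ^+ 2 * g2 r + A ^+ 2 * g1 r) / c0 <= 0.
      rewrite pmulr_lle0 ?invr_gt0// -[leRHS]addr0; apply: lerD.
        by rewrite mulr_ge0_le0 ?sqr_ge0// /g2 oppr_le0 ltW.
      by rewrite mulr_ge0_le0 ?sqr_ge0.
    by lra.
  have u5 : (CT + d) * g4 r <= (CT + d) * (2 / c0 * (zs ^+ 2 / 2)).
    by rewrite ler_wpM2l// addr_ge0.
  by rewrite /GG; move: u1 u2 u3 u5; lra.
have [l Fl] := dominated_derivative_cvg d_FF d_GG bound GL.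
have zcvg : logflux r @[r --> +oo] --> zs.
  apply/cvgrPdist_lt => e e0.
  have n1 : \forall r \near +oo, Num.max (zs / 2) (zs - e) < logflux r.
    by apply: logflux_above; [rewrite lt_max divr_gt0|rewrite gt_max; apply/andP; split; lra].
  have n2 : \forall r \near +oo, logflux r < zs + e by apply: logflux_below; rewrite ltrDl.
  near=> r.
  have h1 : Num.max (zs / 2) (zs - e) < logflux r by near: r.
  have h2 : logflux r < zs + e by near: r.
  move: h1; rewrite gt_max => /andP[_ h1]; rewrite distrC ltr_norml.
  by apply/andP; split; lra.
have K0 : p * (p - 1) * zs != 0 by rewrite !mulf_neq0 ?gt_eqF.
exists ((p * (p - 1) * zs)^-1 * (l - zs)).
have -> : (fun r => ln (v r) + beta * r + kappa * ln r) =
    (fun r => (p * (p - 1) * zs)^-1 * (FF r - logflux r)).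
  by apply/funext => r; rewrite /FF addrK mulrA mulVf ?mul1r.
by apply: cvgMr; exact: cvgB.
Unshelve. all: by end_near. Qed.

End decay_ode.

(** * The limit at infinity *)

(** A superior limit at most A leaves room for A + 1 near 0. *)
Lemma limf_esup_bound_right (R : realType) (f : R -> R) (q A : R) : 0 < A ->
  (limf_esup (fun t : R => (`|f t| / `|t| `^ (q - 1))%:E)%R 0%R^' <= A%:E)%E ->
  exists2 delta : R, 0 < delta & forall t, 0 < t -> t < delta -> `|f t| <= (A + 1) * t `^ (q - 1).
Proof.
move=> A0 h.
have : (limf_esup (fun t : R => (`|f t| / `|t| `^ (q - 1))%:E)%R 0%R^' < (A + 1)%:E)%E.
  by apply: le_lt_trans h _; rewrite lte_fin ltrDl.
rewrite limf_esupE => /ereal_inf_lt[_ [U [e /= e0 he] <-]] hU.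
exists e => // t t0 te; have Ut : U t.
  by apply: he; rewrite /ball_/= ?sub0r ?normrN ?gtr0_norm ?gt_eqF.
have : ((`|f t| / `|t| `^ (q - 1))%:E <= (A + 1)%:E)%E.
  by apply: le_trans (ltW hU); apply: ereal_sup_ubound; exists t.
by rewrite lee_fin (gtr0_norm t0) ler_pdivrMr// powR_gt0.
Qed.

Theorem theorem1p2 (R : realType) (N : nat) (p m mu q A : R) (f : R -> R)
    (u : 'rV[R]_N -> R)
    (hp : 1 < p) (hpN : p < N%:R) (hm : 0 < m)
    (hmu0 : 0 <= mu) (hmu : mu < ((N%:R - p) / p) `^ p)
    (hf : continuous f) (hq : p < q) (hA : 0 < A)
    (hf0 : (limf_esup (fun t : R => (`|f t| / `|t| `^ (q - 1))%:E)%R 0%R^'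
            <= A%:E)%E)
    (hfoo : (limf_esup (fun t : R => (`|f t| / `|t| `^ (pstar N p - 1))%:E)%R
               (norm_infty (fun t : R => `|t|%R))
             <= A%:E)%E)
    (hrad : radial u) (hcont : forall x, x != 0 -> {for x, continuous u})
    (hpos : forall x, x != 0 -> 0 < u x)
    (hsol : weak_solution p mu m f u) :
  exists C : R, 0 < C /\
    u x * enorm x `^ ((N%:R - 1) / (p * (p - 1)))
        * expR ((m / (p - 1)) `^ p^-1 * enorm x)
      @[x --> norm_infty enorm] --> C.
Proof.
case: N u hpN hmu hfoo hrad hcont hpos hsol => [|[|n]] u hpN hmu hfoo hrad hcont hpos hsol.
(* 1 < p < N excludes the dimensions 0 and 1. *)
- by have := lt_trans hp hpN; rewrite ltr10.
- by have := lt_trans hp hpN; rewrite ltxx.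
have [delta delta0 fA] := limf_esup_bound_right hA hf0.
have [v1 [E [L [dv dP dE EL]]]] := radial_equation hrad hcont hp hf hsol hpos.
pose v (r : R) := profile u (r ^+ 2).
have v0 (r : R) : 2 < r -> 0 < v r.
  by move=> r2; apply: profile_gt0 => //; rewrite exprn_gt0//; lra.
have A1 : 0 < A + 1 by lra.
have [l hl] := log_asymptotics hp hm hmu0 hq (ler0n R n.+1) A1 delta0 fA v0 dv dP dE EL.
exists (expR l); split; first exact: expR_gt0.
have cexp : expR (ln (v r) + decay_rate p m * r + n.+1%:R / (p * (p - 1)) * ln r) @[r --> +oo] --> expR l.
  by apply: continuous_cvg hl; exact: continuous_expR.
have norm_oo : enorm x @[x --> norm_infty (@enorm R n.+2)] --> +oo.
  by move=> P [M [_ hM]]; exists M => x /= /hM.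
have := cvg_comp _ _ norm_oo cexp.
apply: cvg_trans; apply: near_eq_cvg; exists 2 => x /= x2.
have x0 : 0 < enorm x by lra.
have ux : u x = v (enorm x) by rewrite (profileE hrad) /v /enorm sqr_sqrtr// nsq_ge0.
have -> : n.+2%:R - 1 = n.+1%:R :> R by rewrite -[n.+2%:R]natr1 addrK.
rewrite !expRD lnK ?posrE ?v0// -ux mulrAC; congr (_ * _ * _).
by rewrite /powR gt_eqF.
Qed.
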